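(* Let $k, s$ be integers with $2 \le k < s$, $s \ge 5k^2$ and $s \not\equiv 0 \pmod k$. Then for every $\gamma > 0$ there exists $n_0 = n_0(k,s,\gamma)$ such that for all $n \ge n_0$ with $n \equiv 0 \pmod s$, \[ t_{k-1}(n, C^k_s) \le \left( \tfrac12 + \tfrac{1}{2s} + \gamma\right) n. \]
   Context: A $k$-graph is a $k$-uniform hypergraph. For a $k$-graph $H$, $\delta_{k-1}(H)$ (minimum codegree) is the minimum, over all $(k-1)$-element vertex sets $S$, of the number of edges containing $S$. For $s \ge k$, the tight cycle $C^k_s$ is the $k$-graph on $s$ vertices admitting a cyclic ordering of its vertices such that every $k$ consecutive vertices form an edge (and these are its edges). For a $k$-graph $F$, a perfect $F$-tiling of $H$ is a collection of vertex-disjoint copies of $F$ in $H$ covering all vertices of $H$. The tiling threshold $t_{k-1}(n,F)$ is the maximum of $\delta_{k-1}(H)$ over all $k$-graphs $H$ on $n$ vertices that have no perfect $F$-tiling. *)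

(* Defs.v *)
From mathcomp Require Import all_boot all_order all_algebra.
From mathcomp Require Import reals.

Set Implicit Arguments.
Unset Strict Implicit.
Unset Printing Implicit Defensive.

(* A hypergraph on the vertex type V is given by its set of edges. *)
Definition hypergraph (V : finType) := {set {set V}}.

Section Hypergraphs.
Variable V : finType.
Implicit Types (H : hypergraph V) (S e : {set V}).

Definition uniform (k : nat) H : bool := [forall e in H, #|e| == k].

Definition codegree H S : nat := #|[set e in H | S \subset e]|.

(* In a k-graph every (k-1)-set lies in at most #|V| edges, so starting the
   minimum at #|V| does not affect it as soon as some (k-1)-set exists. *)
Definition min_codegree (k : nat) H : nat :=
  \big[minn/#|V|]_(S : {set V} | #|S| == k.-1) codegree H S.

(* A copy of F in H, not necessarily induced, is given by an injection of the
   vertices of F into those of H that sends edges to edges. *)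
Definition is_copy (U : finType) (F : hypergraph U) H (f : {ffun U -> V}) :
    bool :=
  injectiveb f && [forall e in F, (f @: e) \in H].

Definition copy_vertices (U : finType) (f : {ffun U -> V}) : {set V} :=
  f @: [set: U].

Definition is_perfect_tiling (U : finType) (F : hypergraph U) H
    (T : {set {ffun U -> V}}) : bool :=
  [&& [forall f in T, is_copy F H f],
      [forall f in T, forall g in T,
         (f != g) ==> [disjoint copy_vertices f & copy_vertices g]] &
      \bigcup_(f in T) copy_vertices f == [set: V]].

Definition has_perfect_tiling (U : finType) (F : hypergraph U) H : bool :=
  [exists T : {set {ffun U -> V}}, is_perfect_tiling F H T].

End Hypergraphs.

(* ordS is the successor modulo s; the edges are the s cyclic intervals
   {i, i+1, ..., i+k-1}. *)
Definition tight_cycle (k s : nat) : hypergraph 'I_s :=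
  [set [set iter j (@ordS s) i | j : 'I_k] | i : 'I_s].

(* The threshold t_{k-1}(n, F). As the quantities involved are invariant under
   isomorphism, it is enough to consider the k-graphs on 'I_n. When n > 0 and
   F has an edge, the edgeless k-graph has no perfect F-tiling, so the maximum
   is over a nonempty set. *)
Definition tiling_threshold (k n : nat) (U : finType) (F : hypergraph U) :
    nat :=
  \max_(H : hypergraph 'I_n | uniform k H && ~~ has_perfect_tiling F H)
     min_codegree k H.

(* Main.v *)
(* Walk around the blow-up of an edge of H.  A common neighbour of two of its
   (k-1)-subsets can be used to exchange two labels of the walk, so that a product
   of fewer than 2k transpositions realizes the shift by s mod k needed to close a
   tight cycle of length s.

   Absorption: any two vertices x, z lie in pattern tuples in which a vertex can
   stand in for either of them, so that positively many (s-1)-sets complete both to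
   a tight cycle.  This gives absorbers, and a linear number of disjoint ones is
   chosen greedily with respect to the sum over s-tuples Q of exp(- number of
   absorbers of Q).

   Almost perfect tiling: for every weight on the uncovered vertices there is a copy
   whose weight is at most about the average.  To see it, take k-1 labels among the
   lightest vertices, the last label of relative rank about 1/2 - 1/(2s), and the
   swapping vertices of rank 3/4, except possibly one of rank 1 - 1/s.  Among any
   three labels two can be swapped cheaply, so the labels split into two classes and
   one expensive swap is enough.  Copies are removed one by one, light for the weight
   derived from the sum over (k-1)-sets S of exp(- lambda * uncovered share of N(S)),
   which keeps the codegree condition inside the uncovered part. *)
Require Import Defs.
From mathcomp Require Import all_boot all_order all_fingroup all_algebra.
From mathcomp Require Import reals sequences exp.
From mathcomp Require Import zify ring lra.

Set Implicit Arguments.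
Unset Strict Implicit.
Unset Printing Implicit Defensive.

Import Order.TTheory GRing.Theory Num.Theory.
Local Open Scope ring_scope.

(** * Counting tuples one coordinate at a time *)

(** The threshold comes from matching two sets of numbers. Split vertex weights into increments
    between thresholds of given ranks. A copy is no heavier than average if, for ranks t = 1/2 -
    1/(2s), 3/4 and 1 - 1/s, at most s(1 - t) of its vertices lie above the preceding threshold: (s
    + 1)/2, s/4 and 1 of them. The last label occurs at most floor(s/k) times and there are at most
    2k - 3 swapping vertices; for k = 2, where s is odd, their sum is exactly (s + 1)/2, whence the
    1/(2s). Conversely, codegree above 1/2 + 1/(2s) is what makes one neighbourhood meet every set
    of density 1/2 - 1/(2s), and two neighbourhoods meet inside every set of density 1 - 1/s; and of
    three neighbourhoods of density above 1/2, two must meet inside every set of density 3/4. Light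
    copies for all weights take the place of linear programming duality for fractional tilings, and
    exponential sums that of concentration inequalities. Tuples are always found with positive
    density, because only then can the pattern be blown up to a walk with distinct vertices. *)

Lemma card_sum_put (T V : finType) (get : T -> V) (put : T -> V -> T)
    (P : pred T) :
  (forall t x, get (put t x) = x) -> (forall t, put t (get t) = t) ->
  (forall t x y, put (put t x) y = put t y) ->
  (#|P| * #|V| = \sum_t #|[pred x | P (put t x)]|)%N.
Proof.
move=> getK putK putput.
(* Swapping the written value with the stored one is an involution on pairs; it turns the condition
   on [t] into the condition on [put t x]. *)
pose inv (q : T * V) := (put q.1 q.2, get q.1).
have invK : involutive inv by case=> t x; rewrite /inv /= putput getK putK.
rewrite -sum1_card big_distrl /=.
under eq_bigr do rewrite mul1n -sum1_card.
under [RHS]eq_bigr do rewrite -sum1_card.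
rewrite !pair_big_dep /= (reindex_inj (inv_inj invK)) /=.
by apply: eq_bigl => -[t x]; rewrite !inE !andbT.
Qed.

Definition upd (I : finType) (V : Type) (g : {ffun I -> V}) (i : I) (v : V) :
  {ffun I -> V} := [ffun j => if j == i then v else g j].

Section Update.
Variables (I : finType) (V : Type).
Implicit Types (g : {ffun I -> V}).

Lemma upd_same g i v : upd g i v i = v.
Proof. by rewrite ffunE eqxx. Qed.

Lemma upd_neq g i j v : j != i -> upd g i v j = g j.
Proof. by rewrite ffunE => /negbTE ->. Qed.

Lemma upd_id g i : upd g i (g i) = g.
Proof. by apply/ffunP => j; rewrite ffunE; case: eqP => // ->. Qed.

Lemma upd_upd g i v w : upd (upd g i v) i w = upd g i w.
Proof. by apply/ffunP => j; rewrite !ffunE; case: eqP. Qed.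
End Update.

Lemma card_sum_upd (I V : finType) (P : pred {ffun I -> V}) (i : I) :
  (#|P| * #|V| = \sum_g #|[pred x | P (upd g i x)]|)%N.
Proof.
apply: (card_sum_put (get := fun g : {ffun I -> V} => g i)) => *.
- exact: upd_same.
- exact: upd_id.
- exact: upd_upd.
Qed.

Section Sequential.
Variables (R : realFieldType) (I V : finType) (C : I -> pred {ffun I -> V}).
Variables (rk : I -> nat) (c : R).
Hypothesis c_ge0 : 0 <= c.
Hypothesis C_upd : forall i j g v, j != i -> (rk j <= rk i)%N ->
  C j (upd g i v) = C j g.
Hypothesis C_ext : forall i g, (forall j, (rk j < rk i)%N -> C j g) ->
  c * #|V|%:R <= #|[pred v | C i (upd g i v)]|%:R.

Let downc (A : {set I}) := forall i j, j \in A -> (rk i < rk j)%N -> i \in A.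
Let all_C (A : {set I}) := [pred g | [forall j in A, C j g]].

(** By [C_upd], the condition [C j] reads only coordinate [j] and coordinates of smaller rank.
    Coordinates are therefore fixed in increasing rank, each with at least c|V| choices, while the
    others stay free, so that one coordinate at a time can be resampled. *)
Lemma card_sequential : c ^+ #|I| * #|V|%:R ^+ #|I| <= #|[pred g | [forall j, C j g]]|%:R.
Proof.
suff H m (A : {set I}) : #|A| = m -> downc A -> c ^+ #|A| * #|V|%:R ^+ #|I| <= #|all_C A|%:R.
  have := H _ [set: I] erefl (fun _ _ _ _ => in_setT _); rewrite cardsT.
  move=> /le_trans; apply; rewrite ler_nat.
  apply/subset_leq_card/subsetP => g /forall_inP gC.
  by apply/forallP => j; apply: gC; rewrite inE.
elim: m A => [A /eqP|m IHm A cA dA].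
  rewrite cards_eq0 => /eqP -> _; rewrite cards0 expr0 mul1r -natrX -card_ffun.
  rewrite ler_nat; apply/subset_leq_card/subsetP => g _.
  by apply/forall_inP => j; rewrite inE.
have /card_gt0P[i0 i0A] : (0 < #|A|)%N by rewrite cA.
(* Removing a coordinate of maximal rank leaves a set closed downwards, none of whose conditions
   reads [i]. *)
case: (@arg_maxnP _ i0 (mem A) rk i0A) => i /= iA imax; rewrite -/(i \in A) in iA.
pose B := A :\ i.
have cB : #|B| = m by move: cA; rewrite (cardsD1 i) iA => -[].
have dB : downc B.
  move=> a b; rewrite !inE => /andP[bi bA] ab; rewrite (dA _ _ bA ab) andbT.
  apply: contraTneq ab => ->; rewrite -leqNgt; exact: imax.
have := IHm B cB dB.
have [V0|V0] := posnP #|V|.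
  have I0 : (0 < #|I|)%N by apply/card_gt0P; exists i.
  by move=> _; rewrite V0 -(prednK I0) exprS mul0r mulr0 ler0n.
have V0R : (0 : R) < #|V|%:R by rewrite ltr0n.
move=> IH; rewrite -(ler_pM2r V0R) -natrM (card_sum_upd _ i).
have -> : c ^+ #|A| * #|V|%:R ^+ #|I| * #|V|%:R =
    c * #|V|%:R * (c ^+ #|B| * #|V|%:R ^+ #|I|).
  by rewrite (cardsD1 i) iA exprS; ring.
apply: (@le_trans _ _ (c * #|V|%:R * #|all_C B|%:R)).
  by apply: ler_wpM2l => //; rewrite mulr_ge0 // ler0n.
rewrite -[#|all_C B|]sum1_card natr_sum mulr_sumr natr_sum.
rewrite [leRHS](bigID (mem (all_C B))) /= -[leLHS]addr0; apply: lerD; last first.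
  by apply: sumr_ge0 => *; rewrite ler0n.
apply: ler_sum => g /forall_inP gB; rewrite mulr1.
apply: le_trans (C_ext (i := i) (g := g) _) _.
  move=> j ji; apply: gB; rewrite !inE (dA _ _ iA ji) andbT.
  by apply: contraTneq ji => ->; rewrite ltnn.
rewrite ler_nat; apply/subset_leq_card/subsetP => v; rewrite !inE => Civ.
apply/forall_inP => j jA; have [->//|ji] := eqVneq j i.
by rewrite C_upd //; [apply: gB; rewrite !inE ji|apply: imax].
Qed.
End Sequential.

(** * Blow-ups of dense families of tuples *)

(** Convexity of the power function. Multiplying the previous bound by [x] leaves the surplus (m +
    1) a^m (x - a)^2. *)
Lemma tangent_le_exp (R : realFieldType) (x a : R) (m : nat) :
  0 <= x -> 0 <= a ->
  a ^+ m.+1 + m.+1%:R * a ^+ m * (x - a) <= x ^+ m.+1.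
Proof.
move=> x0 a0; elim: m => [|m IH]; first by rewrite !expr1 expr0; lra.
have am : 0 <= a ^+ m by rewrite exprn_ge0.
have m0 : (0 : R) <= m%:R by rewrite ler0n.
rewrite [x ^+ _]exprS; apply: le_trans (ler_wpM2l x0 IH).
have : 0 <= m.+1%:R * a ^+ m * (x - a) ^+ 2.
  by apply: mulr_ge0; [apply: mulr_ge0 => //; exact: ler0n|exact: sqr_ge0].
rewrite [m.+2%:R]mulrS; move: (m.+1%:R : R) => M H.
by rewrite !exprS in H *; nra.
Qed.

(** Tangents at the mean [a] are summed; their linear terms cancel. *)
Lemma power_mean (R : realFieldType) (Y : finType) (d : Y -> R) (m : nat) :
  (forall y, 0 <= d y) ->
  (\sum_y d y) ^+ m.+1 <= #|Y|%:R ^+ m * \sum_y d y ^+ m.+1.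
Proof.
move=> d0; have [Y0|Y0] := posnP #|Y|.
  rewrite big1 ?expr0n /=; last first.
    by move=> y _; move: (card0_eq Y0 y); rewrite inE.
  by rewrite mulr_ge0 ?exprn_ge0 ?ler0n // sumr_ge0 // => y _; rewrite exprn_ge0.
have YR : (0 : R) < #|Y|%:R by rewrite ltr0n.
set S := \sum_y d y; have S0 : 0 <= S by exact: sumr_ge0.
pose a := S / #|Y|%:R; have a0 : 0 <= a by rewrite divr_ge0 // ltW.
have Sa : S = #|Y|%:R * a by rewrite /a mulrC divfK // gt_eqF.
rewrite {1}Sa exprMn exprSr -mulrA ler_wpM2l ?exprn_ge0 ?ler0n //.
apply: (@le_trans _ _
  (\sum_y (a ^+ m.+1 + m.+1%:R * a ^+ m * (d y - a)))); last first.
  by apply: ler_sum => y _; exact: tangent_le_exp.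
rewrite big_split /= -mulr_sumr sumrB -/S !sumr_const.
by rewrite -[X in S - X]mulr_natl cardT -cardE -Sa subrr mulr0 addr0 mulr_natl.
Qed.

Lemma card_fixed_coordinate (J V : finType) (j : J) (F : pred V) :
  (#|[pred h : {ffun J -> V} | F (h j)]| * #|V| = #|V| ^ #|J| * #|F|)%N.
Proof.
rewrite (card_sum_upd _ j) -[in RHS]card_ffun -sum_nat_const.
apply: eq_bigr => g _; apply: eq_card => x.
by rewrite !inE upd_same.
Qed.

Definition section_of (I J V : finType) (g : {ffun I -> {ffun J -> V}})
  (f : {ffun I -> J}) : {ffun I -> V} := [ffun i => g i (f i)].

Section Blowup.
Variables (R : realFieldType) (I J V : finType) (P : pred {ffun I -> V}).
Variables (c : R) (j0 : J).
Hypothesis c_ge0 : 0 <= c.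
Hypothesis V_gt0 : (0 < #|V|)%N.
Hypothesis P_dense : c * #|V|%:R ^+ #|I| <= #|P|%:R.

(* The coordinates are blown up one at a time; those outside A still use only
   the copy j0. *)
Let partial_blowup (A : {set I}) := [pred g : {ffun I -> {ffun J -> V}} |
  [forall f : {ffun I -> J},
     [forall i, (i \in A) || (f i == j0)] ==> P (section_of g f)]].

Let N : nat := #|{ffun I -> {ffun J -> V}}|.

Lemma card_partial_blowup0 : c * N%:R <= #|partial_blowup set0|%:R.
Proof.
have Vn0 : (#|V|%:R : R) != 0 by rewrite pnatr_eq0 -lt0n.
have VI : 0 < (#|V|%:R : R) ^+ #|I| by rewrite exprn_gt0 // ltr0n.
suff H : (#|partial_blowup set0| * #|V| ^ #|I| = #|P| * N)%N.
  have H' := congr1 (fun x : nat => x%:R : R) H; rewrite !natrM natrX in H'.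
  by rewrite -(ler_pM2r VI) H' mulrAC ler_wpM2r ?ler0n.
pose pr (g : {ffun I -> {ffun J -> V}}) := section_of g [ffun=> j0].
have -> : #|partial_blowup set0| = #|[pred g | P (pr g)]|.
  apply: eq_card => g; rewrite !inE; apply/forallP/idP => [/(_ [ffun=> j0])|].
    by move=> /implyP; apply; apply/forallP => i; rewrite ffunE eqxx orbT.
  move=> Pg f; apply/implyP => /forallP fj.
  rewrite (_ : f = [ffun=> j0]) //; apply/ffunP => i; rewrite ffunE.
  by have := fj i; rewrite inE => /eqP.
have fib p : (#|[pred g | pr g == p]| * #|V| ^ #|I| = N)%N.
  have -> : #|[pred g | pr g == p]| =
      #|family (fun i => [pred h : {ffun J -> V} | h j0 == p i])|.
    apply: eq_card => g; rewrite !inE; apply/eqP/forallP => [<- i|H].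
      by rewrite !inE !ffunE.
    by apply/ffunP => i; rewrite !ffunE; have := H i; rewrite !inE => /eqP.
  rewrite card_family foldrE big_map big_enum /= -prod_nat_const -big_split /=.
  rewrite /N card_ffun -prod_nat_const; apply: eq_bigr => i _.
  by rewrite (card_fixed_coordinate j0 (pred1 (p i))) card1 muln1 card_ffun.
rewrite -[#|P|]sum1_card -[#|[pred g | P _]|]sum1_card.
rewrite (partition_big pr P) //= !big_distrl /=; apply: eq_bigr => p Pp.
rewrite mul1n -(fib p); congr (_ * _)%N; rewrite -sum1_card; apply: eq_bigl => g.
by rewrite !inE; case: eqP => [->|]; rewrite ?andbF ?andbT.
Qed.

(** Blowing up one more coordinate raises the number of its admissible values, for each choice of
    the others, to the power |J|; by the power mean inequality density d becomes at least d^|J|.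
    This is the classical argument for complete multipartite patterns. *)
Lemma card_partial_blowup (A : {set I}) :
  c ^+ (#|J| ^ #|A|) * N%:R <= #|partial_blowup A|%:R.
Proof.
elim: {A}#|A| {-2}A (erefl #|A|) => [A /eqP|m IHm A cA].
  by rewrite cards_eq0 => /eqP ->; rewrite cards0 expr1; exact: card_partial_blowup0.
have /card_gt0P[i iA] : (0 < #|A|)%N by rewrite cA.
pose B := A :\ i; have iB : i \notin B by rewrite !inE eqxx.
have AB : A = i |: B by rewrite setD1K.
have cB : #|B| = m by move: cA; rewrite (cardsD1 i) iA => -[].
have := IHm B cB; rewrite cB cA.
(* Admissible values at coordinate [i]: the blow-up of [B] tests only the copy [j0] there, that of
   [A] all |J| copies. *)
pose Rg g := [pred v | partial_blowup B (upd g i [ffun=> v])].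
have H1 g h : partial_blowup A (upd g i h) = [forall j, Rg g (h j)].
  apply/forallP/forallP => H => [j|f].
    apply/forallP => f; apply/implyP => /forallP fB.
    have := H (upd f i j) => /implyP.
    rewrite (_ : section_of _ _ = section_of (upd g i [ffun=> h j]) f).
      apply; apply/forallP => a; rewrite AB !inE.
      have [->|ai] //= := eqVneq a i; rewrite upd_neq //.
      by have := fB a; rewrite !inE ai.
    apply/ffunP => a; have [->|ai] := eqVneq a i; rewrite !ffunE ?eqxx ?ffunE //.
    by rewrite (negbTE ai).
  apply/implyP => /forallP fA.
  have := H (f i) => /forallP/(_ (upd f i j0))/implyP.
  rewrite (_ : section_of _ _ = section_of (upd g i h) f).
    apply; apply/forallP => a; have [->|ai] := eqVneq a i.
      by rewrite upd_same eqxx orbT.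
    by rewrite upd_neq //; have := fA a; rewrite AB !inE (negbTE ai).
  apply/ffunP => a; have [->|ai] := eqVneq a i; rewrite !ffunE ?eqxx ?ffunE //.
  by rewrite (negbTE ai).
have H2 g h : partial_blowup B (upd g i h) = Rg g (h j0).
  apply: eq_forallb => f; case: (boolP [forall _, _]) => //= /forallP fB.
  congr P; apply/ffunP => a; have [->|ai] := eqVneq a i; last first.
    by rewrite !ffunE (negbTE ai).
  by rewrite !ffunE eqxx ffunE; have := fB i; rewrite (negbTE iB) => /eqP ->.
have J0 : (0 < #|J|)%N by apply/card_gt0P; exists j0.
have S1 : (#|partial_blowup A| * #|V| ^ #|J| = \sum_g #|Rg g| ^ #|J|)%N.
  rewrite -card_ffun (card_sum_upd _ i); apply: eq_bigr => g _.
  rewrite -card_ffun_on; apply: eq_card => h.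
  rewrite -[LHS]/(partial_blowup A (upd g i h)) H1.
  by apply: eq_forallb => j.
have S2 : (#|partial_blowup B| * #|V| = \sum_g #|Rg g|)%N.
  have VJ : (0 < #|V| ^ #|J|)%N by rewrite expn_gt0 V_gt0.
  apply/eqP; rewrite -(eqn_pmul2r VJ) mulnAC -[(#|V| ^ _)%N]card_ffun.
  rewrite (card_sum_upd _ i) !big_distrl /=; apply/eqP/eq_bigr => g _.
  rewrite card_ffun [RHS]mulnC -(card_fixed_coordinate j0 (Rg g)); congr (_ * _)%N.
  by apply: eq_card => h; rewrite !inE -[LHS]/(partial_blowup B (upd g i h)) H2.
move=> IH.
have V0 : (0 : R) < #|V|%:R by rewrite ltr0n.
have N0 : (0 : R) < N%:R by rewrite ltr0n /N !card_ffun !expn_gt0 V_gt0.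
have := @power_mean R _ (fun g => #|Rg g|%:R) #|J|.-1 (fun g => ler0n _ _).
rewrite -natr_sum -S2 prednK //.
under eq_bigr do rewrite -natrX.
rewrite -natr_sum -S1 -/N !natrM natrX exprMn mulrA ler_pM2r ?exprn_gt0 // => PM.
rewrite -(ler_pM2l (exprn_gt0 #|J|.-1 N0)); apply: le_trans PM.
rewrite expnSr exprM mulrCA -exprSr prednK // -exprMn.
by apply: lerXn2r => //; rewrite nnegrE ?ler0n // mulr_ge0 ?exprn_ge0 ?ler0n.
Qed.

(** Position [j] reads its own copy [j] of coordinate [phi j], so no two positions share an entry of
    [g]. The projection to the entries read has fibres of equal size, hence density survives. *)
Lemma blowup_dense (phi : J -> I) :
  c ^+ (#|J| ^ #|I|) * #|V|%:R ^+ #|J| <=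
  #|[pred v : {ffun J -> V} | [exists g : {ffun I -> {ffun J -> V}},
       [forall f, P (section_of g f)] && [forall j, v j == g (phi j) j]]]|%:R.
Proof.
set T := [pred v | _].
pose pr (g : {ffun I -> {ffun J -> V}}) : {ffun J -> V} :=
  [ffun j => g (phi j) j].
have I0 : (0 < #|I|)%N by apply/card_gt0P; exists (phi j0).
have fib v : #|[pred g | pr g == v]| = (#|V| ^ (#|I|.-1 * #|J|))%N.
  pose F i := family (fun j => if phi j == i then pred1 (v j) else predT).
  have -> : #|[pred g | pr g == v]| = #|family (fun i => [pred h in F i])|.
    apply: eq_card => g; rewrite !inE; apply/eqP/forallP => [E i|H].
      rewrite inE; apply/familyP => j; rewrite -E /pr ffunE.
      by case: eqP => [<-|_]; rewrite inE.
    apply/ffunP => j; rewrite /pr ffunE; have := H (phi j); rewrite inE.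
    by move=> /familyP/(_ j); rewrite eqxx inE => /eqP.
  rewrite card_family foldrE big_map big_enum /=.
  under eq_bigr => i _.
    rewrite (eq_card (B := F i)) ?card_family ?foldrE ?big_map ?big_enum /=.
      over.
    by move=> h; rewrite inE.
  rewrite exchange_big /= expnM -prod_nat_const; apply: eq_bigr => j _.
  rewrite (bigD1 (phi j)) //= eqxx card1 mul1n.
  rewrite (eq_bigr (fun=> #|V|)); last by move=> i /negbTE; rewrite eq_sym => ->.
  by rewrite prod_nat_const; congr (_ ^ _)%N; have := cardC1 (phi j); rewrite /= => <-.
have := card_partial_blowup [set: I]; rewrite cardsT /N !card_ffun.
have -> : #|partial_blowup setT| =
    #|[pred g : {ffun I -> {ffun J -> V}} | [forall f, P (section_of g f)]]|.
  apply: eq_card => g; rewrite !inE; apply: eq_forallb => f.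
  by rewrite (_ : [forall _, _] = true) //; apply/forallP => i; rewrite inE.
set Q := [pred g | _] => QN.
have QT : (#|Q| <= #|T| * #|V| ^ (#|I|.-1 * #|J|))%N.
  rewrite -sum1_card (partition_big pr T) /=; last first.
    move=> g Qg; apply/existsP; exists g; apply/andP; split; first exact: Qg.
    by apply/forallP => j; rewrite ffunE.
  rewrite -sum_nat_const; apply: leq_sum => v _; rewrite -(fib v) -sum1_card.
  by rewrite big_mkcondl /=; apply: leq_sum => g _; case: ifP.
have V0 : (0 : R) < #|V|%:R by rewrite ltr0n.
rewrite -(ler_pM2r (exprn_gt0 (#|I|.-1 * #|J|) V0)) -[X in _ <= _ * X]natrX -[leRHS]natrM.
have QT' : (#|Q|%:R : R) <= (#|T| * #|V| ^ (#|I|.-1 * #|J|))%:R by rewrite ler_nat.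
apply: le_trans QT'; apply: le_trans QN.
by rewrite -mulrA -exprD !natrX -exprM -[X in (X + _)%N]mul1n -mulnDl add1n prednK // mulnC.
Qed.
End Blowup.

(** * Factoring permutations into transpositions *)

(** [A] grows along orbits of [rho]: the image of its exit point is adjoined, and a fresh point only
    when [A] is closed under [rho]. *)
Lemma few_exits (T : finType) (rho : {perm T}) (x0 : T) (a : nat) :
  (0 < a <= #|T|)%N ->
  exists A : {set T}, [/\ x0 \in A, #|A| = a &
    forall x y, x \in A -> y \in A -> rho x \notin A -> rho y \notin A -> x = y].
Proof.
elim: a => // -[_ _|a IHa /andP[_ aT]].
  exists [set x0]; split; rewrite ?set11 ?cards1 // => x y.
  by rewrite !inE => /eqP -> /eqP ->.
have [|A [x0A cA exA]] := IHa; first exact: ltnW.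
have [/exists_inP[x xA rxA]|] := boolP [exists x in A, rho x \notin A].
  exists (rho x |: A); split; rewrite ?inE ?x0A ?orbT // ?cardsU1 ?rxA ?cA //.
  move=> y z; rewrite !inE !negb_or.
  have only_rx t : (t == rho x) || (t \in A) -> (rho t != rho x) && (rho t \notin A) ->
      t = rho x.
    case/orP=> [/eqP //|tA] /andP[tx rtA].
    by rewrite (exA _ _ tA xA rtA rxA) eqxx in tx.
  by move=> yA zA ry rz; rewrite (only_rx _ yA ry) (only_rx _ zA rz).
rewrite negb_exists_in => /forall_inP noex.
have /card_gt0P[z] : (0 < #|~: A|)%N by rewrite cardsCs setCK cA subn_gt0.
rewrite inE => zA; exists (z |: A); split; rewrite ?inE ?x0A ?orbT // ?cardsU1 ?zA ?cA //.
have only_z t : t \in z |: A -> rho t \notin z |: A -> t = z.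
  rewrite !inE !negb_or => /orP[/eqP //|tA] /andP[_].
  by have := noex _ tA; rewrite negbK => ->.
by move=> x y xA yA rx ry; rewrite (only_z x) // (only_z y).
Qed.

(** A set with one exit point has one entry point, and exchanging their images makes it invariant.
    The clause on [z] says that a genuine exchange involves a point outside [A], so none occurs when
    [A] is everything. *)
Lemma almost_invariant_set (T : finType) (rho : {perm T}) (x0 : T) (a : nat) :
  (0 < a <= #|T|)%N ->
  exists (A : {set T}) (z z' : T), [/\ x0 \in A, #|A| = a, z = z' \/ z \notin A &
    forall t, ((rho * tperm z z')%g t \in A) = (t \in A)].
Proof.
move=> aT; have [A [x0A cA exA]] := few_exits rho x0 aT.
have sub_eq (s : {perm T}) : (forall t, t \in A -> s t \in A) ->
    forall t, (s t \in A) = (t \in A).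
  move=> sA t; apply/idP/idP; last exact: sA.
  have /eqP sAA : s @: A == A.
    rewrite eqEcard card_imset ?leqnn ?andbT; last exact: perm_inj.
    by apply/subsetP => y /imsetP[u uA ->]; exact: sA.
  by rewrite -{1}sAA (mem_imset _ _ (@perm_inj _ s)).
have [/exists_inP[x xA rxA]|] := boolP [exists x in A, rho x \notin A]; last first.
  rewrite negb_exists_in => /forall_inP noex; exists A, x0, x0.
  split=> //; [by left|apply: sub_eq => t tA].
  by rewrite permM tperm1 perm1; have := noex t tA; rewrite negbK.
have [/existsP[x' /andP[x'A rx'A]]|] :=
    boolP [exists x', (x' \notin A) && (rho x' \in A)].
  exists A, (rho x), (rho x'); split=> //; first by right.
  apply: sub_eq => t tA; rewrite permM; have [->|tx] := eqVneq t x; first by rewrite tpermL.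
  rewrite tpermD; first by apply: contraNT tx => rt; rewrite (exA t x).
    by rewrite (inj_eq perm_inj) eq_sym.
  by rewrite (inj_eq perm_inj); apply: contraNneq x'A => ->.
rewrite negb_exists => /forallP noent.
have inv_stable t : t \in A -> (rho^-1)%g t \in A.
  by move=> tA; have := noent ((rho^-1)%g t); rewrite permKV tA andbT negbK.
by have := sub_eq _ inv_stable (rho x); rewrite permK xA (negbTE rxA).
Qed.

(** Inside a class, a cycle through the centre and l other points costs l transpositions with the
    centre; a cycle of length l avoiding it costs l + 1, at most 2l. The inequality is strict once a
    centre moves. *)
Lemma star_factor (T : finType) (ctr : T -> T) (s : {perm T}) :
  (forall x, ctr (ctr x) = ctr x) -> (forall x, ctr (s x) = ctr x) ->
  exists ts : seq (T * T), [/\ s = (\prod_(t <- ts) tperm t.1 t.2)%g,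
    all (fun t => (t.1 == ctr t.2) && (t.1 != t.2)) ts,
    (size ts <= #|[set x | (x != ctr x) && (s x != x)]|.*2)%N &
    (forall c, ctr c = c -> s c != c ->
       size ts < #|[set x | (x != ctr x) && (s x != x)]|.*2)%N].
Proof.
move=> ctrK; have [f] := ubnP #|[set x | (x != ctr x) && (s x != x)]|.
elim: f s => // f IHf s; rewrite ltnS => sf ctrs.
pose M (u : {perm T}) := [set x | (x != ctr x) && (u x != x)].
have moved (u : {perm T}) c : (#|M u| <= f)%N -> (forall x, ctr (u x) = ctr x) ->
    ctr c = c -> u c != c ->
    exists ts : seq (T * T), [/\ u = (\prod_(t <- ts) tperm t.1 t.2)%g,
      all (fun t => (t.1 == ctr t.2) && (t.1 != t.2)) ts &
      (size ts < #|M u|.*2)%N].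
  (* Composing with this transposition fixes the point [u c], so fewer non-central points move. *)
  move=> uf ctru cc uc; pose u' := (tperm c (u c) * u)%g.
  have ucM : u c \in M u.
    by rewrite inE ctru cc uc (inj_eq perm_inj).
  have sub : M u' \subset M u :\ u c.
    apply/subsetP => x; rewrite !inE permM => /andP[xc].
    have [->|xuc] := eqVneq x (u c); first by rewrite tpermR eqxx.
    have [xc'|xc'] := eqVneq x c; first by rewrite xc' cc eqxx in xc.
    by rewrite tpermD 1?eq_sym // xc.
  have cM : (#|M u'| < #|M u|)%N.
    by rewrite (cardsD1 (u c) (M u)) ucM add1n ltnS subset_leq_card.
  have [||ts [u'E tsP tsS _]] := IHf u'.
  - exact: leq_trans cM uf.
  - move=> x; rewrite permM ctru; case: tpermP => [->|->|//] //; rewrite ?ctru //.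
  exists ((c, u c) :: ts); split.
  - by rewrite big_cons -u'E mulgA tperm2 mul1g.
  - by rewrite /= tsP ctru cc eqxx eq_sym uc.
  - by have tsS' : (size ts <= #|M u'|.*2)%N := tsS; rewrite /=; lia.
have [/existsP[c /andP[/eqP cc sc]]|] := boolP [exists c, (ctr c == c) && (s c != c)].
  have [ts [sE tsP tsS]] := moved s c sf ctrs cc sc.
  by exists ts; split=> //; apply: ltnW.
rewrite negb_exists => /forallP fixc.
have fixed c : ctr c = c -> s c = c.
  by move=> cc; have := fixc c; rewrite cc eqxx /= negbK => /eqP.
have [/eqP M0|/set0Pn[x]] := boolP (M s == set0).
  exists [::]; split=> // [|c /fixed ->]; last by rewrite eqxx.
  rewrite big_nil; apply/permP => x; rewrite perm1; apply/eqP/negPn/negP => sx.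
  have : x \in M s; last by rewrite M0 inE.
  rewrite inE sx andbT; apply: contraNneq sx => xc.
  by rewrite fixed.
rewrite inE => /andP[xc sx]; pose c := ctr x.
have cc : ctr c = c by exact: ctrK.
have sc := fixed c cc.
(* All centres are fixed here. Joining the cycle of [x] to its centre costs one transposition, does
   not enlarge [M], and leads to the case with the strict bound. *)
pose u := (tperm c x * s)%g.
have sub : M u \subset M s.
  apply/subsetP => y; rewrite !inE permM => /andP[yc].
  have [->|yx] := eqVneq y x; first by rewrite xc sx.
  have [yc'|yc'] := eqVneq y c; first by rewrite yc' cc eqxx in yc.
  by rewrite tpermD 1?eq_sym // yc.
have [||||ts [uE tsP tsS]] := moved u c.
- exact: leq_trans (subset_leq_card sub) sf.
- move=> y; rewrite permM ctrs; case: tpermP => [->|->|//] //.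
- by [].
- by rewrite permM tpermL -sc (inj_eq perm_inj).
exists ((c, x) :: ts); split.
- by rewrite big_cons -uE mulgA tperm2 mul1g.
- by rewrite /= tsP andbT eqxx eq_sym xc.
- by rewrite /=; apply: leq_trans tsS _; rewrite leq_double subset_leq_card.
- by move=> d /fixed ->; rewrite eqxx.
Qed.

(** Enumerations of each set followed by its complement are matched; a final transposition inside
    [B] corrects the image of [x]. *)
Lemma perm_mapping (T : finType) (A B : {set T}) (x y : T) :
  #|A| = #|B| -> x \in A -> y \in B ->
  exists p : {perm T}, p x = y /\ forall t, (p t \in B) = (t \in A).
Proof.
move=> cAB xA yB.
pose sA := enum A ++ enum (~: A); pose sB := enum B ++ enum (~: B).
have mem_s (D : {set T}) t : t \in enum D ++ enum (~: D).
  by rewrite mem_cat !mem_enum inE orbN.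
have uniq_s (D : {set T}) : uniq (enum D ++ enum (~: D)).
  rewrite cat_uniq !enum_uniq /= andbT; apply/hasPn => t.
  by rewrite !mem_enum inE.
have size_s (D : {set T}) : size (enum D ++ enum (~: D)) = #|T|.
  by rewrite size_cat -!cardE cardsC.
pose p t := nth x sB (index t sA).
have idx t : (index t sA < #|T|)%N by rewrite -(size_s A) index_mem mem_s.
have p_inj : injective p.
  move=> t u /eqP; rewrite nth_uniq ?size_s ?uniq_s ?idx // => /eqP.
  by move/(congr1 (nth x sA)); rewrite !nth_index ?mem_s.
have pB t : (p t \in B) = (t \in A).
  rewrite /p /sB nth_cat -cardE -cAB /sA index_cat mem_enum.
  case: (boolP (t \in A)) => tA.
    have lt : (index t (enum A) < #|A|)%N by rewrite cardE index_mem mem_enum.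
    by rewrite lt -mem_enum mem_nth // -cardE -cAB.
  have lt : (index t (enum (~: A)) < #|~: A|)%N.
    by rewrite cardE index_mem mem_enum inE.
  rewrite -cardE ltnNge leq_addr /= addKn; apply/negbTE.
  have cC : #|~: A| = #|~: B| by have := cardsC A; have := cardsC B; lia.
  by rewrite -in_setC -mem_enum mem_nth // -cardE -cC.
pose q := (perm p_inj * tperm (p x) y)%g.
exists q; split=> [|t]; first by rewrite permM permE tpermL.
by rewrite permM permE; case: tpermP => [E|E|_ _]; rewrite -(pB t) ?E ?pB ?xA ?yB.
Qed.

(* The labels G-adjacent to top form a star around top, and by the triple
   condition the remaining ones form a clique.  Up to conjugation and one extra
   transposition, which may fall outside G, rho preserves the two classes. *)
Lemma derangement_factor (T : finType) (rho : {perm T}) (G : rel T) (x0 top : T) :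
  (1 < #|T|)%N -> (forall x, rho x != x) ->
  (forall a b c, a != b -> a != c -> b != c -> [|| G a b, G a c | G b c]) ->
  exists (p : {perm T}) (ts : seq (T * T)), [/\ p x0 = top,
    (rho ^ p)%g = (\prod_(t <- ts) tperm t.1 t.2)%g,
    all (fun t => t.1 != t.2) ts, (size ts + 3 <= #|T|.*2)%N &
    (count (fun t => ~~ G t.1 t.2) ts <= 1)%N].
Proof.
move=> T_gt1 rho_der G3.
pose N := [set b | (b == top) || G top b].
have topN : top \in N by rewrite inE eqxx.
have N0 : (0 < #|N| <= #|T|)%N.
  by rewrite max_card andbT; apply/card_gt0P; exists top.
have [A [z [z' [x0A cA zz' inv]]]] := almost_invariant_set rho x0 N0.
have [p [px0 pN]] := perm_mapping cA x0A topN.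
pose s := ((rho * tperm z z') ^ p)%g.
have sN x : (s x \in N) = (x \in N).
  by rewrite -[x](permKV p) permJ !pN inv.
(* The centre of the second class. No vertex of that class is adjacent to [top], so the triple
   condition for [top], [m0] and a third vertex makes [m0] adjacent to the latter. *)
pose m0 := odflt top [pick b in ~: N].
pose ctr x := if x \in N then top else m0.
have m0N x : x \notin N -> m0 \notin N.
  by move=> xN; rewrite /m0; case: pickP => [b|/(_ x)]; rewrite inE // xN.
have ctrK x : ctr (ctr x) = ctr x.
  rewrite {2 3}/ctr; case: ifP => [_|/negbT/m0N xN]; first by rewrite /ctr topN.
  by rewrite /ctr (negbTE xN).
have ctrs x : ctr (s x) = ctr x by rewrite /ctr sN.
have [ts [sE tsP tsS tsS']] := star_factor ctrK ctrs.
have tsG : all (fun t => G t.1 t.2) ts.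
  apply: sub_all tsP => -[c x] /= /andP[/eqP ->]; rewrite /ctr.
  have [|xN xm] := boolP (x \in N).
    by rewrite inE => /orP[/eqP ->|//]; rewrite eqxx.
  have m0' := m0N _ xN; move: xN m0'; rewrite !inE !negb_or.
  move=> /andP[xt Gx] /andP[mt Gm].
  have := G3 top m0 x; rewrite (negbTE Gx) (negbTE Gm) eq_sym mt eq_sym xt xm.
  by apply.
pose M := [set x | (x != ctr x) && (s x != x)].
have rhoE : (rho ^ p)%g = (s * tperm (p z) (p z'))%g.
  by rewrite -tpermJ /s -conjMg -mulgA tperm2 mulg1.
have topM : top \notin M by rewrite inE /ctr topN eqxx.
(* With a single class no exchange takes place, and [top] moves because [rho] has no fixed point;
   the strict bound leaves at most 2(|T| - 1) - 1 transpositions. *)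
have [NT|] := eqVneq N setT.
  have Ez : z = z'.
    case: zz' => // zA; have /eqP AT : A == setT.
      by rewrite eqEcard subsetT cA NT leqnn.
    by rewrite AT inE in zA.
  exists p, ts; split=> //.
  - by rewrite rhoE Ez tperm1 mulg1.
  - by apply: sub_all tsP => t /andP[].
  - have : (size ts < #|M|.*2)%N.
      apply: (tsS' top); first by rewrite /ctr topN.
      by rewrite /s Ez tperm1 mulg1 -{1}(permKV p top) permJ -[X in _ != X](permKV p top)
        (inj_eq perm_inj).
    have : (#|M| < #|T|)%N.
      rewrite -cardsT; apply/proper_card/properP; split; first exact: subsetT.
      by exists top.
    by lia.
  - by rewrite (eq_in_count (a2 := pred0)) ?count_pred0 // => t tin; rewrite (allP tsG).
move=> /eqP NT; have [m mN] : exists m, m \notin N.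
  apply/existsP; rewrite -negb_forall; apply/negP => /forallP NA; apply: NT.
  by apply/setP => x; rewrite NA inE.
have {mN} m0N' := m0N _ mN.
have mtop : m0 != top by apply: contraNneq m0N' => ->.
(* Neither centre belongs to [M]: at most 2(|T| - 2) transpositions and the exchange, again 2|T| - 3
   in all. *)
have MT : (#|M| + 2 <= #|T|)%N.
  have -> : 2%N = #|[set m0; top]| by rewrite cards2 mtop.
  rewrite -cardsUI (_ : M :&: _ = set0) ?cards0 ?addn0 ?max_card //.
  apply/setP => x; rewrite !inE; apply/negbTE/negP.
  case/andP=> /andP[xc _] /orP[] /eqP xE; move: xc.
    by rewrite xE /ctr (negbTE m0N') eqxx.
  by rewrite xE /ctr topN eqxx.
have cts : count (fun t => ~~ G t.1 t.2) ts = 0%N.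
  by rewrite (eq_in_count (a2 := pred0)) ?count_pred0 // => t tin; rewrite (allP tsG).
have tsS2 : (size ts <= #|M|.*2)%N := tsS.
have [Ez|nz] := eqVneq z z'.
  exists p, ts; split=> //.
  - by rewrite rhoE Ez tperm1 mulg1.
  - by apply: sub_all tsP => t /andP[].
  - by lia.
  - by rewrite cts.
exists p, (rcons ts (p z, p z')); split=> //.
- by rewrite rhoE sE -cats1 big_cat big_seq1.
- rewrite all_rcons /= (inj_eq perm_inj) nz /=.
  by apply: sub_all tsP => t /andP[].
- by rewrite size_rcons; lia.
- by rewrite -cats1 count_cat cts /= addn0; case: (G _ _).
Qed.

(** * Closed tight walks through a blown-up edge *)

(* A walk is cut into blocks of k consecutive vertices, and a block is a map
   from the k slots.  The vertices met by a window that starts at slot j of a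
   block B and ends in the next block B' are those of window B B' j. *)
Definition window (k : nat) (X : finType) (B B' : {ffun 'I_k -> X}) (j : nat) :
  {set X} := [set (if (i < j)%N then B' i else B i) | i : 'I_k].

Definition block_step (k : nat) (X : finType) (E : {set {set X}}) :
  rel {ffun 'I_k -> X} := [rel B B' | [forall j : 'I_k, window B B' j \in E]].

Section Blocks.
Variables (k : nat) (X : finType) (lab : 'I_k -> X) (y : 'I_k -> 'I_k -> X).
Implicit Types (p : {perm 'I_k}) (t : 'I_k * 'I_k) (kappa : X -> nat).

Definition plain p : {ffun 'I_k -> X} := [ffun i => lab (p i)].

Definition subst_block p (b : 'I_k) (u : X) : {ffun 'I_k -> X} :=
  [ffun i => if p i == b then u else lab (p i)].

(* The vertex v takes over slot i, whose label moves to slot j; from the next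
   block on the labels of slots i and j are exchanged.  Every window through v
   misses exactly one of the labels p i and p j. *)
Definition swap_block p (i j : 'I_k) (v : X) : {ffun 'I_k -> X} :=
  [ffun a => if a == i then v else if a == j then lab (p i) else lab (p a)].

Definition swap_step p t : {ffun 'I_k -> X} :=
  let i := (p^-1)%g t.1 in let j := (p^-1)%g t.2 in
  if (i < j)%N then swap_block p i j (y t.1 t.2) else swap_block p j i (y t.1 t.2).

Fixpoint swap_blocks p (ts : seq ('I_k * 'I_k)) : seq {ffun 'I_k -> X} :=
  if ts is t :: ts' then
    let p' := (p * tperm t.1 t.2)%g in
    swap_step p t :: plain p' :: swap_blocks p' ts'
  else [::].

Lemma size_swap_blocks p ts : size (swap_blocks p ts) = (size ts).*2.
Proof. by elim: ts p => //= t ts IH p; rewrite IH doubleS. Qed.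

Lemma last_swap_blocks p ts :
  last (plain p) (swap_blocks p ts) = plain (p * \prod_(t <- ts) tperm t.1 t.2)%g.
Proof.
elim: ts p => [|t ts IH] p; first by rewrite big_nil mulg1.
by rewrite big_cons mulgA -IH.
Qed.

(** With an indicator for [kappa] this counts the occurrences of a kind of vertex; all counts on the
    walk come from it. *)
Definition block_cost kappa (B : {ffun 'I_k -> X}) : nat := \sum_i kappa (B i).

Lemma plain_cost kappa p : block_cost kappa (plain p) = \sum_l kappa (lab l).
Proof.
rewrite /block_cost [RHS](reindex_inj (@perm_inj _ p)) /=.
by apply: eq_bigr => i _; rewrite ffunE.
Qed.

Lemma subst_cost kappa p b u :
  (block_cost kappa (subst_block p b u) + kappa (lab b) = \sum_l kappa (lab l) + kappa u)%N.
Proof.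
rewrite -(plain_cost kappa p) /block_cost.
rewrite (bigD1 ((p^-1)%g b)) //= [in RHS](bigD1 ((p^-1)%g b)) //= !ffunE permKV eqxx.
rewrite [LHS]addnC addnA addnAC; congr (_ + _ + _)%N; apply: eq_bigr => i ib.
by rewrite !ffunE; case: eqP => // pi; rewrite -pi permK eqxx in ib.
Qed.

Lemma swap_step_cost kappa p t : t.1 != t.2 ->
  (block_cost kappa (swap_step p t) <= \sum_l kappa (lab l) + kappa (y t.1 t.2))%N.
Proof.
have H i j v : i != j ->
    (block_cost kappa (swap_block p i j v) <= \sum_l kappa (lab l) + kappa v)%N.
  move=> ij; rewrite -(plain_cost kappa p) /block_cost.
  rewrite (bigD1 i) //= (bigD1 j) 1?eq_sym //= [in X in (_ <= X)%N](bigD1 i) //=.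
  rewrite [in X in (_ <= X)%N](bigD1 j) 1?eq_sym //= !ffunE !eqxx eq_sym (negbTE ij).
  have aux (a b c d e : nat) : d = e -> (a + (b + d) <= b + (c + e) + a)%N by lia.
  apply: aux; apply: eq_bigr => a /andP[ai aj].
  by rewrite !ffunE (negbTE ai) (negbTE aj).
move=> tn; rewrite /swap_step; case: ifP => _; apply: H.
  by rewrite (inj_eq perm_inj).
by rewrite (inj_eq perm_inj) eq_sym.
Qed.

Lemma swap_blocks_cost kappa p ts : all (fun t => t.1 != t.2) ts ->
  (\sum_(B <- swap_blocks p ts) block_cost kappa B <=
   (size ts).*2 * \sum_l kappa (lab l) + \sum_(t <- ts) kappa (y t.1 t.2))%N.
Proof.
elim: ts p => [|t ts IH] p /=; first by rewrite !big_nil.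
case/andP=> tn /IH{}IH; rewrite !big_cons plain_cost doubleS !mulSn.
have := swap_step_cost kappa p tn; have := IH (p * tperm t.1 t.2)%g.
move: (\sum_(B <- _) _)%N (block_cost _ _) (\sum_l _)%N (_ * _)%N => a b c d.
by move: (\sum_(_ <- ts) _)%N => e; lia.
Qed.

Variable E : {set {set X}}.
Hypothesis labE : lab @: [set: 'I_k] \in E.

Lemma image_plain p : [set plain p i | i : 'I_k] = lab @: [set: 'I_k].
Proof.
apply/setP => v; apply/imsetP/imsetP => -[i _ ->].
  by exists (p i) => //; rewrite ffunE.
by exists ((p^-1)%g i) => //; rewrite ffunE permKV.
Qed.

Lemma image_subst p b u :
  [set subst_block p b u i | i : 'I_k] = u |: lab @: [set~ b].
Proof.
apply/setP => v; rewrite !inE; apply/imsetP/orP => [[i _ ->]|].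
  rewrite ffunE; have [_|ib] := eqVneq (p i) b; first by left.
  by right; apply: imset_f; rewrite !inE.
case=> [/eqP ->|/imsetP[l]]; first by exists ((p^-1)%g b) => //; rewrite ffunE permKV eqxx.
rewrite !inE => lb ->; exists ((p^-1)%g l) => //.
by rewrite ffunE permKV (negbTE lb).
Qed.

Lemma window_eq (B B' C : {ffun 'I_k -> X}) j :
  (forall i : 'I_k, (if (i < j)%N then B' i else B i) = C i) ->
  window B B' j = [set C i | i : 'I_k].
Proof. by move=> H; apply: eq_imset. Qed.

Lemma step_plain p : block_step E (plain p) (plain p).
Proof.
apply/forallP => j; rewrite (window_eq (C := plain p)) ?image_plain //.
by move=> i; case: ifP.
Qed.

Lemma step_subst p b u : u |: lab @: [set~ b] \in E ->
  block_step E (plain p) (subst_block p b u) /\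
  block_step E (subst_block p b u) (plain p).
Proof.
move=> uE; split; apply/forallP => j.
  have [lt|le] := ltnP ((p^-1)%g b) j.
    rewrite (window_eq (C := subst_block p b u)) ?image_subst // => i.
    rewrite !ffunE; case: ifP => // ij; case: eqP => // pb.
    by rewrite -pb permK ij in lt.
  rewrite (window_eq (C := plain p)) ?image_plain // => i.
  rewrite !ffunE; case: ifP => // ij; case: eqP => // pb.
  by rewrite -pb permK leqNgt ij in le.
have [lt|le] := ltnP ((p^-1)%g b) j.
  rewrite (window_eq (C := plain p)) ?image_plain // => i.
  rewrite !ffunE; case: ifP => // ij; case: eqP => // pb.
  by rewrite -pb permK ij in lt.
rewrite (window_eq (C := subst_block p b u)) ?image_subst // => i.
rewrite !ffunE; case: ifP => // ij; case: eqP => // pb.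
by rewrite -pb permK leqNgt ij in le.
Qed.

Lemma step_swap p (i j : 'I_k) v : (i < j)%N ->
  v |: lab @: [set~ p i] \in E -> v |: lab @: [set~ p j] \in E ->
  block_step E (plain p) (swap_block p i j v) /\
  block_step E (swap_block p i j v) (plain (tperm i j * p)%g).
Proof.
move=> ij viE vjE; have nij : i != j by rewrite neq_ltn ij.
(* Seen from the labelling after the exchange, the swap block is a single substitution, so leaving
   it is an instance of [step_subst]. *)
have swapE : swap_block p i j v = subst_block (tperm i j * p)%g (p j) v.
  apply/ffunP => a; rewrite !ffunE permM (inj_eq perm_inj).
  case: tpermP => [->|->|/eqP ai /eqP aj]; rewrite ?eqxx //.
    by rewrite eq_sym (negbTE nij).
  by rewrite (negbTE ai) (negbTE aj).
split; apply/forallP => a; last first.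
  have [_] := step_subst (tperm i j * p)%g vjE; rewrite -swapE.
  by move=> /forallP.
(* Windows starting at slot [i] or before see all labels; up to slot [j] they miss the label of [i],
   and after it that of [j]. *)
have [le|lt] := leqP a i.
  rewrite (window_eq (C := plain p)) ?image_plain // => b; case: ifP => // ba.
  rewrite !ffunE; have [E1|_] := eqVneq b i; first by move: ba; rewrite E1 ltnNge le.
  by have [E1|_//] := eqVneq b j; move: ba ij; rewrite E1; lia.
have [le|lt'] := leqP a j.
  rewrite (window_eq (C := subst_block p (p i) v)) ?image_subst // => b.
  rewrite !ffunE (inj_eq perm_inj); have [->|_] := eqVneq b i; first by rewrite lt.
  by have [->|_] := eqVneq b j; [rewrite ltnNge le|case: ifP].
rewrite (window_eq (C := swap_block p i j v)) ?swapE ?image_subst // -swapE => b.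
rewrite !ffunE; have [->|_] := eqVneq b i; first by rewrite lt.
by have [->|_] := eqVneq b j; [rewrite lt'|case: ifP].
Qed.

Hypothesis yE : forall a b, a != b ->
  (y a b |: lab @: [set~ a] \in E) /\ (y a b |: lab @: [set~ b] \in E).

Lemma path_swap_blocks p ts : all (fun t => t.1 != t.2) ts ->
  path (block_step E) (plain p) (swap_blocks p ts).
Proof.
elim: ts p => //= t ts IH p /andP[tn /IH{}IH]; rewrite IH andbT.
have [y1 y2] := yE tn.
pose i := (p^-1)%g t.1; pose j := (p^-1)%g t.2.
have ti : p i = t.1 by rewrite permKV.
have tj : p j = t.2 by rewrite permKV.
have tE : (p * tperm t.1 t.2)%g = (tperm i j * p)%g.
  by rewrite [RHS]conjgC tpermJ ti tj.
rewrite tE /swap_step -/i -/j; case: ltnP => [ij|].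
  by have [|//|-> ->] := @step_swap p i j (y t.1 t.2) ij; rewrite ?ti ?tj.
rewrite leq_eqVlt => /orP[/eqP/val_inj/perm_inj tt|ji].
  by rewrite tt eqxx in tn.
have [||] := @step_swap p j i (y t.1 t.2) ji; rewrite ?ti ?tj //.
by rewrite tpermC => -> ->.
Qed.
End Blocks.

(** Reading past the end of the list returns [d], so the path goes on as a constant sequence; this
    supplies the incomplete last block of the walk. *)
Lemma path_nth_default (T : Type) (e : rel T) (d x : T) (l : seq T) (b : nat) :
  path e x l -> e d d -> last x l = d -> e (nth d (x :: l) b) (nth d (x :: l) b.+1).
Proof.
elim: l x b => [|z l IH] x b /=.
  by move=> _ dd ->; case: b => [|b]; rewrite /= ?nth_nil.
by case/andP=> xz zl dd lz; case: b => [//|b]; exact: (IH z b).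
Qed.

Lemma val_iter_ordS (s : nat) (i : 'I_s) (j : nat) :
  val (iter j (@ordS s) i) = ((i + j) %% s)%N.
Proof.
elim: j => [|j IH] /=; first by rewrite addn0 modn_small.
by rewrite IH -addn1 modnDml addn1 addnS.
Qed.

Section Slots.
Variables (k : nat) (k_gt0 : (0 < k)%N).

Definition slot (m : nat) : 'I_k := Ordinal (ltn_pmod m k_gt0).

Lemma slot_block (b : nat) (i : 'I_k) : slot (b * k + i) = i.
Proof. by apply: val_inj; rewrite /= modnMDl modn_small. Qed.

Lemma sum_over_blocks (F : nat -> 'I_k -> nat) (q r : nat) : (r <= k)%N ->
  (\sum_(0 <= t < q * k + r) F (t %/ k) (slot t) =
   \sum_(0 <= b < q) \sum_i F b i + \sum_(i < k | i < r) F q i)%N.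
Proof.
have one b m : (m <= k)%N ->
    (\sum_(b * k <= t < b * k + m) F (t %/ k) (slot t) = \sum_(i < k | i < m) F b i)%N.
  move=> mk; rewrite -{1}[(b * k)%N]add0n big_addn addKn big_mkord.
  rewrite (big_ord_widen_cond k xpredT (fun t => F ((t + b * k) %/ k)%N (slot (t + b * k)))) //.
  by apply: eq_bigr => i _; rewrite addnC slot_block divnMDl // divn_small ?addn0.
move=> rk; rewrite (big_cat_nat (n := (q * k)%N)) ?leq_addr //= one //; congr (_ + _)%N.
elim: q => [|q IH]; first by rewrite mul0n !big_geq.
rewrite big_nat_recr //= mulSn addnC (big_cat_nat (n := (q * k)%N)) ?leq_addr //= IH one //.
by congr (_ + _)%N; apply: eq_bigl => i; rewrite ltn_ord.
Qed.
End Slots.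

(* Items stand for the vertices met by a walk: a label l, the vertex used to swap
   the labels a and b, or one of two special vertices (true and false), which
   replace the labels b0 and b1 once each. *)
Definition item (k : nat) : finType := ('I_k + 'I_k * 'I_k + bool)%type.

Section Walk.
Variables (k s : nat).
Hypotheses (k_gt1 : (1 < k)%N) (s_ge : (5 * k ^ 2 <= s)%N) (s_mod : (s %% k != 0)%N).
Variables (G : rel 'I_k) (top b0 b1 : 'I_k).
Hypothesis G3 : forall a b c, a != b -> a != c -> b != c -> [|| G a b, G a c | G b c].

Definition label_item (l : 'I_k) : item k := inl (inl l).
Definition swap_item (a b : 'I_k) : item k := inl (inr (a, b)).

Definition walk_pattern (E : {set {set item k}}) : Prop :=
  [/\ label_item @: [set: 'I_k] \in E,
      forall a b, a != b -> (swap_item a b |: label_item @: [set~ a] \in E) /\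
                           (swap_item a b |: label_item @: [set~ b] \in E),
      inr true |: label_item @: [set~ b0] \in E &
      inr false |: label_item @: [set~ b1] \in E].

Definition forget (x : item k) : 'I_k + 'I_k * 'I_k :=
  match x with inl z => z | inr u => inl (if u then b0 else b1) end.

Lemma closed_walk : exists (phi : 'I_s -> item k) (tU tW : 'I_s),
  [/\ (forall t, (phi t == inr true) = (t == tU)),
      (forall t, (phi t == inr false) = (t == tW)),
      forall E, walk_pattern E -> forall e, e \in tight_cycle k s -> phi @: e \in E &
   [/\ (#|[set t | forget (phi t) == inl top]| <= s %/ k)%N,
       (#|[set t | if forget (phi t) is inr _ then true else false]| + 3 <= k.*2)%N &
       (#|[set t | if forget (phi t) is inr z then ~~ G z.1 z.2 else false]| <= 1)%N]].
Proof.
have k0 : (0 < k)%N by exact: ltnW.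
pose r := (s %% k)%N; pose q := (s %/ k)%N.
have rk : (r < k)%N by rewrite ltn_pmod.
have r0 : (0 < r)%N by rewrite lt0n.
have sqr : s = (q * k + r)%N by exact: divn_eq.
have q5 : (5 * k <= q)%N by rewrite leq_divRL // -mulnA.
have ks : (k < s)%N by nia.
pose f (i : 'I_k) : 'I_k := slot k0 (i + (k - r)).
have f_inj : injective f.
  move=> i j /(congr1 val) /= /eqP; rewrite eqn_modDr !modn_small // => /eqP.
  exact: val_inj.
pose rho := perm f_inj.
have rho_der x : rho x != x.
  rewrite permE; apply/eqP => /(congr1 val) /= xE.
  have : (x + (k - r) == x + 0 %[mod k])%N by rewrite xE addn0 modn_small.
  by rewrite eqn_modDl !modn_small; lia.
have cT : #|'I_k| = k by rewrite card_ord.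
have cT1 : (1 < #|'I_k|)%N by rewrite cT.
(* [top] is placed in slot 0: the incomplete block reads slots k - r, ..., k - 1 of the initial
   labelling and so avoids [top], which then occurs at most once per full block and nowhere else. *)
have [p0 [ts [p0top rhoE tsn tsS tsG]]] := derangement_factor (slot k0 0) top cT1 rho_der G3.
rewrite cT in tsS.
pose p1 := (p0 * \prod_(t <- ts) tperm t.1 t.2)%g.
have p1E : p1 = (rho * p0)%g by rewrite /p1 -rhoE -conjgC.
pose d := plain label_item p1.
(* Each special vertex has a block of its own between plain blocks, and plain blocks pad the walk to
   [q] blocks. As [ts] has at most 2k - 3 members, q >= 5k leaves room. *)
pose extra := [:: subst_block label_item p1 b0 (inr true); d;
                  subst_block label_item p1 b1 (inr false); d]
              ++ nseq (q - ((size ts).*2 + 5)) d.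
pose tail := swap_blocks label_item swap_item p0 ts ++ extra.
pose Bs := plain label_item p0 :: tail.
have sizeBs : size Bs = q.
  by rewrite /= size_cat size_swap_blocks /= size_nseq; move: (size ts) tsS => n; clear -q5 k_gt1; lia.
pose c t := nth d Bs (t %/ k) (slot k0 t).
(* The rotation is used here: the constant continuation [d], read from position [s] on, repeats the
   first block. *)
have wrap t : (t < k)%N -> c (s + t)%N = c t.
  move=> tk; rewrite /c (divn_small tk) [nth _ _ 0]/=.
  rewrite nth_default; last by rewrite sizeBs sqr -addnA divnMDl // leq_addr.
  rewrite !ffunE p1E permM permE; congr (label_item (p0 _)).
  apply: val_inj; rewrite /= sqr -addnA modnMDl modnDml (modn_small tk).
  by rewrite addnAC subnKC 1?ltnW // modnDl modn_small.
have cmod t : (t < s + k)%N -> c (t %% s)%N = c t.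
  move=> tsk; have [lt|le] := ltnP t s; first by rewrite modn_small.
  have tk : (t - s < k)%N by lia.
  rewrite -{1}(subnKC le) modnDl modn_small; last exact: ltn_trans ks.
  by rewrite -wrap // subnKC.
pose phi (t : 'I_s) := c t.
(* A special vertex adds only the excess of its [kappa] over that of the label it replaces;
   truncated subtraction keeps this an upper bound. *)
have cost (kappa : item k -> nat) : (\sum_t kappa (phi t) <=
    q * \sum_l kappa (label_item l) +
    \sum_(i < k | (i < r)%N) kappa (label_item (p1 i)) +
    \sum_(t <- ts) kappa (swap_item t.1 t.2) +
    (kappa (inr true) - kappa (label_item b0)) +
    (kappa (inr false) - kappa (label_item b1)))%N.
  pose F b i := kappa (nth d Bs b i).
  have -> : (\sum_t kappa (phi t) = \sum_(0 <= t < q * k + r) F (t %/ k) (slot k0 t))%N.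
    by rewrite -sqr big_mkord.
  rewrite sum_over_blocks ?(ltnW rk) //.
  have -> : (\sum_(i < k | i < r) F q i = \sum_(i < k | i < r) kappa (label_item (p1 i)))%N.
    by apply: eq_bigr => i _; rewrite /F nth_default ?sizeBs // ffunE.
  have -> : (\sum_(0 <= b < q) \sum_i F b i = \sum_(B <- Bs) block_cost kappa B)%N.
    by rewrite (big_nth d) sizeBs.
  rewrite /Bs big_cons big_cat big_cat /= !big_cons big_nil addn0.
  have -> : (\sum_(B <- nseq (q - ((size ts).*2 + 5)) d) block_cost kappa B =
      (q - ((size ts).*2 + 5)) * \sum_l kappa (label_item l))%N.
    by rewrite big_nseq plain_cost iter_addn_0 mulnC.
  rewrite !plain_cost.
  have := subst_cost label_item kappa p1 b0 (inr true).
  have := subst_cost label_item kappa p1 b1 (inr false).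
  have := swap_blocks_cost label_item swap_item kappa p0 tsn.
  have qE : q = (5 + (size ts).*2 + (q - ((size ts).*2 + 5)))%N by lia.
  rewrite {2}qE !mulnDl.
  move: (\sum_(B <- swap_blocks _ _ _ _) _)%N (\sum_l _)%N => a K.
  move: (block_cost _ _) (block_cost _ _) => x1 x2.
  move: (_ * K)%N (_ * K)%N => m1 m2.
  move: (\sum_(_ <- ts) _)%N (\sum_(_ < k | _) _)%N => m3 m4.
  by move: (kappa (inr true)) (kappa (inr false)) (kappa _) (kappa _) => z1 z2 z3 z4; clear; lia.
have count (P : pred (item k)) : #|[set t | P (phi t)]| = (\sum_t P (phi t))%N.
  by rewrite -sum1dep_card big_mkcond; apply: eq_bigr => t _; case: (P _).
have blk b i : (b < q)%N -> (i < k)%N -> (b * k + i < s)%N.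
  move=> bq ik; rewrite sqr; apply: (@leq_trans (b.+1 * k)); first by rewrite mulSn addnC ltn_add2r.
  by apply: leq_trans (leq_addr _ _); rewrite leq_mul2r bq orbT.
have phiblk b (i : 'I_k) (bq : (b < q)%N) : phi (Ordinal (blk b i bq (ltn_ord i))) = nth d Bs b i.
  by rewrite /phi /c /= divnMDl // divn_small // addn0 slot_block.
pose m := (size ts).*2.
have mq : (m.+1 < q)%N by rewrite /m; lia.
have mq2 : (m.+3 < q)%N by rewrite /m; lia.
have nthU : nth d Bs m.+1 = subst_block label_item p1 b0 (inr true).
  by rewrite /= nth_cat size_swap_blocks ltnn subnn.
have nthW : nth d Bs m.+3 = subst_block label_item p1 b1 (inr false).
  rewrite /= nth_cat size_swap_blocks -/m ltnNge (leq_trans (leqnSn _)) //=.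
  by rewrite (_ : (m.+2 - m)%N = 2%N) //; lia.
pose tU := Ordinal (blk _ _ mq (ltn_ord ((p1^-1)%g b0))).
pose tW := Ordinal (blk _ _ mq2 (ltn_ord ((p1^-1)%g b1))).
have phiU : phi tU = inr true by rewrite phiblk nthU ffunE permKV eqxx.
have phiW : phi tW = inr false by rewrite phiblk nthW ffunE permKV eqxx.
have uniq (u : bool) t t' : phi t = inr u -> phi t' = inr u -> t = t'.
  move=> pt pt'; have : (#|[set t | phi t == inr u]| <= 1)%N.
    rewrite (count (pred1 (inr u))); apply: leq_trans (cost (fun x => pred1 (inr u) x : nat)) _ => /=.
    rewrite !big1 //=.
    by rewrite muln0 !add0n; case: u {pt pt'}.
  by move/card_le1_eqP; apply; rewrite inE ?pt ?pt'.
exists phi, tU, tW; split.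
- by move=> t; apply/eqP/eqP => [|->//]; move/uniq; apply.
- by move=> t; apply/eqP/eqP => [|->//]; move/uniq; apply.
- move=> E [E0 Ey EU EW] e /imsetP[i _ ->].
  have pathBs : path (block_step E) (plain label_item p0) tail.
    rewrite cat_path path_swap_blocks //= last_swap_blocks -/p1 -/d.
    have [-> ->] := step_subst E0 p1 EU; have [-> ->] := step_subst E0 p1 EW.
    rewrite /=; elim: (q - _)%N => //= n ->.
    by rewrite step_plain.
  have lastBs : last (plain label_item p0) tail = d.
    rewrite last_cat /=; elim: (q - _)%N => //=.
  have step b : block_step E (nth d Bs b) (nth d Bs b.+1).
    by apply: path_nth_default => //; apply: step_plain.
  have /forallP/(_ (slot k0 i)) := step (i %/ k)%N.
  rewrite -imset_comp; congr (_ \in E).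
  have iE : val i = (i %/ k * k + i %% k)%N by exact: divn_eq.
  have cE j : (j < k)%N -> phi (iter j (@ordS s) i) = c (i + j)%N.
    move=> jk; rewrite /phi val_iter_ordS cmod //.
    apply: (@leq_trans (s + j)); first by rewrite ltn_add2r.
    by rewrite leq_add2l; exact: ltnW.
  apply/setP => x; apply/imsetP/imsetP => -[j _ ->].
    have [lt|le] := ltnP j (slot k0 i).
      have lt' : (k - i %% k + j < k)%N by move: lt (ltn_pmod i k0) => /=; lia.
      exists (Ordinal lt') => //=; rewrite cE //= /c.
      have -> : (i + (k - i %% k + j) = (i %/ k).+1 * k + j)%N.
        by rewrite {1}iE mulSn; have := ltn_pmod i k0; lia.
      by rewrite divnMDl // (divn_small (ltn_ord j)) addn0 slot_block.
    have lt' : (j - i %% k < k)%N by have := ltn_ord j; lia.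
    exists (Ordinal lt') => //=; rewrite cE //= /c.
    have -> : (i + (j - i %% k) = (i %/ k) * k + j)%N.
      by rewrite {1}iE; move: le => /=; lia.
    by rewrite divnMDl // (divn_small (ltn_ord j)) addn0 slot_block.
  exists (slot k0 (i + j)) => //=; rewrite cE // /c.
  have ltj := ltn_ord j; have lti := ltn_pmod i k0.
  have [lt|le] := ltnP (i %% k + j) k.
    have E1 : (i + j = (i %/ k) * k + (i %% k + j))%N by rewrite {1}iE; lia.
    have -> : ((i + j) %/ k = i %/ k)%N.
      by rewrite E1 divnMDl // (divn_small lt) addn0.
    have -> : ((i + j) %% k = i %% k + j)%N by rewrite {1}E1 modnMDl modn_small.
    by rewrite ltnNge leq_addr.
  have E1 : (i + j = (i %/ k).+1 * k + (i %% k + j - k))%N.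
    by rewrite {1}iE mulSn; lia.
  have lt : (i %% k + j - k < k)%N by lia.
  have -> : ((i + j) %/ k = (i %/ k).+1)%N.
    by rewrite E1 divnMDl // (divn_small lt) addn0.
  have -> : ((i + j) %% k = i %% k + j - k)%N by rewrite {1}E1 modnMDl modn_small.
  by case: ifP => //; lia.
split.
- rewrite (count (fun x => forget x == inl top)).
  apply: leq_trans (cost (fun x => (forget x == inl top) : nat)) _ => /=.
  have -> : (\sum_l (forget (label_item l) == inl top) = 1)%N.
    rewrite (bigD1 top) //= eqxx big1 // => l /negbTE lt.
    by rewrite (_ : (_ == _) = (l == top)) ?lt.
  rewrite muln1 big1 => [|i ir]; last first.
    rewrite (_ : (_ == _) = (p1 i == top)) // p1E permM permE -p0top (inj_eq perm_inj).
    apply/eqP; rewrite eqb0; apply/eqP => /(congr1 val) /=.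
    by rewrite mod0n modn_small; lia.
  rewrite (_ : (\sum_(t <- ts) _)%N = 0%N) ?big1 //=.
  by rewrite !addn0 !subnn !addn0.
- set P := fun x : item k => if forget x is inr _ then true else false.
  apply: leq_trans tsS; rewrite leq_add2r (count P); apply: leq_trans (cost (fun x => P x : nat)) _ => /=.
  rewrite [X in (q * X)%N]big1 // muln0 add0n [X in (X + _ + _ + _)%N]big1 // add0n /=.
  by rewrite !addn0 sum1_size.
- set P := fun x : item k => if forget x is inr z then ~~ G z.1 z.2 else false.
  rewrite (count P); apply: leq_trans (cost (fun x => P x : nat)) _ => /=.
  rewrite [X in (q * X)%N]big1 // muln0 add0n [X in (X + _ + _ + _)%N]big1 // add0n /=.
  by rewrite !addn0 -big_mkcond sum1_count.
Qed.
End Walk.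

(** * Neighbourhoods, degenerate tuples and homomorphisms from blow-ups *)

Definition nb (V : finType) (H : hypergraph V) (S : {set V}) : {set V} :=
  [set v | v |: S \in H].

Section Neighbourhoods.
Variables (V : finType) (k : nat) (H : hypergraph V).
Hypotheses (k_gt0 : (0 < k)%N) (Hk : uniform k H).
Implicit Types (S e : {set V}).

Lemma edge_card e : e \in H -> #|e| = k.
Proof. by move=> eH; apply/eqP; move/forall_inP: Hk; apply. Qed.

Lemma nb_notin S v : #|S| = k.-1 -> v \in nb H S -> v \notin S.
Proof.
rewrite inE => cS /edge_card; rewrite cardsU1 cS.
by case: (v \in S) => //=; lia.
Qed.

Lemma codegree_nb S : #|S| = k.-1 -> codegree H S = #|nb H S|.
Proof.
move=> cS; rewrite /codegree -(card_in_imset (f := fun v => v |: S)); last first.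
  move=> v w /(nb_notin cS) vS /(nb_notin cS) wS vw.
  have : v \in w |: S by rewrite -vw setU11.
  by rewrite !inE (negbTE vS) orbF => /eqP.
apply: eq_card => e; rewrite inE; apply/andP/imsetP => [[eH Se]|[v]]; last first.
  by rewrite inE => vH ->; rewrite vH subsetUr.
have : #|e :\: S| = 1%N by rewrite cardsDS // edge_card // cS; lia.
move=> /eqP/cards1P[v ev]; exists v.
  by rewrite inE -ev setUC setDE setUIr setUCr setIT (setUidPr Se).
by rewrite -ev setUC setDE setUIr setUCr setIT (setUidPr Se).
Qed.
End Neighbourhoods.

Lemma card_exists_le (T D : finType) (Q : D -> pred T) (m : nat) :
  (forall d, #|Q d| <= m)%N ->
  (#|[pred x | [exists d, Q d x]]| <= #|D| * m)%N.
Proof.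
move=> Qm; rewrite -sum_nat_const.
apply: (@leq_trans (\sum_(d in D) #|Q d|)%N); last exact: leq_sum.
under eq_bigr do rewrite -sum1_card big_mkcond.
rewrite exchange_big /= -sum1_card big_mkcond /=; apply: leq_sum => x _.
case: ifP => // /existsP[d Qd]; rewrite (bigD1 d) //=.
by rewrite -topredE /= Qd leq_addr.
Qed.

Section Degenerate.
Variables (D V : finType).
Hypothesis V_gt0 : (0 < #|V|)%N.

Lemma card_not_injective :
  (#|[pred v : {ffun D -> V} | ~~ injectiveb v]| <= #|D| ^ 2 * #|V| ^ #|D|.-1)%N.
Proof.
apply: (@leq_trans #|[pred v : {ffun D -> V} | [exists d : D * D,
    [pred v | (d.1 != d.2) && (v d.1 == v d.2)] v]]|).
  apply: subset_leq_card; apply/subsetP => v; rewrite !inE => /injectivePn[a [b ab vab]].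
  by apply/existsP; exists (a, b); rewrite /= ab vab eqxx.
have -> : (#|D| ^ 2 = #|{: D * D}|)%N by rewrite card_prod mulnn.
apply: card_exists_le => -[a b] /=; have [->|ab] := eqVneq a b.
  apply: (@leq_trans 0) => //; rewrite leqn0; apply/eqP/eq_card0 => v.
  by [].

have D0 : (0 < #|D|)%N by apply/card_gt0P; exists a.
rewrite -(leq_pmul2r V_gt0) -expnSr prednK // -card_ffun (card_sum_upd _ a).
rewrite -sum1_card; apply: leq_sum => g _.
rewrite -(card1 (g b)); apply: subset_leq_card; apply/subsetP => x.
by rewrite !inE upd_same upd_neq // eq_sym.
Qed.

Lemma card_hits (B : {set V}) :
  (#|[pred v : {ffun D -> V} | [exists d, v d \in B]]| <= #|D| * (#|B| * #|V| ^ #|D|.-1))%N.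
Proof.
apply: (@card_exists_le _ _ (fun d => [pred v : {ffun D -> V} | v d \in B])) => d.
have D0 : (0 < #|D|)%N by apply/card_gt0P; exists d.
rewrite -(leq_pmul2r V_gt0) (card_fixed_coordinate d (mem B)).
by rewrite -mulnA -expnSr prednK // mulnC.
Qed.
End Degenerate.

Definition extend (I B V : Type) (p : I -> V) (cst : B -> V) (x : I + B) : V :=
  match x with inl i => p i | inr b => cst b end.

(** Since [phi] maps the [k] positions of [e] onto a set of size [k], each index is used by at most
    one of them. The copies these positions read thus fit into one section, to which [P] applies.
    Through [psi] a position may read the copy of another one. *)
Lemma blowup_hom (I B J V T : finType) (k : nat) (H : hypergraph V) (cst : B -> V)
    (P : pred {ffun I -> V}) (E : {set {set (I + B)}})
    (g : {ffun I -> {ffun J -> V}}) (phi : T -> I + B) (psi : T -> J)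
    (e : {set T}) : (0 < k)%N ->
  (forall p, P p -> forall a, a \in E -> extend p cst @: a \in H) ->
  (forall a, a \in E -> #|a| = k) ->
  (forall f, P (section_of g f)) ->
  #|e| = k -> phi @: e \in E ->
  [set extend (fun i => g i (psi t)) cst (phi t) | t in e] \in H.
Proof.
move=> k0 PE Ek gP ek phie.
have phi_inj : {in e &, injective phi}.
  by apply/imset_injP; rewrite (Ek _ phie) ek.
have /card_gt0P[t0 _] : (0 < #|e|)%N by rewrite ek.
pose f : {ffun I -> J} :=
  [ffun i => psi (odflt t0 [pick t | (t \in e) && (phi t == inl i)])].
have := PE _ (gP f) _ phie; rewrite -imset_comp.
congr (_ \in H); apply: eq_in_imset => t te /=.
case E1: (phi t) => [i|b] //=; rewrite !ffunE; case: pickP => [u /andP[ue /eqP pu]|].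
  by rewrite (phi_inj u t ue te) // pu E1.
by move=> /(_ t); rewrite te E1 eqxx.
Qed.

Lemma card_tight_cycle_edge (k s : nat) (e : {set 'I_s}) :
  (k <= s)%N -> e \in tight_cycle k s -> #|e| = k.
Proof.
move=> ks /imsetP[i _ ->]; rewrite card_imset ?card_ord // => a b.
move=> /(congr1 val); rewrite !val_iter_ordS => /eqP; rewrite eqn_modDl.
rewrite !modn_small; first by move=> /eqP /val_inj.
all: exact: leq_trans (ltn_ord _) ks.
Qed.

(** * A copy of small weight *)

(** The witness is the least attained weight satisfying the second clause; if the third failed, the
    heaviest vertex below it would give a smaller one. *)
Lemma quantile (R : realType) (V : finType) (U : {set V}) (w : V -> R) (t : R) :
  (0 < #|U|)%N -> 0 <= t < 1 ->
  exists q, [/\ exists2 v, v \in U & q = w v,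
    t * #|U|%:R < #|[set v in U | w v <= q]|%:R,
    #|[set v in U | w v < q]|%:R <= t * #|U|%:R &
    forall q', t * #|U|%:R < #|[set v in U | w v <= q']|%:R -> q <= q'].
Proof.
move=> /card_gt0P[v0 v0U] /andP[t0 t1].
have tU0 : 0 <= t * #|U|%:R by rewrite mulr_ge0 ?ler0n.
have maxel (A : {set V}) : 0 < (#|A|%:R : R) ->
    exists2 v, v \in A & forall x, x \in A -> w x <= w v.
  rewrite ltr0n => /card_gt0P[a aA].
  by case: (arg_maxP w aA) => v vA vmax; exists v.
pose big v := (v \in U) && (t * #|U|%:R < #|[set x in U | w x <= w v]|%:R).
have [a aU amax] : exists2 v, v \in U & forall x, x \in U -> w x <= w v.
  by apply: maxel; rewrite ltr0n; apply/card_gt0P; exists v0.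
have biga : big a.
  rewrite /big aU (_ : [set x in U | _] = U); last first.
    by apply/setP => x; rewrite inE; case: (boolP (x \in U)) => //= /amax.
  by rewrite gtr_pMl // ltr0n; apply/card_gt0P; exists v0.
case: (arg_minP w biga) => v /andP[vU vbig] vmin; exists (w v).
have minq q' : t * #|U|%:R < #|[set x in U | w x <= q']|%:R -> w v <= q'.
  move=> bq; have [b] := maxel _ (le_lt_trans tU0 bq).
  rewrite inE => /andP[bU bq'] bmax; apply: le_trans bq'; apply: vmin.
  rewrite /big bU; apply: lt_le_trans bq _; rewrite ler_nat subset_leq_card //.
  by apply/subsetP => x xA; have := bmax _ xA; move: xA; rewrite !inE => /andP[-> _].
split=> //; first by exists v.
rewrite leNgt; apply/negP => bq; have [b] := maxel _ (le_lt_trans tU0 bq).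
rewrite inE => /andP[bU bv] bmax; have : w v <= w b; last by rewrite leNgt bv.
apply: minq; apply: lt_le_trans bq _; rewrite ler_nat subset_leq_card //.
by apply/subsetP => x xA; have := bmax _ xA; move: xA; rewrite !inE => /andP[-> _].
Qed.

Lemma card_setI_ge (V : finType) (A B U : {set V}) : A \subset U -> B \subset U ->
  (#|A| + #|B| <= #|U| + #|A :&: B|)%N.
Proof.
move=> AU BU; rewrite -cardsUI leq_add2r subset_leq_card //.
by apply/subUsetP.
Qed.

Lemma card_three_sets (V : finType) (A B C L : {set V}) :
  A \subset L -> B \subset L -> C \subset L ->
  (#|A| + #|B| + #|C| <= #|L| + #|A :&: B| + #|A :&: C| + #|B :&: C|)%N.
Proof.
move=> AL BL CL; have ABL : A :|: B \subset L by apply/subUsetP.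
have := card_setI_ge ABL CL; rewrite setIUl.
have := cardsUI A B; have := cardsUI (A :&: C) (B :&: C); lia.
Qed.

Section PatternTuples.
Variables (k : nat) (V : finType) (H : hypergraph V).
Hypotheses (k_gt0 : (0 < k)%N) (Hk : uniform k H).

(* A tuple consists of the vertices inl l of an edge together with, for each pair
   of labels a, b, a common neighbour inr (a, b) of the edge minus a and of the
   edge minus b. *)
Definition core_index : finType := ('I_k + 'I_k * 'I_k)%type.
Implicit Type p : {ffun core_index -> V}.

Definition core p (D : {set 'I_k}) : {set V} := [set p (inl l) | l in D].

Definition core_rank (i : core_index) : nat :=
  if i is inl l then (k.-1 - l)%N else k.

Definition labels_inj p := injective (fun l : 'I_k => p (inl l)).

Lemma core_upd p i v (D : {set 'I_k}) :
  (forall l, l \in D -> inl l != i) -> core (upd p i v) D = core p D.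
Proof. by move=> Di; apply: eq_in_imset => l lD; rewrite upd_neq // Di. Qed.

Lemma card_core p D : labels_inj p -> #|core p D| = #|D|.
Proof. by move=> pinj; rewrite card_imset. Qed.

Lemma card_core_compl p a : labels_inj p -> #|core p [set~ a]| = k.-1.
Proof. by move=> /card_core ->; rewrite cardsC1 card_ord. Qed.

Definition core_edges p : Prop := labels_inj p /\ core p setT \in H /\
  forall a b, p (inr (a, b)) \in nb H (core p [set~ a]) :&: nb H (core p [set~ b]).

Lemma label_item_inj : injective (@label_item k).
Proof. by move=> a b []. Qed.

Lemma extend_labels p (cst : bool -> V) (D : {set 'I_k}) :
  extend p cst @: (@label_item k @: D) = core p D.
Proof. by rewrite -imset_comp. Qed.

Lemma card_labelsU x a : x \notin @label_item k @: [set~ a] ->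
  #|x |: @label_item k @: [set~ a]| = k.
Proof.
by move=> xn; rewrite cardsU1 xn card_imset ?cardsC1 ?card_ord;
  [rewrite add1n prednK|exact: label_item_inj].
Qed.

Lemma card_labelsT : #|@label_item k @: [set: 'I_k]| = k.
Proof. by rewrite card_imset ?cardsT ?card_ord //; exact: label_item_inj. Qed.

End PatternTuples.

Section LightTuples.
Variables (R : realType) (k s : nat) (V : finType) (H : hypergraph V).
Hypotheses (k_gt0 : (0 < k)%N) (Hk : uniform k H).
Variables (U L0 L1 L2 L3 : {set V}) (delta sigma c : R).
Local Notation u := (#|U|%:R : R).
Local Notation n := (#|V|%:R : R).
Hypotheses (delta_ge0 : 0 <= delta) (c_ge0 : 0 <= c).
Hypothesis codegU : forall S : {set V}, #|S| = k.-1 -> (1/2%:R + sigma/2%:R + delta) * u <= #|nb H S :&: U|%:R.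
Hypotheses (L1U : L1 \subset U) (L2U : L2 \subset U) (L3U : L3 \subset U).
Hypothesis L0_card : c * n + k%:R <= #|L0|%:R.
Hypothesis L1_card : (1/2%:R - sigma/2%:R - delta/2%:R) * u <= #|L1|%:R.
Hypothesis L2_card : 3%:R/4%:R * u <= #|L2|%:R.
Hypothesis L3_card : (1 - sigma - delta) * u <= #|L3|%:R.
Hypothesis c_le : c * n <= delta / 2%:R * u.
Hypothesis sigma_ge0 : 0 <= sigma.

Implicit Type p : {ffun core_index k -> V}.
Let top := slot k_gt0 0.

Definition common_nb p (a b : 'I_k) :=
  nb H (core p [set~ a]) :&: nb H (core p [set~ b]).

(** Asking for a positive share of common neighbours in [L2], not merely one, keeps the number of
    choices linear. *)
Definition cheap p (a b : 'I_k) : bool :=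
  delta * u <= #|common_nb p a b :&: L2|%:R.

(* The labels are chosen in decreasing order, so that label 0 completes the
   edge; the pairs come last. *)
Definition light_cond (i : core_index k) : pred {ffun core_index k -> V} :=
  match i with
  | inl l => fun p =>
     if l == top then p (inl l) \in nb H (core p [set~ l]) :&: L1
     else (p (inl l) \in L0) && [forall m : 'I_k, (l < m)%N ==> (p (inl m) != p (inl l))]
  | inr z => fun p => p (inr z) \in
     common_nb p z.1 z.2 :&: (if cheap p z.1 z.2 then L2 else L3)
  end.

Let edge_deg (S : {set V}) : #|S| = k.-1 -> forall L : {set V}, L \subset U ->
  (1/2%:R + sigma/2%:R + delta) * u + #|L|%:R <= u + #|nb H S :&: L|%:R.
Proof.
move=> cS L LU; apply: (@le_trans _ _ (#|nb H S :&: U|%:R + #|L|%:R)).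
  by rewrite lerD2r; exact: codegU.
have := card_setI_ge (subsetIr (nb H S) U) LU.
rewrite (_ : nb H S :&: U :&: L = nb H S :&: L); last by rewrite -setIA (setIidPr LU).
by rewrite -!natrD ler_nat.
Qed.

(** Label 0 is not explicitly required to differ from the others: it is a neighbour of the (k-1)-set
    they form, and such a set avoids its neighbours. *)
Lemma light_labels_inj p : (forall l, light_cond (inl l) p) -> labels_inj p.
Proof.
move=> pC.
have later (l m : 'I_k) : l != top -> (l < m)%N -> p (inl l) != p (inl m).
  move=> lt lm; have := pC l; rewrite /= (negbTE lt) => /andP[_ /forallP/(_ m)].
  by rewrite lm eq_sym.
have ntop l m : l != top -> m != top -> p (inl l) = p (inl m) -> l = m.
  move=> lt mt /eqP lm; apply: val_inj; case: (ltngtP l m) => // [/(later _ _ lt)|/(later _ _ mt)].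
    by rewrite lm.
  by rewrite eq_sym lm.
have topn l : l != top -> p (inl l) != p (inl top).
  move=> lt; have := pC top; rewrite /= eqxx inE => /andP[pn _].
  have cS : #|core p [set~ top]| = k.-1.
    rewrite card_in_imset ?cardsC1 ?card_ord // => a b; rewrite !inE; exact: ntop.
  apply: contraNneq (nb_notin k_gt0 Hk cS pn) => <-.
  by apply: imset_f; rewrite !inE.
move=> l m lm; have [lt|lt] := eqVneq l top; have [mt|mt] := eqVneq m top.
- by rewrite lt mt.
- by move: (topn m mt); rewrite -lt -lm eqxx.
- by move: (topn l lt); rewrite -mt lm eqxx.
- exact: ntop.
Qed.

(** In shares of [U], label 0 has at least (1/2 + sigma/2 + delta) + (1/2 - sigma/2 - delta/2) - 1 =
    delta/2 candidates in [L1], and an expensive swap has 2(1/2 + sigma/2 + delta) + (1 - sigma -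
    delta) - 2 = delta in [L3]. *)
Lemma light_tuples_dense :
  c ^+ #|core_index k| * n ^+ #|core_index k| <= #|[pred p | [forall i, light_cond i p]]|%:R.
Proof.
apply: (card_sequential (rk := @core_rank k)) => // [i j g v ji rji|i g gC].
  have rk_inl (l m : 'I_k) : (core_rank (inl l : core_index k) <= core_rank (inl m : core_index k))%N = (m <= l)%N.
    rewrite /core_rank /=; move: (ltn_ord l) (ltn_ord m); move: (l : nat) (m : nat) => a b.
    by clear; lia.
  case: j ji rji => [l|z] ji.
    case: i ji => [m ml|z _ _].
      rewrite rk_inl => lm.
      have lm' : (m < l)%N by rewrite ltn_neqAle lm andbT; apply: contra ml => /eqP/val_inj->.
      have ltop : (l == top) = false by apply/negbTE; apply: contraTneq lm' => ->; rewrite /= mod0n.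
      rewrite /= ltop upd_neq //; congr (_ && _); apply: eq_forallb => a.
      case: (ltnP l a) => //= la; rewrite upd_neq //.
      by apply: contraTneq la => -[->]; rewrite -leqNgt ltnW.
    rewrite /= !upd_neq // core_upd //; congr (if _ then _ else _ && _).
    by apply: eq_forallb => m; rewrite upd_neq.
  case: i ji => [m _|z' zz' _].
    by rewrite /core_rank /=; move: (ltn_ord m); move: (m : nat) => a; clear; lia.
  by rewrite /= upd_neq // /cheap /common_nb !core_upd.
case: i gC => [l|[a b]] gC.
  have laterC (m : 'I_k) : (l < m)%N -> light_cond (inl m) g.
    move=> lm; apply: gC; rewrite /core_rank /=; move: lm (ltn_ord m).
    by move: (l : nat) (m : nat) => a b; clear; lia.
  have [ltop|ltop] := eqVneq l top.
    have cl : #|core g [set~ l]| = k.-1.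
      rewrite card_in_imset ?cardsC1 ?card_ord // => x y; rewrite !inE => xl yl xy.
      have lt0 (z : 'I_k) : z != l -> (l < z)%N.
        by rewrite ltop /= mod0n lt0n => zt; apply: contraNneq zt => z0; apply/eqP/val_inj; rewrite /= mod0n.
      have nt z : z != l -> z != top by rewrite ltop.
      apply: val_inj; case: (ltngtP x y) => // [xy'|yx'].
        have := laterC _ (lt0 _ xl); rewrite /= (negbTE (nt _ xl)).
        by move=> /andP[_ /forallP/(_ y)]; rewrite xy' xy eqxx.
      have := laterC _ (lt0 _ yl); rewrite /= (negbTE (nt _ yl)).
      by move=> /andP[_ /forallP/(_ x)]; rewrite yx' xy eqxx.
    have -> : #|[pred v | light_cond (inl l) (upd g (inl l) v)]| = #|nb H (core g [set~ l]) :&: L1|.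
      have lt : (l == top) = true by apply/eqP.
      apply: eq_card => v; rewrite [LHS]inE /= lt upd_same core_upd //.
      by move=> m; rewrite !inE => ml; apply: contraNneq ml => -[->].
    by have h := edge_deg cl L1U; move: L1_card c_le h;
      move: u (#|L1|%:R : R) (c * _) (#|_|%:R) => x1 x2 x3 x4; lra.
  have : (#|L0| <= #|[pred v | light_cond (inl l) (upd g (inl l) v)]| + k)%N.
    have kE : (#|[set g (inl m) | m : 'I_k]| <= k)%N.
      by apply: leq_trans (leq_imset_card _ _) _; rewrite card_ord.
    apply: leq_trans (_ : _ <= #|L0 :\: [set g (inl m) | m : 'I_k]| + k)%N _.
      rewrite -(cardsID [set g (inl m) | m : 'I_k] L0) addnC leq_add2l.
      by apply: leq_trans kE; rewrite subset_leq_card ?subsetIr.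
    rewrite leq_add2r subset_leq_card //; apply/subsetP => v.
    rewrite in_setD => /andP[vn vL]; rewrite inE /= (negbTE ltop) upd_same vL.
    apply/forallP => m; apply/implyP => lm; rewrite upd_neq; last first.
      by apply: contraTneq lm => -[->]; rewrite ltnn.
    by apply: contraNneq vn => <-; apply: imset_f.
  by rewrite -(ler_nat R) natrD => h; move: L0_card h;
    move: (#|L0|%:R : R) (c * _) (#|_|%:R) => x1 x2 x3; lra.
have ginj : labels_inj g.
  apply: light_labels_inj => l; apply: gC; rewrite /core_rank /=.
  by move: (ltn_ord l); move: (l : nat) => m; clear -k_gt0; lia.
set ch := if cheap g a b then L2 else L3.
have -> : #|[pred v | light_cond (inr (a, b)) (upd g (inr (a, b)) v)]| = #|common_nb g a b :&: ch|.
  apply: eq_card => v; rewrite [LHS]inE /= upd_same /cheap /common_nb !core_upd //;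
  by rewrite [RHS]in_setI.
have u0 : 0 <= u by rewrite ler0n.
rewrite /ch; case: ifP => [|_]; first by rewrite /cheap => h; have du := mulr_ge0 delta_ge0 u0;
  move: h du c_le; move: u (c * _) (#|_|%:R) => x1 x2 x3; lra.
have da := edge_deg (card_core_compl a ginj) L3U.
have db := edge_deg (card_core_compl b ginj) L3U.
have := card_setI_ge (subsetIr (nb H (core g [set~ a])) L3) (subsetIr (nb H (core g [set~ b])) L3).
rewrite -setIIl -(ler_nat R) !natrD => dab; rewrite /common_nb.
by have du := mulr_ge0 delta_ge0 u0; move: da db dab L3_card c_le du;
  move: u (#|L3|%:R : R) (c * _) (#|_ :&: _ :&: L3|%:R : R) => x1 x2 x3 x4;
    move: (#|_|%:R) (#|_|%:R) => x5 x6; lra.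
Qed.

(** Inside a set of share 3/4 each of the three neighbourhoods has share at least 1/4 + delta, so
    the pairwise overlaps total at least 3 delta. A larger [L2] only increases them. *)
Lemma cheap_triple p : (forall l, light_cond (inl l) p) -> forall a b d,
  a != b -> a != d -> b != d -> [|| cheap p a b, cheap p a d | cheap p b d].
Proof.
move=> /light_labels_inj pinj a b d _ _ _.
have := card_three_sets (subsetIr (nb H (core p [set~ a])) L2)
  (subsetIr (nb H (core p [set~ b])) L2) (subsetIr (nb H (core p [set~ d])) L2).
rewrite -!setIIl -!/(common_nb _ _ _).
have da := edge_deg (card_core_compl a pinj) L2U.
have db := edge_deg (card_core_compl b pinj) L2U.
have dd := edge_deg (card_core_compl d pinj) L2U.
have u0 : 0 <= u by rewrite ler0n.
have su0 : 0 <= sigma * u by exact: mulr_ge0.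
rewrite -(ler_nat R) !natrD => dsum.
apply: contraT; rewrite !negb_or /cheap -!ltNge => /and3P[h1 h2 h3].
have du := mulr_ge0 delta_ge0 u0.
by move: da db dd dsum h1 h2 h3 L2_card du su0 u0;
  move: u (#|L2|%:R : R) (#|common_nb p a b :&: L2|%:R : R) (#|common_nb p a d :&: L2|%:R : R) (#|common_nb p b d :&: L2|%:R : R) => x1 x2 x3 x4 x5; move: (#|_|%:R) (#|_|%:R) (#|_|%:R) => x6 x7 x8; lra.
Qed.

Lemma light_core_edges p : (forall i, light_cond i p) -> core_edges H p.
Proof.
move=> pC; have pinj := light_labels_inj (fun l => pC (inl l)); split=> //; split.
  have := pC (inl top); rewrite /= eqxx inE => /andP[]; rewrite inE => pH _.
  rewrite (_ : core p setT = p (inl top) |: core p [set~ top]) //.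
  by rewrite /core -[X in X |: _]/((fun l => p (inl l)) top) -imsetU1 setUCr.
by move=> a b; have := pC (inr (a, b)); rewrite /= inE => /andP[].
Qed.
End LightTuples.

Lemma pigeonhole (T C : finType) (f : T -> C) (P : pred T) (c0 : C) :
  exists c, (#|P| <= #|C| * #|[pred x | P x && (f x == c)]|)%N.
Proof.
case: (@arg_maxnP _ c0 xpredT (fun c => #|[pred x | P x && (f x == c)]|) isT) => c _ cmax.
exists c; rewrite -sum1_card (partition_big f xpredT) //= -sum_nat_const.
apply: leq_sum => d _; apply: leq_trans (cmax d isT).
by rewrite -sum1_card; apply: eq_leq; apply: eq_bigl => x; rewrite !inE.
Qed.

Lemma exists_injective (R : realType) (D V : finType) (P : pred {ffun D -> V})
    (m : nat) (c : R) :
  #|D| = m -> (0 < m)%N -> (m ^ 2)%:R < c * #|V|%:R -> 0 <= c ->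
  c * #|V|%:R ^+ m <= #|P|%:R ->
  exists2 v, P v & injective v.
Proof.
move=> <- D0 cV c0 cP.
have V0 : (0 < #|V|)%N.
  by rewrite lt0n; apply: contraTneq cV => ->; rewrite mulr0 -leNgt ler0n.
have VR : (0 : R) < #|V|%:R by rewrite ltr0n.
have [/existsP[v /andP[Pv /injectiveP vinj]]|] := boolP [exists v, P v && injectiveb v].
  by exists v.
rewrite negb_exists => /forallP noinj.
have := card_not_injective D V0; rewrite -(ler_nat R) natrM.
have : (#|P|%:R : R) <= #|[pred v : {ffun D -> V} | ~~ injectiveb v]|%:R.
  rewrite ler_nat subset_leq_card //; apply/subsetP => v Pv; rewrite inE.
  by have := noinj v; rewrite negb_and => /orP[/negP[]|].
move=> h1 h2; have := le_trans cP (le_trans h1 h2).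
have -> : #|V|%:R ^+ #|D| = #|V|%:R * #|V|%:R ^+ #|D|.-1 :> R by rewrite -exprS prednK.
rewrite mulrA [(_ ^ _.-1)%:R]natrX ler_pM2r ?exprn_gt0 //.
by rewrite leNgt cV.
Qed.

Section WalkPattern.
Variables (k : nat) (V : finType) (H : hypergraph V).
Hypothesis (k_gt0 : (0 < k)%N).
Variables (P : pred {ffun core_index k -> V}) (cst : bool -> V).
Hypothesis P_core : forall p, P p -> core_edges H p.

(** Item sets that become edges under all tuples of [P] at once, which is what a blow-up requires.
    The size condition makes a walk injective on each of its edges. *)
Definition common_edges : {set {set item k}} :=
  [set a : {set item k} | (#|a| == k) && [forall p, P p ==> (extend p cst @: a \in H)]].

Lemma common_edgesP p a : P p -> a \in common_edges -> extend p cst @: a \in H.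
Proof. by move=> Pp; rewrite inE => /andP[_ /forallP/(_ p)/implyP]; apply. Qed.

Lemma common_edges_card a : a \in common_edges -> #|a| = k.
Proof. by rewrite inE => /andP[/eqP]. Qed.

Lemma common_labels : @label_item k @: [set: 'I_k] \in common_edges.
Proof.
rewrite inE card_labelsT eqxx; apply/forallP => p; apply/implyP => /P_core[_ [pH _]].
by rewrite extend_labels.
Qed.

Lemma common_edges_add x a : x \notin @label_item k @: [set~ a] ->
  (forall p, P p -> extend p cst x \in nb H (core p [set~ a])) ->
  x |: @label_item k @: [set~ a] \in common_edges.
Proof.
move=> xn xnb; rewrite inE card_labelsU // eqxx.
apply/forallP => p; apply/implyP => /xnb; rewrite inE => pH.
by rewrite imsetU1 extend_labels.
Qed.

Lemma common_swaps a b :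
  swap_item a b |: @label_item k @: [set~ a] \in common_edges /\
  swap_item a b |: @label_item k @: [set~ b] \in common_edges.
Proof.
by split; apply: common_edges_add; try (by apply/imsetP => -[]);
  move=> p /P_core[_ [_ /(_ a b)]]; rewrite inE => /andP[].
Qed.
End WalkPattern.

Lemma imset_labels (k : nat) (X : finType) (h : item k -> X) (D : {set 'I_k}) :
  h @: (@label_item k @: D) = [set h (label_item l) | l in D].
Proof. by rewrite -imset_comp. Qed.

Lemma sum_set_natr (R : realType) (T : finType) (P : pred T) :
  \sum_t ((P t)%:R : R) = #|[set t | P t]|%:R.
Proof.
by rewrite -natr_sum -sum1dep_card [in RHS]big_mkcond /=; congr (_%:R); apply: eq_bigr => t _; case: (P t).
Qed.

(* T is where the copy uses label 0, Y where it uses a swapping vertex, and B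
   where this vertex could only be found in L3. *)
Lemma classified_copy (R : realType) (k s : nat) (V : finType) (H : hypergraph V)
    (U L0 L1 L2 L3 : {set V}) (delta sigma c : R) :
  (1 < k)%N -> (5 * k ^ 2 <= s)%N -> (s %% k != 0)%N -> uniform k H ->
  0 <= delta -> 0 <= sigma -> 0 < c ->
  (forall S : {set V}, #|S| = k.-1 ->
     (1/2%:R + sigma/2%:R + delta) * #|U|%:R <= #|nb H S :&: U|%:R) ->
  L1 \subset U -> L2 \subset U -> L3 \subset U ->
  c * #|V|%:R + k%:R <= #|L0|%:R ->
  (1/2%:R - sigma/2%:R - delta/2%:R) * #|U|%:R <= #|L1|%:R ->
  3%:R/4%:R * (#|U|%:R : R) <= #|L2|%:R ->
  (1 - sigma - delta) * #|U|%:R <= #|L3|%:R ->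
  c * #|V|%:R <= delta / 2%:R * #|U|%:R ->
  ((s ^ 2)%:R : R) < (c ^+ #|core_index k| / #|{ffun 'I_k * 'I_k -> bool}|%:R)
     ^+ (s ^ #|core_index k|) * #|V|%:R ->
  exists (v : {ffun 'I_s -> V}) (T Y B : {set 'I_s}),
    [/\ is_copy (tight_cycle k s) H v,
        [/\ (#|T| <= s %/ k)%N, (#|Y| + 3 <= k.*2)%N, (#|B| <= 1)%N & B \subset Y] &
        forall t, v t \in
          if t \in B then L3 else if t \in Y then L2 else if t \in T then L1 else L0].
Proof.
move=> k1 s5 sm Hk d0 sg0 c0 codeg LU1 LU2 LU3 L0c L1c L2c L3c cn n_large.
have k0 : (0 < k)%N by exact: ltnW.
have s0 : (0 < s)%N by apply: leq_trans s5; rewrite muln_gt0 expn_gt0 k0.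
set n : R := #|V|%:R in L0c cn n_large.
pose I := core_index k; pose M := #|{ffun 'I_k * 'I_k -> bool}|.
have M0 : (0 < M)%N by apply/card_gt0P; exists [ffun=> true].
pose c1 := c ^+ #|I| / M%:R.
have c10 : 0 < c1 by rewrite divr_gt0 ?exprn_gt0 ?ltr0n.
pose c2 := c1 ^+ (s ^ #|I|).
have c20 : 0 < c2 by rewrite exprn_gt0.
have V0 : (0 < #|V|)%N.
  rewrite lt0n; apply: contraTneq n_large => V0.
  by rewrite /n V0 mulr0 -leNgt ler0n.
have nn0 : 0 < n by rewrite ltr0n.
pose cond := @light_cond R k V H k0 U L0 L1 L2 L3 delta.
pose P := [pred p : {ffun I -> V} | [forall i, cond i p]].
have Pdense : c ^+ #|I| * n ^+ #|I| <= #|P|%:R.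
  exact: (light_tuples_dense k0 Hk L2 d0 (ltW c0) codeg LU1 LU3 L0c L1c L3c cn).
pose ch (p : {ffun I -> V}) := [ffun z : 'I_k * 'I_k => cheap H U L2 delta p z.1 z.2].
(* Which pairs are cheap depends on the tuple. Keeping only the tuples with a most frequent pattern
   [gam] fixes one relation [G] for the walk. *)
have [gam Pgam] := pigeonhole ch P [ffun=> true].
pose Pg := [pred p | P p && (ch p == gam)].
have Pg_dense : c1 * n ^+ #|I| <= #|Pg|%:R.
  rewrite /c1 mulrAC ler_pdivrMr ?ltr0n //; apply: le_trans Pdense _.
  by rewrite mulrC -natrM ler_nat.
have Pg_cond p : Pg p -> forall i, cond i p by move=> /andP[/forallP].
have [pg Pgpg] : exists p, Pg p.
  have : (0 < #|Pg|)%N.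
    by rewrite -(ltr0n R); apply: lt_le_trans Pg_dense; rewrite mulr_gt0 ?exprn_gt0.
  by case/card_gt0P => p; exists p.
pose top := slot k0 0.
pose G a b := gam (a, b).
have G3 a b d : a != b -> a != d -> b != d -> [|| G a b, G a d | G b d].
  have := cheap_triple Hk d0 codeg LU2 L2c sg0
    (fun l => Pg_cond _ Pgpg (inl l)) (a := a) (b := b) (d := d).
  by have /andP[_ /eqP gg] := Pgpg; rewrite /G -gg /ch !ffunE /=.
have [phi [tU [tW [_ _ hom [ntop ny nbad]]]]] := closed_walk k1 s5 sm top top top G3.
pose fphi t := forget top top (phi t).
have Pg_core p : Pg p -> core_edges H p.
  by move=> /Pg_cond; exact: light_core_edges.
have [v0 _] : exists v : V, true by case/card_gt0P: V0 => v _; exists v.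
pose cst (b : bool) := v0.
pose E := common_edges H Pg cst.
(* No special vertices are wanted here: both are identified with label 0, whose place they take. *)
pose E' : {set {set item k}} := [set a : {set item k} | (fun x => inl (forget top top x)) @: a \in E].
have pattern : walk_pattern top top E'.
  have lE (D : {set 'I_k}) : (fun x => inl (forget top top x) : item k) @: (@label_item k @: D)
      = @label_item k @: D by rewrite imset_labels.
  have tE (b : bool) : inr b |: @label_item k @: [set~ top] \in E'.
    rewrite inE imsetU1 lE (_ : inl _ = label_item top); last by case: b.
    by rewrite -imsetU1 setUCr; exact: common_labels.
  split=> //; first by rewrite inE lE; exact: common_labels.
  move=> a b _; have [h1 h2] := common_swaps k0 cst Pg_core a b.
  by split; rewrite inE imsetU1 lE.
have := blowup_dense tU (ltW c10) V0 Pg_dense fphi; rewrite card_ord -/c2.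
case/(exists_injective (card_ord s) s0 n_large (ltW c20)) => v.
case/existsP=> g /andP[/forallP gP /forallP vg] vinj.
have vE t : v t = g (fphi t) t by apply/eqP.
have v_cond t i : v t = v t -> cond i (section_of g [ffun=> t]).
  by move=> _; apply: Pg_cond; exact: gP.
pose isy t := if fphi t is inr _ then true else false.
pose isb t := if fphi t is inr z then ~~ G z.1 z.2 else false.
exists v, [set t | fphi t == inl top], [set t | if fphi t is inr _ then true else false],
  [set t | if fphi t is inr z then ~~ G z.1 z.2 else false]; split.
- apply/andP; split; first exact/injectiveP.
  apply/forall_inP => e eT.
  have ks : (k <= s)%N.
    by apply: leq_trans s5; rewrite expnS expn1 mulnCA leq_pmulr // muln_gt0.
  have ek := card_tight_cycle_edge ks eT.
  have := hom E' pattern e eT; rewrite inE -imset_comp => eE.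
  have := @blowup_hom _ _ _ _ _ k H cst Pg E g _ id e k0
     (fun p Pp a aE => common_edgesP Pp aE) (fun a aE => common_edges_card aE) gP ek eE.
  by congr (_ \in H); apply: eq_imset => t /=; rewrite vE.
- by split=> //; apply/subsetP => t; rewrite !inE; case: (fphi t).
move=> t; have := v_cond t (fphi t) erefl; rewrite vE !inE /cond /light_cond.
case: (fphi t) => [l|z].
  rewrite (_ : (inl l == inl top) = (l == top)) // -/top ffunE ffunE.
  by have [lt|_] := eqVneq l top; [rewrite inE => /andP[]|case/andP].
have /andP[_ /eqP gg] := gP [ffun=> t].
have -> : cheap H U L2 delta (section_of g [ffun=> t]) z.1 z.2 = G z.1 z.2.
  by rewrite /G -gg /ch ffunE -surjective_pairing.
by rewrite inE => /andP[_]; rewrite !ffunE; case: (G _ _).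
Qed.

(** For k >= 3 the quotient is at most s/3 and s >= 5k^2 leaves plenty of room. For k = 2 the first
    bound is an equality, and it needs [s] odd. *)
Lemma walk_counts (k s : nat) : (1 < k)%N -> (5 * k ^ 2 <= s)%N -> (s %% k != 0)%N ->
  (2 * (s %/ k + (k.*2 - 3)) <= s + 1)%N /\ (4 * (k.*2 - 3) <= s)%N.
Proof.
move=> k1 s5 sm; have k0 : (0 < k)%N by exact: ltnW.
have k4 : (2 * k <= k ^ 2)%N by rewrite -mulnn leq_mul2r k1 orbT.
split; last by lia.
have [k3|k2] := leqP 3 k.
  have k9 : (3 * k <= k ^ 2)%N by rewrite -mulnn leq_mul2r k3 orbT.
  have : (s %/ k * 3 <= s)%N by apply: leq_trans (leq_trunc_div s k); rewrite leq_mul2l k3 orbT.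
  by lia.
have k2E : k = 2%N by lia.
by move: sm; rewrite k2E; lia.
Qed.

Lemma sum_layers_le (R : realType) (J : finType) (x : J -> R) (T Y B : {set J})
    (q0 q1 q2 q3 : R) :
  q0 <= q1 -> q1 <= q2 -> q2 <= q3 -> B \subset Y ->
  (forall t, x t <= if t \in B then q3 else if t \in Y then q2 else
                    if t \in T then q1 else q0) ->
  \sum_t x t <= #|J|%:R * q0 + (q1 - q0) * (#|T|%:R + #|Y|%:R) + (q2 - q1) * #|Y|%:R
    + (q3 - q2) * #|B|%:R.
Proof.
move=> q01 q12 q23 BY xle.
have card_sum (A : {set J}) : (#|A|%:R : R) = \sum_t (t \in A)%:R.
  by rewrite sum_set_natr; congr (_%:R); apply: eq_card => t; rewrite !inE.
have -> : #|J|%:R * q0 = \sum_(t : J) q0 by rewrite sumr_const mulr_natl.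
rewrite !card_sum -big_split /= !mulr_sumr -!big_split /=; apply: ler_sum => t _.
apply: le_trans (xle t) _.
case: ifP => [tB|_]; first by rewrite (subsetP BY _ tB); case: (t \in T); rewrite /=; lra.
by case: ifP => _; case: (t \in T); rewrite /=; lra.
Qed.

(** Layer-cake decomposition: an increment is collected by all vertices of weight at least its upper
    threshold, a share of at least one minus the corresponding rank. *)
Lemma sum_layers_ge (R : realType) (V : finType) (U : {set V}) (w : V -> R)
    (q0 q1 q2 q3 t0 t1 t2 t3 : R) :
  0 <= q0 -> q0 <= q1 -> q1 <= q2 -> q2 <= q3 -> (forall v, 0 <= w v) ->
  #|[set v in U | w v < q0]|%:R <= t0 * #|U|%:R ->
  #|[set v in U | w v < q1]|%:R <= t1 * #|U|%:R ->
  #|[set v in U | w v < q2]|%:R <= t2 * #|U|%:R ->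
  #|[set v in U | w v < q3]|%:R <= t3 * #|U|%:R ->
  #|U|%:R * ((1 - t0) * q0 + (1 - t1) * (q1 - q0) + (1 - t2) * (q2 - q1) + (1 - t3) * (q3 - q2))
    <= \sum_(v in U) w v.
Proof.
move=> q00 q01 q12 q23 w0.
have cge q t : #|[set x in U | w x < q]|%:R <= t * #|U|%:R ->
    (1 - t) * #|U|%:R <= \sum_(x in U) ((q <= w x)%R%:R : R).
  move=> h; rewrite -natr_sum.
  have -> : (\sum_(x in U) (q <= w x)%R)%N = #|[set x in U | q <= w x]|.
    by rewrite -sum1dep_card big_mkcondr; apply: eq_bigr => x _; case: (_ <= _).
  have : (#|U| = #|[set x in U | (w x < q)%R]| + #|[set x in U | (q <= w x)%R]|)%N.
    rewrite -(cardsID [set x | w x < q]); congr (_ + _)%N; apply: eq_card => x; rewrite !inE //.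
    by rewrite -leNgt andbC.
  by move/(congr1 (fun m => m%:R : R)); rewrite natrD; lra.
move=> /cge c0 /cge c1 /cge c2 /cge c3.
have h0 := ler_wpM2l q00 c0.
have h1 := ler_wpM2l (etrans (subr_ge0 _ _) q01) c1.
have h2 := ler_wpM2l (etrans (subr_ge0 _ _) q12) c2.
have h3 := ler_wpM2l (etrans (subr_ge0 _ _) q23) c3.
apply: le_trans (_ : q0 * \sum_(x in U) ((q0 <= w x)%R%:R : R) +
   (q1 - q0) * \sum_(x in U) ((q1 <= w x)%R%:R : R) +
   (q2 - q1) * \sum_(x in U) ((q2 <= w x)%R%:R : R) +
   (q3 - q2) * \sum_(x in U) ((q3 <= w x)%R%:R : R) <= _).
  have e (u a b c d A B C D : R) : u * (A * a + B * b + C * c + D * d) =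
    a * (A * u) + b * (B * u) + c * (C * u) + d * (D * u) by ring.
  by rewrite e !lerD.
rewrite !mulr_sumr -!big_split /=; apply: ler_sum => x _; have wx := w0 x.
by case: (leP q0 (w x)) => a0; case: (leP q1 (w x)) => a1; case: (leP q2 (w x)) => a2;
  case: (leP q3 (w x)) => a3; rewrite /=; lra.
Qed.

(** Coefficients are compared increment by increment. The factor 1 - zeta pays for the lowest layer,
    whose threshold has rank zeta instead of 0. *)
Lemma layers_compare (R : realType) (s n1 n2 n3 delta zeta q0 q1 q2 q3 : R) :
  0 < s -> 0 <= delta -> 0 <= zeta -> 0 <= n1 -> 0 <= n2 -> 0 <= n3 ->
  n1 <= (s + 1) / 2%:R -> n2 <= s / 4%:R -> n3 <= 1 ->
  q0 <= q1 -> q1 <= q2 -> q2 <= q3 ->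
  (1 - zeta) * (s * q0 + (q1 - q0) * n1 + (q2 - q1) * n2 + (q3 - q2) * n3) <=
  s * ((1 - zeta) * q0 + (1 - (1/2%:R - s^-1/2%:R - delta/2%:R)) * (q1 - q0) +
       (1 - 3%:R/4%:R) * (q2 - q1) + (1 - (1 - s^-1 - delta)) * (q3 - q2)).
Proof.
move=> s0 d0 z0 n10 n20 n30 h1 h2 h3 q01 q12 q23.
have sn : s != 0 by rewrite gt_eqF.
have si : s * s^-1 = 1 by rewrite mulfV // gt_eqF.
have D1 : 0 <= q1 - q0 by rewrite subr_ge0.
have D2 : 0 <= q2 - q1 by rewrite subr_ge0.
have D3 : 0 <= q3 - q2 by rewrite subr_ge0.
move: (q1 - q0) (q2 - q1) (q3 - q2) D1 D2 D3 => a b c D1 D2 D3 {q01 q12 q23}.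
have A1 := ler_wpM2l D1 h1; have A2 := ler_wpM2l D2 h2; have A3 := ler_wpM2l D3 h3.
have sd : 0 <= s * delta by rewrite mulr_ge0 // ltW.
have B1 := mulr_ge0 D1 sd; have B3 := mulr_ge0 D3 sd.
have Z1 := mulr_ge0 z0 (mulr_ge0 D1 n10); have Z2 := mulr_ge0 z0 (mulr_ge0 D2 n20).
have Z3 := mulr_ge0 z0 (mulr_ge0 D3 n30).
have -> : s * ((1 - zeta) * q0 + (1 - (1/2%:R - s^-1/2%:R - delta/2%:R)) * a +
       (1 - 3%:R/4%:R) * b + (1 - (1 - s^-1 - delta)) * c) =
  (1 - zeta) * (s * q0) + a * ((s + s * s^-1) / 2%:R) + a * (s * delta) / 2%:R + b * (s / 4%:R) +
  c * (s * s^-1) + c * (s * delta) by field.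
rewrite si mulr1.
have -> : (1 - zeta) * (s * q0 + a * n1 + b * n2 + c * n3) =
  (1 - zeta) * (s * q0) + a * n1 + b * n2 + c * n3
  - zeta * (a * n1) - zeta * (b * n2) - zeta * (c * n3) by ring.
by lra.
Qed.

Lemma light_copy (R : realType) (k s : nat) (delta zeta eps : R) :
  (1 < k)%N -> (5 * k ^ 2 <= s)%N -> (s %% k != 0)%N ->
  0 < delta <= 20%:R^-1 -> 0 < zeta <= 4%:R^-1 -> 0 < eps ->
  exists n0 : nat, forall (V : finType) (H : hypergraph V) (U : {set V}) (w : V -> R),
    (n0 <= #|V|)%N -> uniform k H -> eps * #|V|%:R <= #|U|%:R ->
    (forall S : {set V}, #|S| = k.-1 ->
       (1/2%:R + s%:R^-1/2%:R + delta) * #|U|%:R <= #|nb H S :&: U|%:R) ->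
    (forall v, 0 <= w v) ->
    exists f : {ffun 'I_s -> V}, [/\ is_copy (tight_cycle k s) H f,
      copy_vertices f \subset U &
      (1 - zeta) * #|U|%:R * (\sum_(v in copy_vertices f) w v)
        <= s%:R * \sum_(v in U) w v].
Proof.
move=> k1 s5 sm /andP[d0 d20] /andP[z0 z4] e0.
have k0 : (0 < k)%N by exact: ltnW.
have s20 : (20 <= s)%N.
  by apply: leq_trans s5; rewrite (@leq_pmul2l 5 4) // (@leq_exp2r 2 k 2).
have s0 : (0 < s)%N by lia.
pose sigma : R := s%:R^-1.
have sR : (20%:R : R) <= s%:R by rewrite ler_nat.
have sg0 : 0 < sigma by rewrite invr_gt0; lra.
have sgs : sigma * s%:R = 1 by rewrite mulVf // gt_eqF //; lra.
have sg20 : sigma <= 20%:R^-1 by nra.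
(* Once |U| >= eps |V|, this makes c|V| at most both zeta/2 and delta/2 times |U|: the room
   available in the lowest layer and among the candidates for label 0. *)
pose c := eps * zeta * delta / 4%:R.
have c0 : 0 < c by rewrite /c !mulr_gt0 ?invr_gt0 ?ltr0n.
pose I := core_index k; pose M := #|{ffun 'I_k * 'I_k -> bool}|.
have M0 : (0 < M)%N by apply/card_gt0P; exists [ffun=> true].
pose c1 := c ^+ #|I| / M%:R.
have c10 : 0 < c1 by rewrite divr_gt0 ?exprn_gt0 ?ltr0n.
pose c2 := c1 ^+ (s ^ #|I|).
have c20 : 0 < c2 by rewrite exprn_gt0.
pose n0 := (Num.bound ((s ^ 2)%:R / c2) + Num.bound (2%:R * k%:R / (zeta * eps))).+1.
exists n0 => V H U w nV Hk eU codeg w0.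
set u : R := #|U|%:R in eU codeg *; set n : R := #|V|%:R in eU.
have n_gt : forall x, 0 <= x -> (Num.bound x < n0)%N -> x < n.
  move=> x x0 xn; apply: lt_le_trans (archi_boundP x0) _.
  by rewrite ler_nat (leq_trans (ltnW xn)).
have n1 : (s ^ 2)%:R / c2 < n.
  by apply: n_gt; rewrite ?divr_ge0 ?ler0n ?(ltW c20) // /n0 ltnS leq_addr.
have n2 : 2%:R * k%:R / (zeta * eps) < n.
  apply: n_gt; rewrite ?divr_ge0 ?mulr_ge0 ?ler0n ?(ltW z0) ?(ltW e0) //.
  by rewrite /n0 ltnS leq_addl.
have nn0 : 0 < n by apply: le_lt_trans n1; rewrite divr_ge0 ?ler0n ?(ltW c20).
have u0 : 0 < u by apply: lt_le_trans eU; rewrite mulr_gt0.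
have U0 : (0 < #|U|)%N by rewrite -(ltr0n R).
have V0 : (0 < #|V|)%N by rewrite -(ltr0n R).
have ku : 2%:R * k%:R <= zeta * u.
  rewrite ltr_pdivrMr ?mulr_gt0 // in n2; apply: le_trans (ltW n2) _.
  by rewrite mulrC -mulrA ler_pM2l.
(* The bounds on delta, 1/s and zeta ensure zeta < t1 < t2 < t3, hence the order of the
   quantiles. *)
pose t1 : R := 1/2%:R - sigma/2%:R - delta/2%:R.
pose t2 : R := 3%:R/4%:R; pose t3 : R := 1 - sigma - delta.
have [|q0 [[v0 v0U q0E] q0le q0lt q0min]] := @quantile R V U w zeta U0; first by lra.
have [|q1 [_ q1le q1lt q1min]] := @quantile R V U w t1 U0; first by rewrite /t1; lra.
have [|q2 [_ q2le q2lt q2min]] := @quantile R V U w t2 U0; first by rewrite /t2; lra.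
have [|q3 [_ q3le q3lt q3min]] := @quantile R V U w t3 U0; first by rewrite /t3; lra.
have q00 : 0 <= q0 by rewrite q0E.
have q01 : q0 <= q1 by apply: q0min; apply: le_lt_trans q1le; rewrite ler_pM2r // /t1; lra.
have q12 : q1 <= q2 by apply: q1min; apply: le_lt_trans q2le; rewrite ler_pM2r // /t1 /t2; lra.
have q23 : q2 <= q3 by apply: q2min; apply: le_lt_trans q3le; rewrite ler_pM2r // /t2 /t3; lra.
pose L q := [set v in U | w v <= q].
have LU q : L q \subset U by apply/subsetP => v; rewrite inE => /andP[].
have L0c : c * n + k%:R <= #|L q0|%:R.
  apply: le_trans (ltW q0le); rewrite -/u.
  have : c * n <= zeta / 2%:R * u; last by lra.
  have -> : c * n = zeta * delta / 4%:R * (eps * n) by rewrite /c; ring.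
  apply: le_trans (_ : zeta * delta / 4%:R * u <= _).
    by rewrite ler_wpM2l // !mulr_ge0 ?invr_ge0 ?ler0n // ltW.
  by rewrite ler_pM2r //; nra.
have cn : c * n <= delta / 2%:R * u.
  have -> : c * n = zeta * delta / 4%:R * (eps * n) by rewrite /c; ring.
  apply: le_trans (_ : zeta * delta / 4%:R * u <= _).
    by rewrite ler_wpM2l // !mulr_ge0 ?invr_ge0 ?ler0n // ltW.
  by rewrite ler_pM2r //; nra.
have n_large : ((s ^ 2)%:R : R) < c2 * n by rewrite ltr_pdivrMr // mulrC in n1.
have [v [T [Y [B [vcopy [cT cY cB BY] vcls]]]]] := classified_copy k1 s5 sm Hk (ltW d0) (ltW sg0) c0
  codeg (LU q1) (LU q2) (LU q3) L0c (ltW q1le) (ltW q2le) (ltW q3le) cn n_large.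
have vinj : injective v by case/andP: vcopy => /injectiveP.
exists v; split=> //.
  apply/subsetP => x /imsetP[t _ ->]; have := vcls t.
  by case: ifP => _; [|case: ifP => _; [|case: ifP => _]]; rewrite inE => /andP[].
have -> : \sum_(x in copy_vertices v) w x = \sum_t w (v t).
  by rewrite big_imset /=; [apply: eq_bigl => t; rewrite inE|move=> x y _ _; exact: vinj].
have W1 : \sum_t w (v t) <= #|'I_s|%:R * q0 + (q1 - q0) * (#|T|%:R + #|Y|%:R)
    + (q2 - q1) * #|Y|%:R + (q3 - q2) * #|B|%:R.
  apply: sum_layers_le => // t; have := vcls t.
  by case: ifP => _; [|case: ifP => _; [|case: ifP => _]]; rewrite inE => /andP[].
have W2 := sum_layers_ge q00 q01 q12 q23 w0 q0lt q1lt q2lt q3lt.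
have [K1 K2] := walk_counts k1 s5 sm.
have sR0 : (0 : R) < s%:R by rewrite ltr0n.
have K3 : (#|Y| <= k.*2 - 3)%N by rewrite -(leq_add2r 3) subnK // (leq_trans _ cY) ?leq_addl.
have N1 : (#|T|%:R + #|Y|%:R : R) <= (s%:R + 1) / 2%:R.
  rewrite ler_pdivlMr ?ltr0n // -natrD natr1 -natrM ler_nat mulnC.
  by rewrite addn1 in K1; apply: leq_trans K1; rewrite leq_mul2l leq_add.
have N2 : (#|Y|%:R : R) <= s%:R / 4%:R.
  rewrite ler_pdivlMr ?ltr0n // -natrM ler_nat mulnC.
  by apply: leq_trans K2; rewrite leq_mul2l.
have N3 : (#|B|%:R : R) <= 1 by rewrite (ler_nat _ _ 1).
have N10 : (0 : R) <= #|T|%:R + #|Y|%:R by rewrite addr_ge0 ?ler0n.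
have W3 := layers_compare (q0 := q0) sR0 (ltW d0) (ltW z0) N10 (ler0n _ _) (ler0n _ _) N1 N2 N3 q01 q12 q23.
apply: le_trans (ler_wpM2l (ltW sR0) W2).
rewrite card_ord in W1; have z1 : 0 <= 1 - zeta by rewrite subr_ge0 (le_trans z4) // invf_le1 ?ler1n ?ltr0n.
rewrite -mulrA mulrCA [leRHS]mulrCA ler_pM2l //.
exact: le_trans (ler_wpM2l z1 W1) W3.
Qed.

(** * Absorbers *)

Section ReachTuples.
Variables (R : realType) (k : nat) (V : finType) (H : hypergraph V).
Hypotheses (k_gt1 : (1 < k)%N) (Hk : uniform k H).
Variables (x z : V).

Let k_gt0 : (0 < k)%N := ltnW k_gt1.
Let l0 := slot k_gt0 0.
Let l1 := slot k_gt0 1.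
Let rest : {set 'I_k} := [set l : 'I_k | (1 < l)%N].

Implicit Type p : {ffun core_index k -> V}.

Lemma val_l0 : l0 = 0%N :> nat. Proof. by rewrite /= mod0n. Qed.
Lemma val_l1 : l1 = 1%N :> nat. Proof. by rewrite /= modn_small. Qed.

Lemma eq_l0 (l : 'I_k) : (l == l0) = (l == 0%N :> nat).
Proof. by rewrite -val_l0. Qed.

Lemma eq_l1 (l : 'I_k) : (l == l1) = (l == 1%N :> nat).
Proof. by rewrite -val_l1. Qed.

Lemma labels_but0 : [set~ l0] = l1 |: rest.
Proof.
apply/setP => l; rewrite !inE eq_l0 eq_l1.
by case: (nat_of_ord l) => [|[|m]].
Qed.

Lemma labels_but1 : [set~ l1] = l0 |: rest.
Proof.
apply/setP => l; rewrite !inE eq_l0 eq_l1.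
by case: (nat_of_ord l) => [|[|m]].
Qed.

Lemma card_rest : #|rest| = (k - 2)%N.
Proof.
have := cardsC1 l0; rewrite labels_but0 cardsU1 inE val_l1 card_ord ltnn /=.
by move=> h; rewrite -[LHS](addKn 1) h -subn1 -subnDA.
Qed.

(** Label 1 is a neighbour of [x] and the labels above 1, so [x] can replace label 0. Label 0 is a
    neighbour of [z] and those labels, so [z] can replace label 1; it also completes the edge. *)
Definition reach_cond (i : core_index k) : pred {ffun core_index k -> V} :=
  match i with
  | inl l => fun p =>
     if l == l0 then
       p (inl l) \in nb H (z |: core p rest) :&: nb H (core p [set~ l0])
     else if l == l1 then p (inl l) \in nb H (x |: core p rest)
     else [&& p (inl l) != x, p (inl l) != z &
           [forall m : 'I_k, (l < m)%N ==> (p (inl m) != p (inl l))]]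
  | inr a => fun p => p (inr a) \in common_nb H p a.1 a.2
  end.

Lemma rest_card p w : w = x \/ w = z -> (forall l, l \in rest -> reach_cond (inl l) p) ->
  #|w |: core p rest| = k.-1.
Proof.
move=> wxz pC.
have big (l : 'I_k) : l \in rest -> [&& p (inl l) != x, p (inl l) != z &
           [forall m : 'I_k, (l < m)%N ==> (p (inl m) != p (inl l))]].
  move=> lr; have := pC l lr; move: lr; rewrite inE /= => lr.
  by rewrite eq_l0 eq_l1; case: (nat_of_ord l) lr => [|[|m]].
have inj : {in rest &, injective (fun l => p (inl l))}.
  move=> l m lr mr lm; apply: val_inj; case: (ltngtP l m) => // [h|h].
    by have := big l lr => /and3P[_ _ /forallP/(_ m)]; rewrite h lm eqxx.
  by have := big m mr => /and3P[_ _ /forallP/(_ l)]; rewrite h lm eqxx.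
rewrite cardsU1 card_in_imset // card_rest.
have -> : w \notin core p rest.
  apply/imsetP => -[l lr wE]; have := big l lr => /and3P[].
  by case: wxz => <-; rewrite wE eqxx.
by lia.
Qed.

Lemma core_but0_card p : #|x |: core p rest| = k.-1 ->
  p (inl l1) \notin x |: core p rest -> #|core p [set~ l0]| = k.-1.
Proof.
move=> cx; rewrite in_setU1 negb_or => /andP[_ p1r].
have cE : core p (l1 |: rest) = p (inl l1) |: core p rest by rewrite /core imsetU1.
rewrite labels_but0 cE cardsU1 p1r.
have : (#|core p rest| <= k - 2)%N by rewrite -card_rest leq_imset_card.
by move: cx k_gt1; rewrite cardsU1; case: (x \notin _); move: #|core p rest| => m /=; lia.
Qed.

Lemma reach_labels_inj p : (forall l, reach_cond (inl l) p) -> labels_inj p.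
Proof.
move=> pC.
have cx := rest_card (or_introl erefl) (fun l _ => pC l).
have later (l m : 'I_k) : (l < m)%N -> p (inl l) != p (inl m).
  move=> lm; have := pC l; rewrite /=.
  have [l00|_] := eqVneq l l0.
    rewrite inE => /andP[_ pn].
    have c0 : #|core p [set~ l0]| = k.-1.
      have := pC l1; rewrite /= ifN; last by rewrite eq_l0 val_l1.
      by rewrite eqxx => /(nb_notin k_gt0 Hk cx); exact: core_but0_card.
    apply: contraNneq (nb_notin k_gt0 Hk c0 pn) => ->.
    by apply: imset_f; rewrite !inE; apply: contraTneq lm => ->; rewrite l00 ltnn.
  have [l11|_] := eqVneq l l1.
    move=> pn; apply: contraNneq (nb_notin k_gt0 Hk cx pn) => ->.
    apply/setU1P; right; apply: imset_f; rewrite inE.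
    by move: lm; rewrite l11 val_l1.
  by case/and3P=> _ _ /forallP/(_ m); rewrite lm eq_sym.
move=> l m /eqP lm; apply: val_inj; case: (ltngtP l m) => // [/later|/later].
  by rewrite lm.
by rewrite eq_sym lm.
Qed.

Lemma reach_edges p : (forall i, reach_cond i p) ->
  [/\ core_edges H p, x \in nb H (core p [set~ l0]) & z \in nb H (core p [set~ l1])].
Proof.
move=> pC; have pinj := reach_labels_inj (fun l => pC (inl l)).
have := pC (inl l0); rewrite /= eqxx inE => /andP[]; rewrite !inE => p0z p0.
have := pC (inl l1); rewrite /= ifN; last by rewrite eq_l0 val_l1.
rewrite eqxx inE => p1x.
have im1 (l : 'I_k) (D : {set 'I_k}) : core p (l |: D) = p (inl l) |: core p D.
  by rewrite /core imsetU1.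
split; first split=> //; first split.
- by rewrite -(setUCr [set l0]) im1.
- by move=> a b; exact: (pC (inr (a, b))).
- by rewrite labels_but0 im1 setUCA.
- by rewrite labels_but1 im1 setUCA.
Qed.
Variables (g c : R).
Local Notation n := (#|V|%:R : R).
Hypothesis codeg : forall S : {set V}, #|S| = k.-1 -> (1/2%:R + g) * n <= #|nb H S|%:R.
Hypotheses (c_ge0 : 0 <= c) (c_le : c * n <= 2%:R * g * n).
Hypothesis c_half : c * n <= 1 / 2%:R * n.
Hypothesis g_ge0 : 0 <= g.
Hypothesis c_small : c * n + (k + 2)%:R <= n.

Let two_nb (S S' : {set V}) : #|S| = k.-1 -> #|S'| = k.-1 ->
  c * n <= #|nb H S :&: nb H S'|%:R.
Proof.
move=> cS cS'; have h1 := codeg cS; have h2 := codeg cS'.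
have := card_setI_ge (subsetT (nb H S)) (subsetT (nb H S')); rewrite cardsT.
rewrite -(ler_nat R) !natrD => h3; move: h1 h2 h3 c_le.
by move: n (#|nb H S|%:R : R) (#|nb H S'|%:R : R) (#|_|%:R) (c * _) => a1 a2 a3 a4 a5; lra.
Qed.

Lemma reach_tuples_dense :
  c ^+ #|core_index k| * n ^+ #|core_index k| <= #|[pred p | [forall i, reach_cond i p]]|%:R.
Proof.
apply: (card_sequential (rk := @core_rank k)) => // [i j h v ji rji|i h hC].
  have rk_inl (l m : 'I_k) : (core_rank (inl l : core_index k) <= core_rank (inl m : core_index k))%N = (m <= l)%N.
    rewrite /core_rank /=; move: (ltn_ord l) (ltn_ord m); move: (l : nat) (m : nat) => a b.
    by clear; lia.
  case: j ji rji => [l|a] ji.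
    have rest_upd : (forall m : 'I_k, i = inl m -> (m <= 1)%N) -> core (upd h i v) rest = core h rest.
      move=> ile; apply: core_upd => m; rewrite inE => m1.
      by apply: contraTneq m1 => /esym/ile; rewrite -leqNgt.
    case: i ji rest_upd => [m ml|b _].
      rewrite rk_inl => ru lm.
      have lm' : (m < l)%N by rewrite ltn_neqAle lm andbT; apply: contra ml => /eqP/val_inj->.
      have ll0 : (l == l0) = false by rewrite eq_l0; apply/eqP; move: lm'; lia.
      rewrite /= ll0 upd_neq //; case: ifP => [/eqP l11|_].
        by rewrite ru // => _ [<-]; move: lm'; rewrite l11 val_l1; lia.
      congr [&& _, _ & _]; apply: eq_forallb => a.
      case: (ltnP l a) => //= la; rewrite upd_neq //.
      by apply: contraTneq la => -[->]; rewrite -leqNgt ltnW.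
    move=> ru _; rewrite /= ru // core_upd // !upd_neq //.
    by do 2 case: ifP => // _; congr [&& _, _ & _]; apply: eq_forallb => m; rewrite upd_neq.
  case: i ji => [m _|b ab _].
    by rewrite /core_rank /=; move: (ltn_ord m); move: (m : nat) => b; clear; lia.
  by rewrite /= upd_neq // /common_nb !core_upd.
case: i hC => [l|[a b]] hC; last first.
  have hinj : labels_inj h.
    apply: reach_labels_inj => l; apply: hC; rewrite /core_rank /=.
    by move: (ltn_ord l); move: (l : nat) => m; clear -k_gt0; lia.
  have -> : #|[pred v | reach_cond (inr (a, b)) (upd h (inr (a, b)) v)]| = #|common_nb H h a b|.
    apply: eq_card => v; rewrite [LHS]inE /= upd_same /common_nb !core_upd //. by rewrite in_setI.
  by apply: two_nb; apply: card_core_compl.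
have laterC (m : 'I_k) : (l < m)%N -> reach_cond (inl m) h.
  move=> lm; apply: hC; rewrite /core_rank /=; move: lm (ltn_ord m).
  by move: (l : nat) (m : nat) => a b; clear; lia.
have ru v : (l <= 1)%N -> core (upd h (inl l) v) rest = core h rest.
  move=> l_le1; apply: core_upd => m; rewrite inE => m1.
  by apply: contraTneq m1 => -[->]; rewrite -leqNgt.
have rest_ok : (l <= 1)%N -> forall m, m \in rest -> reach_cond (inl m) h.
  by move=> l_le1 m; rewrite inE => m1; apply: laterC; apply: leq_ltn_trans m1.
have [ll0|ll0] := eqVneq l l0.
  have l_le1 : (l <= 1)%N by rewrite ll0 val_l0.
  have -> : #|[pred v | reach_cond (inl l) (upd h (inl l) v)]| =
      #|nb H (z |: core h rest) :&: nb H (core h [set~ l0])|.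
    have lt : (l == l0) = true by apply/eqP.
    apply: eq_card => v; rewrite [LHS]inE /= lt upd_same ru // core_upd //.
    by move=> m; rewrite !inE ll0; apply: contra => /eqP[->].
  apply: two_nb; first by apply: rest_card; [right|exact: rest_ok].
  have := laterC l1; rewrite ll0 val_l0 val_l1 => /(_ isT) /=.
  rewrite ifN; last by rewrite eq_l0 val_l1.
  have cx := rest_card (or_introl erefl) (rest_ok l_le1).
  by rewrite eqxx => /(nb_notin k_gt0 Hk cx); exact: core_but0_card.
have [ll1|ll1] := eqVneq l l1.
  have l_le1 : (l <= 1)%N by rewrite ll1 val_l1.
  have -> : #|[pred v | reach_cond (inl l) (upd h (inl l) v)]| = #|nb H (x |: core h rest)|.
    have lt : (l == l1) = true by apply/eqP.
    by apply: eq_card => v; rewrite [LHS]inE /= (negbTE ll0) lt upd_same ru.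
  have := codeg (rest_card (or_introl erefl) (rest_ok l_le1)).
  have gn : 0 <= g * n by rewrite mulr_ge0 ?ler0n.
  move: c_half gn; move: n (c * _) (#|_|%:R) => a1 a2 a3; lra.
have sub : [set: V] :\: ([set x; z] :|: [set h (inl m) | m : 'I_k]) \subset
    [pred v | reach_cond (inl l) (upd h (inl l) v)].
  apply/subsetP => v; rewrite inE in_setT andbT in_setU !inE negb_or => /andP[].
  rewrite negb_or => /andP[vx vz] vn; rewrite /= (negbTE ll0) (negbTE ll1) upd_same vx vz /=.
  apply/forallP => m; apply/implyP => lm; rewrite upd_neq; last first.
    by apply: contraTneq lm => -[->]; rewrite ltnn.
  by apply: contraNneq vn => <-; apply: imset_f.
have := subset_leq_card sub; rewrite cardsDS ?subsetT // cardsT.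
have : (#|[set x; z] :|: [set h (inl m) | m : 'I_k]| <= k + 2)%N.
  rewrite addnC; apply: leq_trans (leq_card_setU _ _) _; apply: leq_add.
    by rewrite cards2; case: (_ != _).
  by apply: leq_trans (leq_imset_card _ _) _; rewrite card_ord.
move=> h1 h2; have h3 : (#|V| <= #|[pred v | reach_cond (inl l) (upd h (inl l) v)]| + (k + 2))%N.
  by rewrite addnC -leq_subLR (leq_trans (leq_sub2l _ h1)).
move: h3; rewrite -(ler_nat R) natrD; move: c_small.
by move: n (c * _) (#|_|%:R) ((k + 2)%:R) => a1 a2 a3 a4; lra.
Qed.

End ReachTuples.

Definition is_hom (k s : nat) (V : finType) (H : hypergraph V) (v : {ffun 'I_s -> V}) : bool :=
  [forall e in tight_cycle k s, (v @: e) \in H].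

Definition reroute (J : finType) (V : Type) (tU tW : J) (r : {ffun J -> V}) (z : V) :
  {ffun J -> V} := upd (upd r tU (r tW)) tW z.

(* The vertex r tW can take over position tU, where x was, and leave its own
   position to z: the same s - 1 vertices complete both x and z to a copy. *)
Lemma reach_dense (R : realType) (k s : nat) (g : R) :
  (1 < k)%N -> (5 * k ^ 2 <= s)%N -> (s %% k != 0)%N -> 0 < g <= 4%:R^-1 ->
  exists (tU tW : 'I_s) (beta : R) (n0 : nat), [/\ tU != tW, 0 < beta &
    forall (V : finType) (H : hypergraph V) (x z : V), (n0 <= #|V|)%N -> uniform k H ->
    (forall S : {set V}, #|S| = k.-1 -> (1/2%:R + g) * #|V|%:R <= #|nb H S|%:R) ->
    beta * #|V|%:R ^+ s <=
      #|[pred v : {ffun 'I_s -> V} | is_hom k H (upd v tU x) && is_hom k H (reroute tU tW v z)]|%:R].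
Proof.
move=> k1 s5 sm /andP[g0 g4].
pose k0 : (0 < k)%N := ltnW k1.
pose l0 := slot k0 0; pose l1 := slot k0 1.
(* Without weights every swap is good, so [G] is constantly true. The special vertices will be [x]
   in place of label 0 and [z] in place of label 1. *)
have [phi [tU [tW [phiU phiW hom _]]]] :=
  closed_walk k1 s5 sm (G := fun _ _ => true) l0 l0 l1 (fun _ _ _ _ _ _ => isT).
have tUW : tU != tW.
  by rewrite -phiW; have := phiU tU; rewrite eqxx => /eqP ->.
pose I := core_index k; pose c1 := g ^+ #|I|; pose beta := c1 ^+ (s ^ #|I|).
have c10 : 0 < c1 by rewrite exprn_gt0.
exists tU, tW, beta, (2 * (k + 2))%N; split=> //; first by rewrite exprn_gt0.
move=> V H x z nV Hk codeg; set n : R := #|V|%:R in codeg *.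
have V0 : (0 < #|V|)%N by apply: leq_trans nV; rewrite muln_gt0 addn2.
have nn0 : 0 < n by rewrite ltr0n.
have kn : 2%:R * (k + 2)%:R <= n by rewrite -natrM ler_nat.
have gn : g * n <= 4%:R^-1 * n by rewrite ler_pM2r.
have gn0 : 0 <= g * n by rewrite mulr_ge0 // ltW.
have A1 : g * n <= 2%:R * g * n by rewrite -mulrA; lra.
have A2 : g * n <= 1 / 2%:R * n by lra.
have A3 : g * n + (k + 2)%:R <= n. by lra.
pose P := [pred p : {ffun I -> V} | [forall i, @reach_cond k V H k1 x z i p]].
have Pdense : c1 * n ^+ #|I| <= #|P|%:R.
  exact: (reach_tuples_dense k1 Hk x z codeg (ltW g0) A1 A2 (ltW g0) A3).
have P_edges p : P p -> [/\ core_edges H p, x \in nb H (core p [set~ l0])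
    & z \in nb H (core p [set~ l1])].
  by move=> /forallP pC; exact: (reach_edges Hk pC).
pose cst (b : bool) := if b then x else z.
have P_core p : P p -> core_edges H p by move=> /P_edges[].
pose E := common_edges H P cst.
have Ex : inr true |: @label_item k @: [set~ l0] \in E.
  by apply: common_edges_add => //; [apply/imsetP => -[]|move=> p /P_edges[]].
have Ez : inr false |: @label_item k @: [set~ l1] \in E.
  by apply: common_edges_add => //; [apply/imsetP => -[]|move=> p /P_edges[]].
have Elab := common_labels cst P_core.
have Esw a b := common_swaps k0 cst P_core a b.
(* Each of the two copies has only one special vertex. The position of the other goes to the vertex
   swapping labels 0 and 1, which can replace either label. *)
pose skip (u : bool) (y : item k) := if y == inr u then swap_item l0 l1 else y.
have skipL u (D : {set 'I_k}) : skip u @: (@label_item k @: D) = @label_item k @: D.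
  by rewrite imset_labels.
have skip_pattern u : walk_pattern l0 l1 [set a : {set item k} | skip u @: a \in E].
  have [sw0 sw1] := Esw l0 l1; split.
  - by rewrite in_set skipL.
  - by move=> a b _; have [h1 h2] := Esw a b; split; rewrite in_set imsetU1 skipL.
  - by rewrite in_set imsetU1 skipL; case: u.
  - by rewrite in_set imsetU1 skipL; case: u.
pose phi' t : I := if t == tW then inr (l0, l1) else forget l0 l1 (phi t).
have := blowup_dense tU (ltW c10) V0 Pdense phi'; rewrite card_ord -/beta.
move/le_trans; apply; rewrite ler_nat subset_leq_card //; apply/subsetP => v.
rewrite !inE => /existsP[h /andP[/forallP hP /forallP vh]].
have vE t : v t = h (phi' t) t by apply/eqP.
have ks : (k <= s)%N.
  by apply: leq_trans s5; rewrite expnS expn1 mulnCA leq_pmulr // muln_gt0.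
have window u (psi : 'I_s -> 'I_s) e : e \in tight_cycle k s ->
    [set extend (fun i => h i (psi t)) cst (skip u (phi t)) | t in e] \in H.
  move=> eT; have ek := card_tight_cycle_edge ks eT.
  have := hom _ (skip_pattern u) e eT; rewrite inE -imset_comp => eE.
  exact: (@blowup_hom _ _ _ _ _ k H cst P E h _ psi e k0
     (fun p Pp a aE => common_edgesP Pp aE) (fun a aE => common_edges_card aE) hP ek eE).
have phi_inl t : t != tU -> t != tW -> exists2 i, phi t = inl i & phi' t = i.
  move=> tu tw; have := phiU t; have := phiW t; rewrite (negbTE tu) (negbTE tw).
  rewrite /phi' (negbTE tw); by case: (phi t) => [i _ _|[] //]; exists i.
have phiUE : phi tU = inr true by apply/eqP; rewrite phiU.
have phiWE : phi tW = inr false by apply/eqP; rewrite phiW.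
have vW : v tW = h (inr (l0, l1)) tW by rewrite vE /phi' eqxx.
apply/andP; split; apply/forall_inP => e eT.
  have := window false id e eT; congr (_ \in H); apply: eq_imset => t.
  have [->|tu] := eqVneq t tU; first by rewrite phiUE upd_same.
  rewrite upd_neq //; have [->|tw] := eqVneq t tW; first by rewrite phiWE vW.
  by have [i -> iE] := phi_inl t tu tw; rewrite vE iE.
(* Position [tU] reads the copy belonging to [tW], so both copies use the same swapping vertex. *)
have := window true (fun t => if t == tU then tW else t) e eT.
congr (_ \in H); apply: eq_imset => t; rewrite /reroute.
have [->|tw] := eqVneq t tW; first by rewrite phiWE upd_same.
rewrite upd_neq //; have [->|tu] := eqVneq t tU; first by rewrite phiUE upd_same vW.
rewrite upd_neq //.
by have [i -> iE] := phi_inl t tu tw; rewrite vE iE.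
Qed.

Section AbsorberDensity.
Variables (R : realType) (k s : nat) (V : finType) (H : hypergraph V).
Variables (tU tW : 'I_s) (beta : R).
Hypotheses (tUW : tU != tW) (beta_gt0 : 0 < beta) (V_gt0 : (0 < #|V|)%N).
Local Notation n := (#|V|%:R : R).
Hypothesis reach : forall x z : V, beta * n ^+ s <=
  #|[pred v : {ffun 'I_s -> V} | is_hom k H (upd v tU x) && is_hom k H (reroute tU tW v z)]|%:R.

Let s_gt0 : (0 < s)%N. Proof. exact: leq_ltn_trans (ltn_ord tU). Qed.
Let n_gt0 : 0 < n. Proof. by rewrite ltr0n. Qed.

Definition column (a : {ffun 'I_s -> {ffun 'I_s -> V}}) : {ffun 'I_s -> V} :=
  [ffun i => a i tU].

(* The rows of a cover a; in the presence of Q the rows release the column tU,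
   which is a further copy. *)
Definition absorbs (Q : {ffun 'I_s -> V}) (a : {ffun 'I_s -> {ffun 'I_s -> V}}) : bool :=
  is_hom k H (column a) &&
  [forall i, is_hom k H (a i) && is_hom k H (reroute tU tW (a i) (Q i))].

Lemma card_hom : beta * n ^+ s <= #|[pred v : {ffun 'I_s -> V} | is_hom k H v]|%:R.
Proof.
rewrite -(ler_pM2r n_gt0) -[leRHS]natrM (card_sum_upd _ tU).
have -> : (\sum_(v : {ffun 'I_s -> V}) #|[pred x | [pred w | is_hom k H w] (upd v tU x)]| =
    \sum_(x : V) #|[pred v : {ffun 'I_s -> V} | is_hom k H (upd v tU x)]|)%N.
  pose ind (v : {ffun 'I_s -> V}) x : nat := is_hom k H (upd v tU x).
  transitivity (\sum_v \sum_x ind v x)%N.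
    by apply: eq_bigr => v _; rewrite -sum1_card big_mkcond.
  rewrite exchange_big /=; apply: eq_bigr => x _.
  by rewrite -sum1_card [RHS]big_mkcond.
have -> : beta * n ^+ s * n = \sum_(x : V) beta * n ^+ s by rewrite sumr_const mulr_natr.
rewrite natr_sum; apply: ler_sum => x _; apply: le_trans (reach x x) _.
by rewrite ler_nat subset_leq_card //; apply/subsetP => v; rewrite !inE => /andP[].
Qed.

(** The conditions counted by [reach] ignore the entry at [tU], so prescribing it costs just one
    factor |V|. *)
Lemma card_rows (x z : V) : beta * n ^+ s.-1 <=
  #|[pred r : {ffun 'I_s -> V} | (r tU == x) && (is_hom k H r && is_hom k H (reroute tU tW r z))]|%:R.
Proof.
rewrite -(ler_pM2r n_gt0) -[leRHS]natrM (card_sum_upd _ tU) -mulrA -exprSr prednK //.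
apply: le_trans (reach x z) _; rewrite ler_nat -sum1_card big_mkcond.
apply: leq_sum => v _; case: ifP => // /andP[h1 h2].
apply/card_gt0P; exists x; rewrite !inE upd_same eqxx h1 /=.
by move: h2; rewrite /reroute upd_neq 1?eq_sym // upd_upd.
Qed.

(** The column is chosen first, among at least beta |V|^s homomorphisms; it prescribes one entry of
    each row and leaves beta |V|^(s-1) choices for each of the [s] rows. *)
Lemma absorbers_dense (Q : {ffun 'I_s -> V}) :
  beta ^+ s.+1 * n ^+ (s * s) <= #|[pred a | absorbs Q a]|%:R.
Proof.
pose row x z := [pred r : {ffun 'I_s -> V} |
  (r tU == x) && (is_hom k H r && is_hom k H (reroute tU tW r z))].
have -> : #|[pred a | absorbs Q a]| = (\sum_(a | absorbs Q a) 1)%N.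
  by rewrite sum1dep_card; apply: eq_card => a; rewrite !inE.
rewrite (partition_big column (fun u => is_hom k H u)) /=; last by move=> a /andP[].
rewrite natr_sum; apply: le_trans (_ : \sum_(u : {ffun 'I_s -> V} | is_hom k H u)
    (beta * n ^+ s.-1) ^+ s <= _).
  have -> : \sum_(u : {ffun 'I_s -> V} | is_hom k H u) (beta * n ^+ s.-1) ^+ s =
     #|[pred v : {ffun 'I_s -> V} | is_hom k H v]|%:R * (beta * n ^+ s.-1) ^+ s.
    by rewrite sumr_const [RHS]mulr_natl.
  apply: le_trans (ler_wpM2r _ card_hom); last by rewrite exprn_ge0 // mulr_ge0 ?exprn_ge0 // ltW.
  rewrite exprMn -exprM mulrACA -exprS -exprD.
  by rewrite (_ : (s + s.-1 * s)%N = (s * s)%N) // -{1}[s]mul1n -mulnDl add1n prednK.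
apply: ler_sum => u uh.
have -> : (\sum_(a | absorbs Q a && (column a == u)) 1)%N =
    #|family (fun i => row (u i) (Q i))|.
  rewrite sum1dep_card; apply: eq_card => a; rewrite !inE.
  apply/andP/forallP => [[/andP[_ /forallP ha] /eqP au] i|ha].
    by rewrite !inE ha andbT -au ffunE.
  have au : column a = u.
    by apply/ffunP => i; rewrite ffunE; have := ha i; rewrite !inE => /andP[/eqP].
  rewrite au eqxx; split=> //; rewrite /absorbs au uh /=.
  by apply/forallP => i; have := ha i; rewrite !inE => /andP[].
rewrite card_family foldrE big_map big_enum /= natr_prod.
have -> : (beta * n ^+ s.-1) ^+ s = \prod_(i : 'I_s) (beta * n ^+ s.-1).
  by rewrite prodr_const card_ord.
apply: ler_prod => i _; rewrite card_rows andbT mulr_ge0 ?exprn_ge0 //.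
  exact: ltW.
Qed.
End AbsorberDensity.

(** * Tilings of vertex sets and the absorbing mechanism *)

Section Tileable.
Variables (k s : nat) (V : finType) (H : hypergraph V).

Definition tileable (A : {set V}) : Prop :=
  exists T : {set {ffun 'I_s -> V}},
    [/\ forall f, f \in T -> is_copy (tight_cycle k s) H f,
        forall f g, f \in T -> g \in T -> f != g ->
          [disjoint copy_vertices f & copy_vertices g] &
        \bigcup_(f in T) copy_vertices f = A].

Lemma tileable0 : tileable set0.
Proof. by exists set0; split=> [f|f g|]; rewrite ?inE ?big_set0. Qed.

Lemma tileableU (A B : {set V}) : [disjoint A & B] -> tileable A -> tileable B -> tileable (A :|: B).
Proof.
move=> AB [TA [cA dA UA]] [TB [cB dB UB]]; exists (TA :|: TB).
have subA f : f \in TA -> copy_vertices f \subset A by move=> fA; rewrite -UA bigcup_sup.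
have subB f : f \in TB -> copy_vertices f \subset B by move=> fB; rewrite -UB bigcup_sup.
split.
- by move=> f; rewrite inE => /orP[/cA|/cB].
- move=> f g; rewrite !inE => /orP[fA|fB] /orP[gA|gB]; [exact: dA| | |exact: dB].
    by move=> _; apply: disjointWl (subA _ fA) (disjointWr (subB _ gB) AB).
  by move=> _; rewrite disjoint_sym; apply: disjointWl (subA _ gA) (disjointWr (subB _ fB) AB).
by rewrite bigcup_setU UA UB.
Qed.

Lemma tileable_inj (I : finType) (F : I -> {ffun 'I_s -> V}) :
  (forall i, is_hom k H (F i)) -> injective (fun z : I * 'I_s => F z.1 z.2) ->
  tileable [set F z.1 z.2 | z : I * 'I_s].
Proof.
move=> Fh Finj; exists [set F i | i : I]; split.
- move=> f /imsetP[i _ ->]; apply/andP; split; last exact: Fh.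
  by apply/injectiveP => a b ab; have [] := Finj (i, a) (i, b) ab.
- move=> f g /imsetP[i _ ->] /imsetP[j _ ->] ij.
  rewrite disjoints_subset; apply/subsetP => v /imsetP[a _ ->]; rewrite inE.
  apply: contra ij => /imsetP[b _ ab].
  by have [-> _] := Finj (i, a) (j, b) ab.
apply/setP => v; apply/bigcupP/imsetP => [[f /imsetP[i _ ->] /imsetP[a _ ->]]|[[i a] _ ->]].
  by exists (i, a).
by exists (F i); apply: imset_f.
Qed.

Lemma tileable_copy (f : {ffun 'I_s -> V}) :
  is_copy (tight_cycle k s) H f -> tileable (copy_vertices f).
Proof.
move=> fc; exists [set f]; split; last by rewrite big_set1.
- by move=> g /set1P ->.
- by move=> g h /set1P -> /set1P ->; rewrite eqxx.
Qed.

Variables (tU tW : 'I_s).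
Hypothesis tUW : tU != tW.
Local Notation absorber := {ffun 'I_s -> {ffun 'I_s -> V}}.
Local Notation absorbs := (absorbs k H tU tW).
Implicit Types (a : absorber) (fam : seq absorber).

Definition flat a : {ffun 'I_s * 'I_s -> V} := [ffun z => a z.1 z.2].

Definition absorber_set a : {set V} := [set flat a z | z : 'I_s * 'I_s].

Definition good_absorber a : bool := injectiveb (flat a) && [forall i, is_hom k H (a i)].

Lemma good_absorber_tileable a : good_absorber a -> tileable (absorber_set a).
Proof.
move=> /andP[/injectiveP ainj /forallP ah].
rewrite /absorber_set (_ : [set _ | _ : _] = [set a z.1 z.2 | z : 'I_s * 'I_s]).
  apply: (tileable_inj ah) => z z' zz'; apply: ainj; rewrite !ffunE; exact: zz'.
by apply: eq_imset => z; rewrite ffunE.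
Qed.

Lemma absorbs_tileable a (Q : {ffun 'I_s -> V}) :
  injective (flat a) -> injective Q -> absorbs Q a ->
  [disjoint absorber_set a & [set Q i | i : 'I_s]] ->
  tileable (absorber_set a :|: [set Q i | i : 'I_s]).
Proof.
move=> ainj Qinj /andP[ch /forallP ah] aQ.
pose F (o : option 'I_s) := if o is Some i then reroute tU tW (a i) (Q i) else column tU a.
(* Sends a position of one of the s + 1 copies to the place of its vertex in [a] or [Q]; it is onto
   by injectivity and counting. *)
pose theta (z : option 'I_s * 'I_s) : 'I_s * 'I_s + 'I_s :=
  if z.1 is Some i then
    if z.2 == tW then inr i else inl (i, if z.2 == tU then tW else z.2)
  else inl (z.2, tU).
pose val x := match x with inl z => flat a z | inr i => Q i end.
have valinj : injective val.
  have aQn z i : flat a z != Q i.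
    apply/eqP => E; move/pred0P/(_ (Q i)): aQ; rewrite /= -{1}E !imset_f //.
  move=> [z|i] [z'|i'] /= E.
  - by rewrite (ainj _ _ E).
  - by move/eqP: E; rewrite (negbTE (aQn _ _)).
  - by move/esym/eqP: E; rewrite (negbTE (aQn _ _)).
  - by rewrite (Qinj _ _ E).
have thinj : injective theta.
  move=> [[i|] t] [[i'|] t']; rewrite /theta /=.
  - case: (eqVneq t tW) => [->|tw]; case: (eqVneq t' tW) => [->|tw'] // [->] //.
    case: (eqVneq t tU) => [->|tu]; case: (eqVneq t' tU) => [->|tu'] // E.
    + by rewrite E eqxx in tw'.
    + by rewrite E eqxx in tw.
    + by rewrite E.
  - case: (eqVneq t tW) => [->|tw] // [_]; case: (eqVneq t tU) => [_ E|tu E].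
      by move: tUW; rewrite E eqxx.
    by rewrite E eqxx in tu.
  - case: (eqVneq t' tW) => [->|tw] // [_]; case: (eqVneq t' tU) => [_ E|tu E].
      by move: tUW; rewrite E eqxx.
    by rewrite -E eqxx in tu.
  - by case=> ->.
have Fval z : F z.1 z.2 = val (theta z).
  case: z => [[i|] t]; last by rewrite /F /theta /= !ffunE.
  rewrite /F /theta /reroute /=; case: (eqVneq t tW) => [->|tw] /=; first by rewrite upd_same.
  rewrite upd_neq //; case: (eqVneq t tU) => [->|tu]; first by rewrite upd_same [RHS]ffunE.
  by rewrite upd_neq // [RHS]ffunE.
have thsurj x : exists z, theta z = x.
  have : x \in [set theta z | z : option 'I_s * 'I_s].
    rewrite (_ : [set _ | _ : _] = setT) ?inE //; apply/eqP.
    rewrite eqEcard subsetT card_imset // !cardsT card_sum !card_prod card_option !card_ord.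
    by rewrite mulSn addnC leqnn.
  by case/imsetP=> z _ ->; exists z.
rewrite (_ : _ :|: _ = [set F z.1 z.2 | z : option 'I_s * 'I_s]).
  apply: tileable_inj => [[i|] |z z']; first by have /andP[] := ah i.
    exact: ch.
  by rewrite !Fval => /valinj/thinj.
apply/setP => v; apply/setUP/imsetP => [[/imsetP[z _ ->]|/imsetP[i _ ->]]|[z _ ->]].
- by have [y yz] := thsurj (inl z); exists y => //; rewrite Fval yz.
- by have [y yz] := thsurj (inr i); exists y => //; rewrite Fval yz.
rewrite Fval; case: (theta z) => [y|i] /=; [left|right]; exact: imset_f.
Qed.

Definition family_set fam : {set V} := \bigcup_(a <- fam) absorber_set a.

Fixpoint valid_family fam : bool :=
  if fam is a :: fam' then
    [&& good_absorber a, [disjoint absorber_set a & family_set fam'] & valid_family fam']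
  else true.

Lemma valid_family_tileable fam : valid_family fam -> tileable (family_set fam).
Proof.
elim: fam => [_|a fam IH] /=; first by rewrite /family_set big_nil; exact: tileable0.
move=> /and3P[ga da /IH tf]; rewrite /family_set big_cons.
exact: tileableU da (good_absorber_tileable ga) tf.
Qed.

Lemma valid_family_remove fam1 a fam2 : valid_family (fam1 ++ a :: fam2) ->
  [/\ good_absorber a, [disjoint absorber_set a & family_set (fam1 ++ fam2)],
      valid_family (fam1 ++ fam2) &
      family_set (fam1 ++ a :: fam2) = absorber_set a :|: family_set (fam1 ++ fam2)].
Proof.
elim: fam1 => [|b fam1 IH] /=.
  by move=> /and3P[ga da vf]; split=> //; rewrite /family_set big_cons.
move=> /and3P[gb db /IH[ga da vf fE]].
have fbE : family_set (b :: fam1 ++ fam2) = absorber_set b :|: family_set (fam1 ++ fam2).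
  by rewrite /family_set big_cons.
move: db; rewrite fE -setI_eq0 setIUr setU_eq0 !setI_eq0 => /andP[ba db].
split=> //.
- by rewrite fbE -setI_eq0 setIUr setU_eq0 !setI_eq0 da andbT disjoint_sym.
- by rewrite gb db vf.
by rewrite fbE /family_set big_cons -/(family_set _) fE setUCA.
Qed.

Lemma card_absorber_set a : good_absorber a -> #|absorber_set a| = (s * s)%N.
Proof.
by move=> /andP[/injectiveP ainj _]; rewrite card_imset // card_prod card_ord.
Qed.

Lemma card_family_set fam : valid_family fam -> #|family_set fam| = (size fam * (s * s))%N.
Proof.
elim: fam => [_|a fam IH] /=; first by rewrite /family_set big_nil cards0.
move=> /and3P[ga da /IH cf]; rewrite /family_set big_cons -/(family_set _).
by rewrite cardsU (disjoint_setI0 da) cards0 subn0 cf card_absorber_set // mulSn.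
Qed.

Lemma exists_tuple (W : {set V}) : (s <= #|W|)%N ->
  exists Q : {ffun 'I_s -> V}, injective Q /\ [set Q i | i : 'I_s] \subset W.
Proof.
move=> sW; pose Q := [ffun i : 'I_s => enum_val (widen_ord sW i)].
exists Q; split.
  move=> i j; rewrite !ffunE => /enum_val_inj /(congr1 val) /= ij; exact: val_inj.
by apply/subsetP => v /imsetP[i _ ->]; rewrite ffunE enum_valP.
Qed.

(** The set [W] is absorbed [s] vertices at a time. Spending one absorber lowers every count by at
    most one, so the hypothesis passes to m - 1. *)
Lemma family_absorbs (m : nat) fam (W : {set V}) : valid_family fam ->
  #|W| = (m * s)%N -> [disjoint family_set fam & W] ->
  (forall Q, m <= count (absorbs Q) fam)%N -> tileable (family_set fam :|: W).
Proof.
elim: m fam W => [|m IH] fam W vf.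
  rewrite mul0n => /eqP; rewrite cards_eq0 => /eqP -> _ _; rewrite setU0.
  exact: valid_family_tileable.
move=> cW fW cnt.
have [|Q [Qinj QW]] := @exists_tuple W; first by rewrite cW mulSn leq_addr.
set QS := [set Q i | i : 'I_s] in QW.
have : has (absorbs Q) fam by rewrite has_count; apply: leq_trans (cnt Q).
case/hasP=> a ain Qa; case/splitPr: ain vf fW cnt => fam1 fam2 vf fW cnt.
have [ga da vf' fE] := valid_family_remove vf.
have cQS : #|QS| = s by rewrite card_imset // card_ord.
have dQ (B : {set V}) : B \subset family_set (fam1 ++ a :: fam2) -> [disjoint B & W].
  by move=> BF; apply: disjointWl BF fW.
have a_sub : absorber_set a \subset family_set (fam1 ++ a :: fam2) by rewrite fE subsetUl.
have f_sub : family_set (fam1 ++ fam2) \subset family_set (fam1 ++ a :: fam2).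
  by rewrite fE subsetUr.
have t1 : tileable (absorber_set a :|: QS).
  apply: absorbs_tileable => //; first by case/andP: ga => /injectiveP.
  exact: disjointWr QW (dQ _ a_sub).
have t2 : tileable (family_set (fam1 ++ fam2) :|: (W :\: QS)).
  apply: IH => //.
  - by rewrite cardsDS // cW cQS mulSn addKn.
  - exact: disjointWr (subsetDl _ _) (dQ _ f_sub).
  move=> Q'; rewrite -ltnS; apply: leq_trans (cnt Q') _.
  by rewrite !count_cat /= addnCA -add1n leq_add2r leq_b1.
have -> : family_set (fam1 ++ a :: fam2) :|: W =
    (absorber_set a :|: QS) :|: (family_set (fam1 ++ fam2) :|: (W :\: QS)).
  rewrite fE; apply/setP => v; rewrite !in_setU in_setD.
  case: (boolP (v \in QS)) => [/(subsetP QW) ->|_]; first by rewrite !orbT.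
  by rewrite orbF orbA.
apply: tileableU t1 t2; move: da (dQ _ a_sub) (dQ _ f_sub); move: (family_set _) => Fs da dA dF.
rewrite -setI_eq0 setIUr !setIUl !setU_eq0 !setI_eq0 da /=.
apply/and3P; split.
- by rewrite disjoint_sym; apply: disjointWr QW dF.
- exact: disjointWr (subsetDl _ _) dA.
- by rewrite -setI_eq0 setIDA setIC -setIDA setDv setI0.
Qed.
End Tileable.

(** * Greedy choice of an absorbing family *)

Lemma natr_le_exp (R : realType) (c : R) (m : nat) : 0 < c ->
  exists n0 : nat, forall n : nat, (n0 <= n)%N -> n%:R ^+ m <= expR (c * n%:R).
Proof.
(* From [x] on, the Taylor term of degree m + 1 alone exceeds n^m. *)
move=> c0; pose x := (m.+1)`!%:R / c ^+ m.+1.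
have x0 : 0 <= x by rewrite divr_ge0 ?exprn_ge0 ?ler0n // ltW.
exists (Num.bound x) => n nx.
have xn : x <= n%:R by apply: le_trans (ltW (archi_boundP x0)) _; rewrite ler_nat.
have cn0 : 0 <= c * n%:R by rewrite mulr_ge0 ?ler0n // ltW.
apply: le_trans (expR_ge1Dxn m cn0).
apply: le_trans (_ : (c * n%:R) ^+ m.+1 / (m.+1)`!%:R <= _); last by rewrite lerDr.
have f0 : (0 : R) < (m.+1)`!%:R by rewrite ltr0n fact_gt0.
rewrite ler_pdivlMr // exprMn [n%:R ^+ m.+1]exprS mulrA mulrC ler_wpM2r ?exprn_ge0 ?ler0n //.
by rewrite mulrC -ler_pdivrMr ?exprn_gt0.
Qed.

Lemma expRN1_le (R : realType) : expR (- 1) <= 2%:R^-1 :> R.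
Proof.
rewrite expRN lef_pV2 ?posrE ?expR_gt0 ?ltr0n //.
by have := expR_ge1Dx (1 : R).
Qed.

Section AbsorbingFamily.
Variables (R : realType) (k s : nat) (V : finType) (H : hypergraph V).
Variables (tU tW : 'I_s) (b : R).
Hypotheses (b_gt0 : 0 < b) (V_gt0 : (0 < #|V|)%N).
Local Notation n := (#|V|%:R : R).
Local Notation absorber := {ffun 'I_s -> {ffun 'I_s -> V}}.
Local Notation absorbs := (absorbs k H tU tW).
Hypothesis dense : forall Q, b * n ^+ (s * s) <= #|[pred a : absorber | absorbs Q a]|%:R.
Implicit Types (fam : seq absorber) (a : absorber) (Q : {ffun 'I_s -> V}).

Let s_gt0 : (0 < s)%N. Proof. exact: leq_ltn_trans (ltn_ord tU). Qed.
Let n_gt0 : 0 < n. Proof. by rewrite ltr0n. Qed.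

(** A single tuple with few absorbers has large weight, so a small total forces many absorbers for
    every tuple. *)
Definition weight fam Q : R := expR (- (count (absorbs Q) fam)%:R).
Definition total_weight fam : R := \sum_Q weight fam Q.

Definition available fam a : bool :=
  good_absorber k H a && [disjoint absorber_set a & family_set fam].

Lemma flat_inj : injective (@flat s V).
Proof.
move=> a a' /ffunP aa'; apply/ffunP => i; apply/ffunP => j.
by have := aa' (i, j); rewrite !ffunE.
Qed.

Lemma card_flat (P : pred {ffun 'I_s * 'I_s -> V}) :
  (#|[set a : absorber | P (flat a)]| <= #|P|)%N.
Proof.
rewrite -(card_imset _ flat_inj) subset_leq_card //.
by apply/subsetP => v /imsetP[a]; rewrite inE => Pa ->.
Qed.

(** Absorbers with a repeated entry or meeting the family number O((1 + |fam|) |V|^(s^2 - 1)), at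
    most half of the guaranteed supply under the smallness assumption. *)
Lemma available_dense fam Q : valid_family k H fam ->
  ((s * s) ^ 2 + s * s * (size fam * (s * s)))%:R <= b / 2%:R * n ->
  b / 2%:R * n ^+ (s * s) <= #|[set a | available fam a && absorbs Q a]|%:R.
Proof.
move=> vf small.
set F := family_set fam; have cF : #|F| = (size fam * (s * s))%N by exact: card_family_set vf.
pose D := ('I_s * 'I_s)%type; have cD : #|{: D}| = (s * s)%N by rewrite card_prod card_ord.
pose N1 := [pred v : {ffun D -> V} | ~~ injectiveb v].
pose N2 := [pred v : {ffun D -> V} | [exists d, v d \in F]].
have sub : [set a | absorbs Q a] \subset [set a | available fam a && absorbs Q a]
    :|: ([set a : absorber | N1 (flat a)] :|: [set a : absorber | N2 (flat a)]).
  apply/subsetP => a; rewrite !inE => Qa; rewrite Qa andbT /available /good_absorber.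
  case: (boolP (injectiveb (flat a))) => //= ainj.
  have -> : [forall i, is_hom k H (a i)].
    by apply/forallP => i; case/andP: Qa => _ /forallP/(_ i)/andP[].
  rewrite /=; case: (boolP [disjoint _ & _]) => //= /pred0Pn[v /andP[/imsetP[z _ ->] zF]].
  by apply/existsP; exists z.
have := subset_leq_card sub; rewrite cardsE => le1.
have h1 : (#|[set a : absorber | N1 (flat a)]| <= (s * s) ^ 2 * #|V| ^ (s * s).-1)%N.
  by apply: leq_trans (card_flat N1) _; rewrite -cD; exact: card_not_injective.
have h2 : (#|[set a : absorber | N2 (flat a)]| <= s * s * (#|F| * #|V| ^ (s * s).-1))%N.
  by apply: leq_trans (card_flat N2) _; rewrite -{1}cD -cD; exact: card_hits.
have le2 := leq_trans le1 (leq_trans (leq_card_setU _ _) (leq_add (leqnn _)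
  (leq_trans (leq_card_setU _ _) (leq_add h1 h2)))).
have := dense Q; move: le2; rewrite -(ler_nat R) natrD => le2 le3.
have := le_trans le3 le2.
have -> : (((s * s) ^ 2 * #|V| ^ (s * s).-1 + s * s * (#|F| * #|V| ^ (s * s).-1))%N%:R : R) =
    ((s * s) ^ 2 + s * s * (size fam * (s * s)))%:R * n ^+ (s * s).-1.
  by rewrite cF mulnA -mulnDl natrM natrX.
have ss : (0 < s * s)%N by rewrite muln_gt0 s_gt0.
have nE : n ^+ (s * s) = n * n ^+ (s * s).-1 by rewrite -exprS prednK.
have := ler_wpM2r (exprn_ge0 (s * s).-1 (ltW n_gt0)) small.
rewrite -[leRHS]mulrA -nE; move: (_%:R * _) (#|_|%:R) (n ^+ (s * s)) => x1 x2 x3; lra.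
Qed.

Lemma total_weight_gt0 fam : 0 < total_weight fam.
Proof.
have [v _] : exists v : V, v \in V by apply/card_gt0P.
rewrite /total_weight (bigD1 [ffun=> v]) //= ltr_wpDr ?expR_gt0 //.
by apply: sumr_ge0 => Q _; exact: expR_ge0.
Qed.

(** Averaging: every tuple has at least b/2 of all arrays as available absorbers, so some available
    absorber serves tuples carrying b/4 of the total weight. These lose a factor e, at least half of
    their weight. *)
Lemma extend_family fam : valid_family k H fam ->
  ((s * s) ^ 2 + s * s * (size fam * (s * s)))%:R <= b / 2%:R * n ->
  exists a, valid_family k H (a :: fam) /\
    total_weight (a :: fam) <= (1 - b / 8%:R) * total_weight fam.
Proof.
move=> vf small; set Phi := total_weight fam; have Phi0 : 0 < Phi by exact: total_weight_gt0.
pose gain a : R := \sum_Q weight fam Q * (absorbs Q a)%:R.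
have [/existsP[a /andP[av ga]]|] :=
    boolP [exists a, available fam a && (b / 4%:R * Phi <= gain a)]; last first.
  rewrite negb_exists => /forallP noa.
  have upper : \sum_(a | available fam a) gain a <= b / 4%:R * Phi * n ^+ (s * s).
    apply: le_trans (_ : \sum_(a : absorber) b / 4%:R * Phi <= _).
      rewrite big_mkcond /=; apply: ler_sum => a _.
      have := noa a; rewrite negb_and; case: ifP => //= _; last first.
        by rewrite mulr_ge0 ?divr_ge0 ?ler0n // ltW.
      by rewrite -ltNge => /ltW.
    by rewrite sumr_const -[_ *+ #|_|]mulr_natr !card_ffun !card_ord -expnM natrX.
  have lower : b / 2%:R * n ^+ (s * s) * Phi <= \sum_(a | available fam a) gain a.
    rewrite exchange_big /= /Phi /total_weight mulr_sumr; apply: ler_sum => Q _.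
    rewrite -mulr_sumr mulrC ler_wpM2l ?expR_ge0 //.
    apply: le_trans (available_dense Q vf small) _.
    rewrite -natr_sum ler_nat -sum1dep_card big_mkcondr /=.
    by apply: leq_sum => a _; case: (absorbs _ _).
  have := le_trans lower upper; have : 0 < b * n ^+ (s * s) * Phi.
    by rewrite !mulr_gt0 // exprn_gt0.
  have -> : b / 2%:R * n ^+ (s * s) * Phi = (b * n ^+ (s * s) * Phi) / 2%:R by ring.
  have -> : b / 4%:R * Phi * n ^+ (s * s) = (b * n ^+ (s * s) * Phi) / 4%:R by ring.
  by move: (b * _ * _) => x h1 h2; lra.
exists a; split; first by case/andP: av => ga' da; rewrite /= ga' da vf.
have le1 : total_weight (a :: fam) <= Phi - gain a / 2%:R.
  rewrite /total_weight /Phi /gain mulr_suml -sumrB; apply: ler_sum => Q _.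
  rewrite {1}/weight /= natrD opprD expRD -/(weight fam Q).
  have w0 : 0 <= weight fam Q by exact: expR_ge0.
  case: (absorbs Q a); rewrite /= ?mulr1 ?mulr0 ?oppr0 ?expR0 ?mul1r ?mul0r ?subr0 //.
  by have := ler_wpM2r w0 (expRN1_le R); move: (_ * weight fam Q) => y h; lra.
apply: le_trans le1 _; move: ga.
have -> : b / 4%:R * Phi = 2%:R * (b / 8%:R * Phi) by field.
by rewrite mulrBl mul1r; move: (b / 8%:R * Phi) => y h; lra.
Qed.

Lemma build_family (m : nat) : b <= 1 ->
  ((s * s) ^ 2 + s * s * (m * (s * s)))%:R <= b / 2%:R * n ->
  exists fam, [/\ valid_family k H fam, size fam = m &
    total_weight fam <= (1 - b / 8%:R) ^+ m * n ^+ s].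
Proof.
move=> b1; elim: m => [|m IH] small.
  exists [::]; split=> //; rewrite expr0 mul1r /total_weight /weight /= oppr0 expR0.
  by rewrite sumr_const card_ffun card_ord natrX.
have small' : ((s * s) ^ 2 + s * s * (m * (s * s)))%:R <= b / 2%:R * n.
  apply: le_trans small; rewrite ler_nat leq_add2l leq_mul2l leq_mul2r leqnSn.
  by rewrite !orbT.
have [fam [vf sf wf]] := IH small'; rewrite -sf in small'.
have [a [va wa]] := extend_family vf small'.
exists (a :: fam); split=> //=; first by rewrite sf.
apply: le_trans wa _; rewrite exprS -mulrA ler_wpM2l //.
by rewrite subr_ge0 ler_pdivrMr ?ltr0n // mul1r (le_trans b1) // ler1n.
Qed.
End AbsorbingFamily.

Lemma absorbing_set (R : realType) (k s : nat) (g alpha : R) :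
  (1 < k)%N -> (5 * k ^ 2 <= s)%N -> (s %% k != 0)%N -> 0 < g <= 4%:R^-1 -> 0 < alpha ->
  exists (nu : R) (n0 : nat), 0 < nu /\
    forall (V : finType) (H : hypergraph V), (n0 <= #|V|)%N -> uniform k H ->
    (forall S : {set V}, #|S| = k.-1 -> (1/2%:R + g) * #|V|%:R <= #|nb H S|%:R) ->
    exists A : {set V}, [/\ #|A|%:R <= alpha * #|V|%:R, (s %| #|A|)%N &
      forall (W : {set V}) (m : nat), [disjoint A & W] -> #|W| = (m * s)%N ->
        m%:R <= nu * #|V|%:R -> tileable k s H (A :|: W)].
Proof.
move=> k1 s5 sm g01 al0.
have [tU [tW [beta0 [n1 [tUW beta00 reach]]]]] := reach_dense k1 s5 sm g01.
pose beta := Num.min beta0 1.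
have beta_gt0 : 0 < beta by rewrite lt_min beta00 ltr01.
have s0 : (0 < s)%N by exact: leq_ltn_trans (ltn_ord tU).
pose b := beta ^+ s.+1; have b0 : 0 < b by rewrite exprn_gt0.
have b1 : b <= 1 by apply: exprn_ile1; [exact: ltW|rewrite ge_min lexx orbT].
have sR : (0 : R) < s%:R by rewrite ltr0n.
(* The family has about mu |V| absorbers of s^2 vertices. The first bound keeps absorbers available
   throughout, the second keeps their union below alpha |V|. *)
pose mu := Num.min (b / (4%:R * s%:R ^+ 4)) (alpha / s%:R ^+ 2).
have mu0 : 0 < mu by rewrite lt_min !divr_gt0 ?mulr_gt0 ?exprn_gt0 ?ltr0n.
(* With at least mu |V|/2 absorbers, (1 - b/8)^m is at most exp(-2 nu |V|). The initial total |V|^s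
   costs exp(nu |V|), so each tuple keeps at least nu |V| absorbers. *)
pose nu := b * mu / 32%:R; have nu0 : 0 < nu by rewrite !divr_gt0 ?mulr_gt0 ?ltr0n.
have [n2 pe] := natr_le_exp s nu0.
pose x1 := 4%:R * s%:R ^+ 4 / b : R.
pose n0 := (n1 + n2 + Num.bound x1 + Num.bound (2%:R / mu)).+1.
have [ge1 ge2 ge3 ge4] : [/\ (n1 <= n0)%N, (n2 <= n0)%N, (Num.bound x1 <= n0)%N &
    (Num.bound (2%:R / mu) <= n0)%N].
  rewrite /n0; move: (Num.bound x1) (Num.bound (2%:R / mu)) => p q; split.
  - by rewrite -!addnA -addnS leq_addr.
  - by rewrite [(n1 + n2)%N]addnC -!addnA -addnS leq_addr.
  - by rewrite addnAC [(_ + p)%N]addnC -addnS -addnA leq_addr.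
  - by rewrite -addSn leq_addl.
exists nu, n0; split=> // V H nV Hk codeg; set n : R := #|V|%:R.
have V0 : (0 < #|V|)%N by apply: leq_trans nV.
have nn0 : 0 < n by rewrite ltr0n.
have dense (Q : {ffun 'I_s -> V}) :
    b * n ^+ (s * s) <= #|[pred a | absorbs k H tU tW Q a]|%:R.
  apply: absorbers_dense => // x z; apply: le_trans (reach V H x z _ Hk codeg).
    by rewrite ler_wpM2r ?exprn_ge0 ?ler0n // ge_min lexx.
  exact: leq_trans nV.
have nlarge : forall x : R, 0 <= x -> (Num.bound x <= n0)%N -> x <= n.
  move=> x x0 xn; apply: le_trans (ltW (archi_boundP x0)) _.
  by rewrite ler_nat (leq_trans xn).
have x1n : x1 <= n.
  apply: nlarge; last by [].
  by rewrite divr_ge0 ?mulr_ge0 ?exprn_ge0 ?ler0n // ltW.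
have mun : 2%:R <= mu * n.
  rewrite mulrC -ler_pdivrMr //; apply: nlarge; last by [].
  by rewrite divr_ge0 ?ler0n // ltW.
pose m := Num.trunc (mu * n).
have mun0 : 0 <= mu * n by rewrite mulr_ge0 // ltW.
have /andP[m_le m_gt] : (m%:R <= mu * n < m.+1%:R) by exact: truncn_itv.
have m_half : mu * n / 2%:R <= m%:R.
  by move: m_gt; rewrite -natr1; move: (mu * n) mun => y h1 h2; lra.
have small : ((s * s) ^ 2 + s * s * (m * (s * s)))%:R <= b / 2%:R * n.
  have -> : (((s * s) ^ 2 + s * s * (m * (s * s)))%:R : R) = s%:R ^+ 4 + s%:R ^+ 4 * m%:R.
    by rewrite natrD natrX !natrM; ring.
  have h1 : s%:R ^+ 4 <= b / 4%:R * n.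
    move: x1n; rewrite /x1 ler_pdivrMr // [b / 4%:R * n]mulrAC [b * n]mulrC.
    by move: (n * b) (s%:R ^+ 4) => y1 y2; lra.
  have h2 : s%:R ^+ 4 * m%:R <= b / 4%:R * n.
    apply: le_trans (_ : s%:R ^+ 4 * (mu * n) <= _); first by apply: ler_wpM2l => //; rewrite exprn_ge0 ?ler0n.
    rewrite mulrA ler_wpM2r ?ler0n //.
    have : mu <= b / (4%:R * s%:R ^+ 4) by rewrite ge_min lexx.
    rewrite ler_pdivlMr ?mulr_gt0 ?exprn_gt0 ?ltr0n // => h.
    rewrite (_ : s%:R ^+ 4 * mu = mu * (4%:R * s%:R ^+ 4) / 4%:R); last by field.
    by rewrite ler_pM2r ?invr_gt0 ?ltr0n.
  by move: h1 h2; move: (s%:R ^+ 4) (_ * m%:R) => y1 y2 h1 h2; lra.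
have [fam [vf sf wf]] := build_family b0 V0 dense b1 small.
have cA := card_family_set vf; rewrite sf in cA.
exists (family_set fam); split.
- rewrite cA natrM; have : mu <= alpha / s%:R ^+ 2 by rewrite ge_min lexx orbT.
  rewrite ler_pdivlMr ?exprn_gt0 // => h.
  apply: le_trans (_ : mu * n * (s * s)%:R <= _); first by rewrite ler_wpM2r ?ler0n.
  by rewrite mulrAC natrM -expr2 ler_wpM2r ?ler0n.
- by rewrite cA mulnA dvdn_mull.
move=> W m' dW cW m'n; apply: (family_absorbs tUW vf cW dW) => Q.
rewrite leqNgt; apply/negP => cQ.
have : weight R k H tU tW fam Q <= total_weight R k H tU tW fam.
  rewrite /total_weight (bigD1 Q) //= lerDl; apply: sumr_ge0 => Q' _; exact: expR_ge0.
move/le_trans/(_ wf).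
have -> : (1 - b / 8%:R) ^+ m * n ^+ s = n ^+ s * (1 - b / 8%:R) ^+ m by rewrite mulrC.
have e1 : (1 - b / 8%:R) ^+ m <= expR (- (b / 8%:R * m%:R)).
  rewrite -[- (_ * m%:R)]mulNr expRM_natr; apply: lerXn2r.
  - by rewrite nnegrE subr_ge0 ler_pdivrMr ?ltr0n // mul1r (le_trans b1) // ler1n.
  - by rewrite nnegrE expR_ge0.
  - by have := expR_ge1Dx (- (b / 8%:R)).
have e2 : n ^+ s <= expR (nu * n).
  by apply: pe; exact: leq_trans nV.
move=> h; have := le_trans h (ler_pM (exprn_ge0 _ (ltW nn0)) (exprn_ge0 _ _) e2 e1).
rewrite subr_ge0 ler_pdivrMr ?ltr0n // mul1r (le_trans b1) ?ler1n // => /(_ isT).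
rewrite -expRD /weight ler_expR => h2.
have h3 : (count (absorbs k H tU tW Q) fam)%:R <= nu * n.
  by apply: le_trans m'n; rewrite ler_nat ltnW.
have cQ1 : (count (absorbs k H tU tW Q) fam)%:R + 1 <= m'%:R :> R by rewrite natr1 ler_nat.
have h4 : b / 8%:R * m%:R >= 2%:R * (nu * n).
  have -> : 2%:R * (nu * n) = b / 8%:R * (mu * n / 2%:R) by rewrite /nu; field.
  by rewrite ler_pM2l ?divr_gt0 ?ltr0n.
by move: h2 h3 h4 m'n cQ1; move: (nu * n) (_ * m%:R) => y1 y2; lra.
Qed.

(** * Almost perfect tilings *)

(** From 1 - z <= exp(-z) the exponential is at most 1/(1 - z), and (1 + z + 2z^2)(1 - z) = 1 + z^2
    (1 - 2z). *)
Lemma expR_le_quadratic (R : realType) (z : R) :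
  `|z| <= 2%:R^-1 -> expR z <= 1 + z + 2%:R * z ^+ 2.
Proof.
rewrite ler_norml => /andP[z1 z2].
have z3 : 0 < 1 - z by lra.
have : 1 - z <= expR (- z) by have := expR_ge1Dx (- z).
rewrite expRN -[X in X <= _]invrK lef_pV2 ?posrE ?invr_gt0 ?expR_gt0 // => h.
apply: le_trans h _; rewrite -[X in X <= _]mul1r ler_pdivrMr //.
have : 0 <= z ^+ 2 * (1 - 2%:R * z) by apply: mulr_ge0; [exact: sqr_ge0|lra].
have -> : (1 + z + 2%:R * z ^+ 2) * (1 - z) = 1 + z ^+ 2 * (1 - 2%:R * z) by ring.
by lra.
Qed.

(* Removing a copy that is light for vertex_risk hardly increases the potential,
   and a small potential keeps all the shares large: this derandomizes the choice
   of a random copy at each step. *)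
Section Potential.
Variables (R : realType) (k : nat) (V : finType) (H : hypergraph V) (lambda : R).
Hypothesis lambda_ge0 : 0 <= lambda.
Implicit Types (U C S : {set V}).

Definition share U S : R := #|nb H S :&: U|%:R / #|U|%:R.

Definition risk U S : R := expR (- (lambda * share U S)).

Definition potential U : R := \sum_(S : {set V} | #|S| == k.-1) risk U S.

Definition vertex_risk U (v : V) : R :=
  \sum_(S : {set V} | #|S| == k.-1) risk U S * (v \in nb H S)%:R.

Lemma share_ge0 U S : 0 <= share U S.
Proof. by rewrite divr_ge0 ?ler0n. Qed.

Lemma share_le1 U S : share U S <= 1.
Proof.
have [U0|U0] := posnP #|U|; first by rewrite /share U0 invr0 mulr0 ler01.
by rewrite ler_pdivrMr ?ltr0n // mul1r ler_nat subset_leq_card // subsetIr.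
Qed.

Lemma sum_vertex_risk U C :
  \sum_(v in C) vertex_risk U v =
  \sum_(S : {set V} | #|S| == k.-1) risk U S * #|nb H S :&: C|%:R.
Proof.
rewrite exchange_big /=; apply: eq_bigr => S _; rewrite -mulr_sumr; congr (_ * _).
rewrite -natr_sum; congr (_%:R); rewrite -sum1_card [RHS](eq_bigl (fun v => (v \in C) && (v \in nb H S))).
  by rewrite [RHS]big_mkcondr; apply: eq_bigr => v _; case: (v \in nb H S).
by move=> v; rewrite !inE andbC.
Qed.

Lemma potential_ge0 U : 0 <= potential U.
Proof. by apply: sumr_ge0 => S _; exact: expR_ge0. Qed.

(** The exponent changes by lambda (d - |C| f)/(|U| - |C|), with d neighbours in [C] and old share
    f. This is at most rho in absolute value, so the quadratic bound applies. *)
Lemma risk_step U C S (rho : R) : C \subset U -> (#|C| < #|U|)%N ->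
  lambda * #|C|%:R <= rho * (#|U|%:R - #|C|%:R) -> 0 <= rho <= 2%:R^-1 ->
  risk (U :\: C) S <= risk U S * (1 + lambda / (#|U|%:R - #|C|%:R) *
    (#|nb H S :&: C|%:R - #|C|%:R * share U S) + 2%:R * rho ^+ 2).
Proof.
move=> CU cC lr /andP[r0 r2].
set u : R := #|U|%:R in lr *; set s : R := #|C|%:R in lr *.
set d : R := #|nb H S :&: C|%:R; set f := share U S.
have us : 0 < u - s by rewrite subr_gt0 ltr_nat.
have s0 : 0 <= s by rewrite ler0n.
have u0 : 0 < u by lra.
have d0 : 0 <= d by rewrite ler0n.
have ds : d <= s by rewrite ler_nat subset_leq_card // subsetIr.
have f0 := share_ge0 U S; have f1 := share_le1 U S.
have sfE : share (U :\: C) S = (f * u - d) / (u - s).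
  rewrite /share cardsDS // natrB ?subset_leq_card //; congr (_ / _).
  have e : (#|nb H S :&: U| = #|nb H S :&: (U :\: C)| + #|nb H S :&: C|)%N.
    by rewrite -(cardsID C) addnC -setIA (setIidPr CU) setIDA.
  by rewrite /f /share -/u divfK ?gt_eqF // e natrD addrK.
pose z := lambda / (u - s) * (d - s * f).
have zE : - (lambda * share (U :\: C) S) = - (lambda * f) + z.
  by rewrite sfE /z; field; rewrite gt_eqF.
have lrho : lambda / (u - s) * s <= rho.
  by rewrite mulrAC ler_pdivrMr.
have l0 : 0 <= lambda / (u - s) by rewrite divr_ge0 // ltW.
have zr : `|z| <= rho.
  apply: le_trans lrho; rewrite normrM ger0_norm // ler_wpM2l // ler_norml.
  have sf0 := mulr_ge0 s0 f0; have sf1 := ler_wpM2l s0 f1; rewrite mulr1 in sf1.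
  have bnd (a b e : R) : 0 <= a -> a <= b -> 0 <= e -> e <= b -> - b <= e - a <= b.
    by move=> *; apply/andP; split; lra.
  exact: bnd.
rewrite /risk zE expRD ler_wpM2l ?expR_ge0 //.
apply: le_trans (expR_le_quadratic (le_trans zr r2)) _.
rewrite lerD2l ler_pM2l ?ltr0n // -(real_normK (num_real z)).
by apply: lerXn2r => //; rewrite nnegrE ?normr_ge0.
Qed.

(** Summed over [S], the linear terms give the vertex risk of [C] minus |C| times the average over
    [U]; lightness bounds this by 2 zeta |C| times that average, which is at most the potential as
    shares are at most 1. *)
Lemma potential_step U C (zeta rho : R) : C \subset U -> (#|C| < #|U|)%N ->
  lambda * #|C|%:R <= rho * (#|U|%:R - #|C|%:R) -> 0 <= rho <= 2%:R^-1 ->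
  0 <= zeta <= 2%:R^-1 ->
  (1 - zeta) * #|U|%:R * (\sum_(v in C) vertex_risk U v)
     <= #|C|%:R * \sum_(v in U) vertex_risk U v ->
  potential (U :\: C) <= (1 + (2%:R * zeta * rho + 2%:R * rho ^+ 2)) * potential U.
Proof.
move=> CU cC lr rho01 /andP[z0 z2] light; have /andP[r0 _] := rho01.
apply: le_trans (ler_sum _ (fun S _ => risk_step S CU cC lr rho01)) _.
set u : R := #|U|%:R in lr light *; set s : R := #|C|%:R in lr light *.
have us : 0 < u - s by rewrite subr_gt0 ltr_nat.
have s0 : 0 <= s by rewrite ler0n.
have u0 : 0 < u by lra.
set tau := lambda / (u - s).
have t0 : 0 <= tau by rewrite divr_ge0 // ltW.
have ts : tau * s <= rho by rewrite mulrAC ler_pdivrMr.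
pose WC := \sum_(v in C) vertex_risk U v; pose WU := \sum_(v in U) vertex_risk U v.
have -> : \sum_(S : {set V} | #|S| == k.-1) risk U S * (1 + tau *
    (#|nb H S :&: C|%:R - s * share U S) + 2%:R * rho ^+ 2) =
    (1 + 2%:R * rho ^+ 2) * potential U + tau * (WC - s * (WU / u)).
  rewrite /WC /WU !sum_vertex_risk [in X in _ - s * X]mulr_suml.
  rewrite mulr_sumr mulrBr !mulr_sumr -sumrB -big_split /=; apply: eq_bigr => S _.
  by rewrite /share -/u; ring.
have WUu : WU / u <= potential U.
  rewrite /WU sum_vertex_risk mulr_suml; apply: ler_sum => S _.
  rewrite -mulrA -[leRHS]mulr1 ler_wpM2l ?expR_ge0 //; exact: share_le1.
have WU0 : 0 <= WU / u.
  rewrite divr_ge0 ?(ltW u0) // /WU sum_vertex_risk; apply: sumr_ge0 => S _.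
  by rewrite mulr_ge0 ?expR_ge0 ?ler0n.
have WCle : WC - s * (WU / u) <= 2%:R * zeta * s * (WU / u).
  have h : (1 - zeta) * WC <= s * (WU / u).
    by rewrite mulrA ler_pdivlMr // mulrAC.
  have y0 : 0 <= s * (WU / u) by rewrite mulr_ge0.
  have zy : zeta * (s * (WU / u)) <= 2%:R^-1 * (s * (WU / u)) by rewrite ler_wpM2r.
  rewrite -[X in _ <= X]mulrA; move: (s * (WU / u)) h y0 zy => y h y0 zy.
  have [//|lt] := leP (WC - y) (2%:R * zeta * y).
  have : (1 - zeta) * (y + 2%:R * zeta * y) < (1 - zeta) * WC by rewrite ltr_pM2l; lra.
  have zzy := mulr_ge0 z0 (_ : 0 <= (1 - 2%:R * zeta) * y).
  have := zzy (mulr_ge0 (_ : 0 <= 1 - 2%:R * zeta) y0).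
  have h3 : 0 <= 1 - 2%:R * zeta by lra.
  move=> /(_ h3).
  have -> : (1 - zeta) * (y + 2%:R * zeta * y) = y + zeta * ((1 - 2%:R * zeta) * y) by ring.
  by lra.
have P0 := potential_ge0 U.
have step : tau * (WC - s * (WU / u)) <= 2%:R * zeta * rho * potential U.
  apply: le_trans (ler_wpM2l t0 WCle) _.
  have -> : tau * (2%:R * zeta * s * (WU / u)) = 2%:R * zeta * ((tau * s) * (WU / u)) by ring.
  have h := ler_pM (mulr_ge0 t0 s0) WU0 ts WUu.
  have z20 : 0 <= 2%:R * zeta by rewrite mulr_ge0 ?ler0n.
  by have := ler_wpM2l z20 h; rewrite [leRHS]mulrA.
have -> : (1 + (2%:R * zeta * rho + 2%:R * rho ^+ 2)) * potential U =
  (1 + 2%:R * rho ^+ 2) * potential U + 2%:R * zeta * rho * potential U by ring.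
by rewrite lerD2l.
Qed.

Lemma share_from_potential U S (t : R) : 0 < lambda -> #|S| = k.-1 ->
  potential U < expR (- (lambda * t)) -> t <= share U S.
Proof.
move=> l0 cS; rewrite leNgt => h; apply/negP => lt.
have : risk U S <= potential U.
  rewrite /potential (bigD1 S) /=; last exact/eqP.
  by rewrite lerDl; apply: sumr_ge0 => S' _; exact: expR_ge0.
move/le_lt_trans/(_ h); rewrite ltr_expR ltrN2 ltr_pM2l //.
by move/lt_trans/(_ lt); rewrite ltxx.
Qed.

Lemma potential_le U (t : R) : (0 < #|V|)%N -> (forall S, #|S| = k.-1 -> t <= share U S) ->
  potential U <= #|V|%:R ^+ k * expR (- (lambda * t)).
Proof.
move=> V0 tS.
apply: le_trans (_ : \sum_(S : {set V} | #|S| == k.-1) expR (- (lambda * t)) <= _).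
  by apply: ler_sum => S /eqP cS; rewrite ler_expR lerN2 ler_wpM2l // tS.
rewrite sumr_const -[X in X <= _]mulr_natl ler_wpM2r ?expR_ge0 // -natrX ler_nat.
apply: (@leq_trans #|{ffun 'I_k.-1 -> V}|).
  pose im (f : {ffun 'I_k.-1 -> V}) : {set V} := [set f i | i : 'I_k.-1].
  apply: leq_trans (leq_imset_card im predT); rewrite subset_leq_card //.
  apply/subsetP => S /eqP cS; have [f [finj fS]] := @exists_tuple k.-1 V S (eq_leq (esym cS)).
  apply/imsetP; exists f => //; apply/eqP; rewrite eq_sym eqEcard fS cS.
  by rewrite card_imset // card_ord leqnn.
by rewrite card_ffun card_ord; apply: leq_pexp2l => //; exact: leq_pred.
Qed.
End Potential.

Lemma almost_tiling (R : realType) (k s : nat) (delta eps : R) :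
  (1 < k)%N -> (5 * k ^ 2 <= s)%N -> (s %% k != 0)%N ->
  0 < delta <= 20%:R^-1 -> 0 < eps <= 1 ->
  exists n0 : nat, forall (V : finType) (H : hypergraph V) (V0 : {set V}),
    (n0 <= #|V|)%N -> uniform k H ->
    (forall S : {set V}, #|S| = k.-1 ->
       1/2%:R + s%:R^-1/2%:R + 2%:R * delta <= share R H V0 S) ->
    exists (U : {set V}) (t : nat), [/\ U \subset V0, tileable k s H (V0 :\: U),
      (#|U| + t * s = #|V0|)%N & #|U|%:R <= eps * #|V|%:R + s%:R].
Proof.
move=> k1 s5 sm d01 /andP[e0 e1]; have /andP[d0 d20] := d01.
have s0 : (0 < s)%N by apply: leq_trans s5; rewrite muln_gt0 expn_gt0 (ltnW k1).
have sR : (0 : R) < s%:R by rewrite ltr0n.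
(* With lambda = kappa |V| one has lambda s = rho eps |V|, so a step changes an exponent by at most
   rho; and |V|/s steps of factor exp(4 rho^2) amount to exp(kappa delta |V|/2). *)
pose rho := delta * eps / 8%:R; pose kappa := delta * eps ^+ 2 / (8%:R * s%:R).
have r0 : 0 < rho by rewrite !mulr_gt0 ?invr_gt0 ?ltr0n.
have kap0 : 0 < kappa by rewrite divr_gt0 ?mulr_gt0 ?exprn_gt0 ?ltr0n.
have de1 : delta * eps <= delta by rewrite ler_piMr // ltW.
have r4 : rho <= 4%:R^-1 by rewrite /rho; lra.
have r01 : 0 < rho <= 4%:R^-1 by rewrite r0 r4.
have [n1 light] := light_copy k1 s5 sm d01 r01 e0.
have c0 : 0 < kappa * delta / 4%:R by apply: divr_gt0; rewrite ?ltr0n // mulr_gt0.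
have [n2 pe] := natr_le_exp k c0.
exists (n1 + n2).+1 => V H V0 nV Hk shareV0.
have n1V : (n1 <= #|V|)%N by apply: leq_trans nV; rewrite -addnS leq_addr.
have n2V : (n2 <= #|V|)%N by apply: leq_trans nV; rewrite -addSn leq_addl.
have Vpos : (0 < #|V|)%N by apply: leq_trans nV.
set n : R := #|V|%:R; have nn0 : 0 < n by rewrite ltr0n.
pose lambda := kappa * n; have l0 : 0 < lambda by rewrite mulr_gt0.
pose tau : R := 1/2%:R + s%:R^-1/2%:R.
have en0 : 0 < eps * n by rewrite mulr_gt0.
have claim t : (t * s)%:R + eps * n <= #|V0|%:R -> exists U : {set V},
    [/\ U \subset V0, tileable k s H (V0 :\: U), (#|U| + t * s = #|V0|)%N &
        potential k H lambda U <= potential k H lambda V0 * expR (4%:R * rho ^+ 2) ^+ t].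
  elim: t => [_|t IH tle].
    exists V0; split; rewrite ?setDv ?mul0n ?addn0 ?expr0 ?mulr1 //.
    exact: tileable0.
  have tle' : (t * s)%:R + eps * n <= #|V0|%:R.
    by apply: le_trans tle; rewrite lerD2r ler_nat leq_mul2r leqnSn orbT.
  have [U [UV tU cU pU]] := IH tle'.
  have uE : (#|U|%:R : R) + (t * s)%:R = #|V0|%:R by rewrite -natrD cU.
  have us : s%:R + eps * n <= #|U|%:R :> R.
    move: tle; rewrite mulSn natrD -uE; move: (#|U|%:R) ((t * s)%:R) (s%:R) (eps * n) => a b c d.
    by lra.
  have eU : eps * n <= #|U|%:R by apply: le_trans us; rewrite lerDr ltW.
  (* This forces share at least tau + delta for every (k-1)-set. The initial surplus 2 delta leaves
     kappa delta |V| to spend in the exponent: a quarter pays for |V|^k and a half for the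
     removals. *)
  have small : potential k H lambda U < expR (- (lambda * (tau + delta))).
    apply: le_lt_trans pU _.
    have h1 := potential_le (ltW l0) Vpos shareV0; rewrite -/n -/tau in h1.
    have h2 := pe _ n2V; rewrite -/n in h2.
    have ts : t%:R <= n / s%:R.
      rewrite ler_pdivlMr // -natrM ler_nat; apply: leq_trans (max_card V0).
      by rewrite -cU leq_addl.
    have h3 : expR (4%:R * rho ^+ 2) ^+ t <= expR (kappa * delta / 2%:R * n).
      rewrite -expRM_natr ler_expR.
      apply: le_trans (ler_wpM2l _ ts) _; first by rewrite mulr_ge0 ?sqr_ge0 ?ler0n.
      by rewrite /rho /kappa le_eqVlt; apply/orP; left; apply/eqP; field; rewrite gt_eqF.
    have P0 := potential_ge0 k H lambda V0.
    have E0 : 0 <= expR (4%:R * rho ^+ 2) ^+ t by rewrite exprn_ge0 ?expR_ge0.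
    apply: le_lt_trans (ler_pM P0 E0 h1 h3) _.
    apply: le_lt_trans (_ : expR (kappa * delta / 4%:R * n) *
      expR (- (lambda * (tau + 2%:R * delta))) * expR (kappa * delta / 2%:R * n) < _).
      by rewrite ler_wpM2r ?expR_ge0 // ler_wpM2r ?expR_ge0.
    rewrite -!expRD ltr_expR /lambda.
    have : 0 < kappa * n * delta by apply: mulr_gt0 => //; apply: mulr_gt0.
    have -> : kappa * delta / 4%:R * n = kappa * n * delta / 4%:R by ring.
    have -> : kappa * delta / 2%:R * n = kappa * n * delta / 2%:R by ring.
    have -> : kappa * n * (tau + 2%:R * delta) = kappa * n * tau + 2%:R * (kappa * n * delta) by ring.
    rewrite (mulrDr (kappa * n) tau delta); move: (kappa * n * delta) (kappa * n * tau) => x y h; lra.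
  have U0 : (0 : R) < #|U|%:R by apply: lt_le_trans eU.
  have codeg (S : {set V}) : #|S| = k.-1 ->
      (1/2%:R + s%:R^-1/2%:R + delta) * #|U|%:R <= #|nb H S :&: U|%:R.
    by move=> cS; rewrite -ler_pdivlMr //; exact: share_from_potential small.
  have vr0 v : 0 <= vertex_risk k H lambda U v.
    by apply: sumr_ge0 => S _; apply: mulr_ge0; [exact: expR_ge0|exact: ler0n].
  have [f [fcopy fU fw]] := light V H U (vertex_risk k H lambda U) n1V Hk eU codeg vr0.
  pose C := copy_vertices f.
  have cC : #|C| = s.
    by rewrite card_imset ?cardsT ?card_ord //; case/andP: fcopy => /injectiveP.
  have CU : (#|C| < #|U|)%N.
    by rewrite cC -(ltr_nat R); apply: lt_le_trans us; rewrite ltrDl.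
  exists (U :\: C); split.
  - exact: subset_trans (subsetDl _ _) UV.
  - have -> : V0 :\: (U :\: C) = (V0 :\: U) :|: C.
      apply/setP => v; rewrite !inE; case: (boolP (v \in C)) => [vC|_]; rewrite ?orbF ?orbT //=.
      by rewrite (subsetP UV) // (subsetP fU).
    apply: tileableU tU (tileable_copy fcopy).
    by rewrite -setI_eq0 setIDAC setD_eq0 subIset // fU orbT.
  - by rewrite cardsDS // cC mulSn addnA subnK // -cC ltnW.
  rewrite exprSr mulrA; apply: le_trans (_ : _ <= potential k H lambda U * expR (4%:R * rho ^+ 2)) _;
    last by rewrite ler_wpM2r ?expR_ge0.
  have rho2 : 0 <= rho <= 2%:R^-1 by rewrite (ltW r0) (le_trans r4) // lef_pV2 ?posrE ?ltr0n // ler_nat.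
  have lr : lambda * #|C|%:R <= rho * (#|U|%:R - #|C|%:R).
    rewrite cC; apply: le_trans (_ : rho * (eps * n) <= _).
      by rewrite /lambda /rho /kappa le_eqVlt; apply/orP; left; apply/eqP; field; rewrite gt_eqF.
    by rewrite ler_pM2l // lerBrDl.
  have fw' : (1 - rho) * #|U|%:R * (\sum_(v in C) vertex_risk k H lambda U v)
     <= #|C|%:R * \sum_(v in U) vertex_risk k H lambda U v by rewrite cC.
  apply: le_trans (potential_step (ltW l0) fU CU lr rho2 rho2 fw') _.
  rewrite mulrC ler_wpM2l ?potential_ge0 //.
  apply: le_trans (expR_ge1Dx _).
  by rewrite lerD2l expr2; have -> : 2%:R * rho * rho + 2%:R * (rho * rho) = 4%:R * (rho * rho) by ring.
have [small|large] := leP (#|V0|%:R) (eps * n).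
  exists V0, 0%N; split; rewrite ?setDv ?mul0n ?addn0 //; first exact: tileable0.
  by apply: le_trans small _; rewrite lerDl ler0n.
pose t := Num.trunc ((#|V0|%:R - eps * n) / s%:R).
have t_ge0 : 0 <= (#|V0|%:R - eps * n) / s%:R.
  by rewrite divr_ge0 ?subr_ge0 ?ler0n // ltW.
have /andP[t_le t_gt] := truncn_itv t_ge0; rewrite -/t in t_le t_gt.
rewrite ler_pdivlMr // -natrM in t_le; rewrite ltr_pdivrMr // in t_gt.
have [|U [UV tU cU _]] := claim t; first by rewrite -lerBrDr.
exists U, t; split=> //.
have : (#|U|%:R : R) + (t * s)%:R = #|V0|%:R by rewrite -natrD cU.
move: t_gt; rewrite -natr1 mulrDl mul1r -natrM.
by move: ((t * s)%:R) (#|U|%:R) (#|V0|%:R) (s%:R) (eps * n) => a b c d e; lra.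
Qed.

(** * From almost perfect to perfect tilings *)

Lemma min_codegree_le (V : finType) (k : nat) (H : hypergraph V) (S : {set V}) :
  #|S| = k.-1 -> (min_codegree k H <= codegree H S)%N.
Proof.
move=> cS; rewrite /min_codegree.
have := mem_index_enum S; elim: (index_enum _) => // T r IH.
rewrite inE big_cons => /orP[/eqP <-|/IH le]; first by rewrite cS eqxx geq_minl.
by case: ifP => // _; apply: leq_trans (geq_minr _ _) le.
Qed.

Lemma tileable_has_perfect_tiling (k s : nat) (V : finType) (H : hypergraph V) :
  tileable k s H [set: V] -> has_perfect_tiling (tight_cycle k s) H.
Proof.
case=> T [Tcopy Tdisj Tcover]; apply/existsP; exists T; apply/and3P; split.
- by apply/forall_inP.
- apply/forall_inP => f fT; apply/forall_inP => h hT; apply/implyP; exact: Tdisj.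
- by rewrite Tcover.
Qed.

Lemma perfect_tiling (R : realType) (k s : nat) (g : R) :
  (1 < k)%N -> (5 * k ^ 2 <= s)%N -> (s %% k != 0)%N -> 0 < g <= 10%:R^-1 ->
  exists n0 : nat, forall (V : finType) (H : hypergraph V), (n0 <= #|V|)%N ->
    (s %| #|V|)%N -> uniform k H ->
    (forall S : {set V}, #|S| = k.-1 ->
       (1/2%:R + s%:R^-1/2%:R + g) * #|V|%:R <= #|nb H S|%:R) ->
    tileable k s H [set: V].
Proof.
move=> k1 s5 sm /andP[g0 g10].
have s0 : (0 < s)%N by apply: leq_trans s5; rewrite muln_gt0 expn_gt0 (ltnW k1).
have sR : (0 : R) < s%:R by rewrite ltr0n.
have g4 : 0 < g <= 4%:R^-1 by rewrite g0; lra.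
have a0 : 0 < g / 4%:R by lra.
have [nu [n1 [nu0 absorb]]] := absorbing_set k1 s5 sm g4 a0.
(* Setting the absorbing set aside costs g/4 of the codegree; of the remaining 3g/4, the almost
   perfect tiling needs 2 delta = g/2. *)
pose delta := g / 4%:R.
have d01 : 0 < delta <= 20%:R^-1 by rewrite /delta; lra.
(* The uncovered part has at most eps |V| + s vertices, for large |V| at most nu |V| groups of [s],
   which the absorbing set can take. *)
pose eps := Num.min (nu * s%:R / 2%:R) 1.
have eps01 : 0 < eps <= 1.
  by rewrite lt_min ltr01 andbT ge_min lexx orbT andbT !mulr_gt0 ?invr_gt0 ?ltr0n.
have [n2 tile] := almost_tiling k1 s5 sm d01 eps01.
pose n3 := Num.bound (2%:R / nu).
exists (n1 + n2 + n3).+1 => V H nV sV Hk codeg; set n : R := #|V|%:R in codeg.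
have n1V : (n1 <= #|V|)%N by apply: leq_trans nV; rewrite -addnA -addnS leq_addr.
have n2V : (n2 <= #|V|)%N by apply: leq_trans nV; rewrite [(n1 + n2)%N]addnC -addnA -addnS leq_addr.
have n3V : (n3 <= #|V|)%N by apply: leq_trans nV; rewrite -addSn leq_addl.
have V0 : (0 < #|V|)%N by apply: leq_trans nV.
have nn0 : 0 < n by rewrite ltr0n.
have si0 : 0 <= s%:R^-1 / 2%:R :> R by rewrite divr_ge0 ?invr_ge0 ?ler0n.
have codeg1 (S : {set V}) : #|S| = k.-1 -> (1/2%:R + g) * n <= #|nb H S|%:R.
  by move=> cS; apply: le_trans (codeg S cS); rewrite ler_wpM2r ?ler0n // lerD2r lerDl.
have [A [A_small sA A_absorbs]] := absorb V H n1V Hk codeg1; rewrite -/n in A_small.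
have cAC : (#|A| + #|~: A| = #|V|)%N by exact: cardsC.
have cACR : (#|A|%:R : R) + #|~: A|%:R = n by rewrite -natrD cAC.
have AC0 : (0 : R) < #|~: A|%:R.
  have : g / 4%:R * n <= 40%:R^-1 * n by rewrite ler_wpM2r ?ler0n //; lra.
  by move: cACR A_small nn0; move: (#|A|%:R) (#|~: A|%:R) (g / 4%:R * n) => x y w h1 h2 h3 h4; lra.
have shareAC (S : {set V}) : #|S| = k.-1 ->
    1/2%:R + s%:R^-1/2%:R + 2%:R * delta <= share R H (~: A) S.
  move=> cS; rewrite /share ler_pdivlMr //.
  have h1 := codeg S cS.
  have h2 : (#|nb H S|%:R : R) <= #|nb H S :&: ~: A|%:R + #|A|%:R.
    rewrite -natrD ler_nat -(cardsID (~: A)) leq_add2l setDE setCK.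
    by rewrite subset_leq_card // subsetIr.
  have h3 : (1/2%:R + s%:R^-1/2%:R + 2%:R * delta) * #|~: A|%:R <=
      (1/2%:R + s%:R^-1/2%:R + 2%:R * delta) * n.
    rewrite ler_wpM2l ?ler_nat ?max_card //; rewrite /delta.
    by move: si0; move: (s%:R^-1 / 2%:R) => z; lra.
  have gn : 0 <= g * n by rewrite mulr_ge0 ?ltW.
  move: h1 h2 h3 A_small.
  have -> : (1/2%:R + s%:R^-1/2%:R + g) * n = (1/2%:R + s%:R^-1/2%:R) * n + g * n by ring.
  have -> : (1/2%:R + s%:R^-1/2%:R + 2%:R * delta) * n =
    (1/2%:R + s%:R^-1/2%:R) * n + g * n / 2%:R by rewrite /delta; field; rewrite gt_eqF.
  have -> : g / 4%:R * n = g * n / 4%:R by ring.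
  move: gn; move: (g * n) ((1/2%:R + s%:R^-1/2%:R) * n)
    ((1/2%:R + s%:R^-1/2%:R + 2%:R * delta) * #|~: A|%:R) => x y z.
  by move: (#|nb H S|%:R) (#|nb H S :&: ~: A|%:R) (#|A|%:R) => p q r h0 h1 h2 h3 h4; lra.
have [U [t [UA tU cU Usmall]]] := tile V H (~: A) n2V Hk shareAC; rewrite -/n in Usmall.
have sU : (s %| #|U|)%N.
  have sAC : (s %| #|~: A|)%N by rewrite -(dvdn_addr _ sA) cAC.
  by rewrite -(dvdn_addl _ (dvdn_mull t (dvdnn s))) cU.
have cUm : #|U| = (#|U| %/ s * s)%N by rewrite divnK.
have dAU : [disjoint A & U] by rewrite disjoint_sym disjoints_subset.
have m_small : (#|U| %/ s)%:R <= nu * n.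
  rewrite -(ler_pM2r sR) -natrM -cUm; apply: le_trans Usmall _.
  have h1 : eps * n <= nu * s%:R / 2%:R * n by rewrite ler_wpM2r ?ler0n // ge_min lexx.
  have h2 : 2%:R <= n * nu.
    rewrite -ler_pdivrMr //; apply: le_trans (ltW (archi_boundP _)) _; last by rewrite ler_nat.
    by rewrite divr_ge0 ?ler0n // ltW.
  have h3 := ler_wpM2r (ltW sR) h2.
  move: h1 h3; have -> : nu * s%:R / 2%:R * n = n * nu * s%:R / 2%:R by ring.
  have -> : nu * n * s%:R = n * nu * s%:R by ring.
  by move: (eps * n) (n * nu * s%:R) (s%:R) => x y z; lra.
have tAU := A_absorbs U _ dAU cUm m_small.
have -> : [set: V] = (A :|: U) :|: (~: A :\: U).
  by apply/setP => v; rewrite !inE; case: (v \in A); case: (v \in U).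
apply: tileableU tAU tU; rewrite -setI_eq0; apply/eqP/setP => v; rewrite !inE.
by case: (v \in A); case: (v \in U).
Qed.

Theorem theorem1p6 (R : realType) (k s : nat)
    (k_ge2 : (2 <= k)%N) (k_lt_s : (k < s)%N) (s_ge : (5 * k ^ 2 <= s)%N)
    (s_mod : (s <> 0 %[mod k])%N) (gamma : R) (gamma_gt0 : 0 < gamma) :
  exists n0 : nat, forall n : nat,
    (n0 <= n)%N -> (n = 0 %[mod s])%N ->
    (tiling_threshold k n (tight_cycle k s))%:R
      <= (1 / 2%:R + 1 / (2%:R * s%:R) + gamma) * n%:R.
Proof.
have k0 : (0 < k)%N by exact: ltnW.
have sm : (s %% k != 0)%N by apply/eqP => E; apply: s_mod; rewrite E mod0n.
pose g := Num.min gamma 10%:R^-1.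
have g01 : 0 < g <= 10%:R^-1.
  by rewrite lt_min gamma_gt0 invr_gt0 ltr0n ge_min lexx orbT.
have [n0 tile] := perfect_tiling k_ge2 s_ge sm g01.
exists n0 => n n_large /eqP; rewrite mod0n => sn.
set bound := (_ * n%:R).
have bound0 : 0 <= bound.
  by rewrite mulr_ge0 ?ler0n // !addr_ge0 ?divr_ge0 ?mulr_ge0 ?ler0n ?ler01 // ltW.
rewrite /tiling_threshold.
(* The neutral element 0 of the maximum also lies below [bound], so an empty range needs no separate
   treatment. *)
apply: (big_ind (fun m : nat => m%:R <= bound)) => //.
  by move=> x y hx hy; rewrite /maxn; case: ifP.
move=> H /andP[Hk]; apply: contraNT; rewrite -ltNge => Hdeg.
apply: tileable_has_perfect_tiling; apply: tile => //; rewrite ?card_ord //.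
move=> S cS; apply: le_trans (_ : bound <= _).
  rewrite ler_wpM2r ?ler0n // lerD ?ge_min ?lexx // lerD2l.
  by rewrite mul1r invfM mulrC.
apply: le_trans (ltW Hdeg) _.
by rewrite ler_nat -(codegree_nb k0 Hk cS) min_codegree_le.
Qed.
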